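(* Consider a sequence of support recovery problems indexed by $n\to\infty$, with $p=p(n)$, $k=k(n)$, $1\le k<p$, and $\beta_{\min}=\beta_{\min}(n)>0$, where the measurement matrix $X\in\mathbb{R}^{n\times p}$ has i.i.d. entries drawn from any distribution with mean zero and variance one. Then a necessary condition for asymptotically reliable recovery over the signal class $\mathcal{C}(\beta_{\min})$ is $$ n \;>\; \max\bigl\{ f_1(p,k,\beta_{\min}),\; f_2(p,k,\beta_{\min}),\; k-1 \bigr\},$$ (that is, if some sequence of decoders achieves asymptotically reliable recovery over $\mathcal{C}(\beta_{\min})$, then this inequality holds for all sufficiently large $n$), where $$ f_1(p,k,\beta_{\min}) := \frac{\log\binom{p}{k}-1}{\frac12\log\left(1+k\beta_{\min}^2\left(1-\frac{k}{p}\right)\right)},\qquad f_2(p,k,\beta_{\min}) := \frac{\log(p-k+1)-1}{\frac12\log\left(1+\beta_{\min}^2\left(1-\frac{1}{p-k+1}\right)\right)}. $$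
   Context: Observation model: $Y = X\beta + W\in\mathbb{R}^n$, where $X\in\mathbb{R}^{n\times p}$ is a random measurement matrix known to the decoder, $W\sim N(0,I_{n\times n})$ is independent of $X$, and $\beta\in\mathbb{R}^p$ is a fixed unknown vector with exactly $k$ non-zero entries and support $S=\{i:\beta_i\neq0\}$. The signal class $\mathcal{C}(\beta_{\min})$ consists of all such $\beta$ with $|\beta_i|\ge\beta_{\min}$ for all $i\in S$. A decoder is any (measurable) map $g$ producing an estimate $g(Y)$ of the support from the observations $Y$ (it may depend on $X$ and on the problem parameters). Given, for each $k$-subset $S$ of $\{1,\dots,p\}$, a vector $\beta^S\in\mathcal{C}(\beta_{\min})$ with support $S$, the average probability of error is $$p_{err}=\frac{1}{\binom{p}{k}}\sum_{S}\mathbb{P}[g(Y)\ne S\mid S],$$ where the sum is over all $k$-subsets $S$, and the conditional probability is with $\beta=\beta^S$ and over the randomness of $X$ and $W$. Recovery over $\mathcal{C}(\beta_{\min})$ is asymptotically reliable if $p_{err}\to0$ as $n\to\infty$ for every choice of the vectors $\beta^S\in\mathcal{C}(\beta_{\min})$ (equivalently, the supremum of $p_{err}$ over these choices tends to $0$). Logarithms are base 2. *)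

(* Defs.v *)
From HB Require Import structures.
From mathcomp Require Export all_boot all_order all_algebra.
From mathcomp Require Export all_classical all_reals all_analysis.
Export Order.TTheory GRing.Theory Num.Theory.
Export numFieldNormedType.Exports.

Set Implicit Arguments.
Unset Strict Implicit.
Unset Printing Implicit Defensive.

Local Open Scope classical_set_scope.
Local Open Scope ring_scope.

Definition mutually_independent (R : realType) (d : measure_display)
    (Omega : measurableType d) (P : probability Omega R) (I : finType)
    (Z : I -> Omega -> R) : Prop :=
  forall (J : {set I}) (B : I -> set R), (forall i, measurable (B i)) ->
    P (\bigcap_(i in [set` J]) (Z i @^-1` B i)) =
    (\prod_(i in J) P (Z i @^-1` B i))%E.

(* Laws are compared on measurable sets only: library measures are functions
   on all sets, with uncontrolled values outside the sigma-algebra. *)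
Definition has_law (R : realType) (d : measure_display)
    (Omega : measurableType d) (P : probability Omega R)
    (Z : {RV P >-> R}) (m : set R -> \bar R) : Prop :=
  forall A : set R, measurable A -> distribution P Z A = m A.

(* Mutual independence of all the X i j and W i together amounts to: X has
   independent entries, W has independent entries, and W is independent of X.
   In particular W has law N(0, I_n). *)
Definition measurement_model (R : realType) (mu : probability R R)
    (d : measure_display) (Omega : measurableType d) (P : probability Omega R)
    (n p : nat) (X : 'I_n -> 'I_p -> {RV P >-> R}) (W : 'I_n -> {RV P >-> R})
    : Prop :=
  [/\ forall i j, has_law (X i j) mu,
      forall i, has_law (W i) (normal_prob 0 1) &
      mutually_independent P
        (fun s : ('I_n * 'I_p) + 'I_n =>
           match s with
           | inl ij => (X ij.1 ij.2 : Omega -> R)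
           | inr i => (W i : Omega -> R)
           end)].

Definition supp (R : realType) (p : nat) (b : 'cV[R]_p) : {set 'I_p} :=
  [set i | b i 0 != 0]%SET.

Definition signal_class (R : realType) (p k : nat) (bmin : R)
    (b : 'cV[R]_p) : Prop :=
  #|supp b| = k /\ forall i, i \in supp b -> bmin <= `|b i 0|.

(* The first argument is the observation Y, the second the matrix X. *)
Definition decoder (R : realType) (n p : nat) : Type :=
  'cV[R]_n -> 'M[R]_(n, p) -> {set 'I_p}.

(* The product (equivalently, Borel) sigma-algebra on R^n x R^(n x p). *)
Definition observation_sigma (R : realType) (n p : nat)
    : set (set ('cV[R]_n * 'M[R]_(n, p))) :=
  <<s [set A | exists B : set R, measurable B /\
         ((exists i : 'I_n,
             A = [set z : 'cV[R]_n * 'M[R]_(n, p) | B (z.1 i 0)]) \/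
          (exists (i : 'I_n) (j : 'I_p),
             A = [set z : 'cV[R]_n * 'M[R]_(n, p) | B (z.2 i j)]))] >>.

Definition measurable_decoder (R : realType) (n p : nat)
    (g : decoder R n p) : Prop :=
  forall S : {set 'I_p},
    observation_sigma [set z : 'cV[R]_n * 'M[R]_(n, p) | g z.1 z.2 = S].

Section error.
Context (R : realType) (d : measure_display) (Omega : measurableType d)
  (P : probability Omega R) (n p : nat).
Variables (X : 'I_n -> 'I_p -> {RV P >-> R}) (W : 'I_n -> {RV P >-> R}).

Definition measurement_matrix (w : Omega) : 'M[R]_(n, p) :=
  \matrix_(i, j) X i j w.

Definition observation (b : 'cV[R]_p) (w : Omega) : 'cV[R]_n :=
  measurement_matrix w *m b + \col_i W i w.

Definition p_err (k : nat) (g : decoder R n p)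
    (b : {set 'I_p} -> 'cV[R]_p) : R :=
  ('C(p, k)%:R)^-1 * \sum_(S : {set 'I_p} | #|S| == k)
    fine (P [set w | g (observation (b S) w) (measurement_matrix w) <> S]).

End error.

(* The decoders are fixed before the vectors b n S are chosen, so they cannot
   use the values of the non-zero coefficients. *)
Definition asymptotically_reliable (R : realType) (d : nat -> measure_display)
    (Omega : forall n, measurableType (d n))
    (P : forall n, probability (Omega n) R)
    (p k : nat -> nat) (bmin : nat -> R)
    (X : forall n, 'I_n -> 'I_(p n) -> {RV (P n) >-> R})
    (W : forall n, 'I_n -> {RV (P n) >-> R})
    (g : forall n, decoder R n (p n)) : Prop :=
  forall b : forall n, {set 'I_(p n)} -> 'cV[R]_(p n),
    (forall n (S : {set 'I_(p n)}), #|S| = k n ->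
       signal_class (k n) (bmin n) (b n S) /\ supp (b n S) = S) ->
    p_err (X n) (W n) (k n) (g n) (b n) @[n --> \oo] --> (0 : R).

Definition log2 (R : realType) (x : R) : R := ln x / ln 2.

Definition f1 (R : realType) (p k : nat) (bmin : R) : R :=
  (log2 ('C(p, k)%:R) - 1) /
  (2^-1 * log2 (1 + k%:R * bmin ^+ 2 * (1 - k%:R / p%:R))).

Definition f2 (R : realType) (p k : nat) (bmin : R) : R :=
  (log2 (p%:R - k%:R + 1) - 1) /
  (2^-1 * log2 (1 + bmin ^+ 2 * (1 - (p%:R - k%:R + 1)^-1))).

(* Main.v *)
(** For a family of signals at squared distance [sigma^2] from a common vector
    [m], compare each observation with pure noise of variance [1 + sigma^2]
    around [X m]. On the event that the log-likelihood ratio is at most [c], the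
    probability of a correct answer is at most [e^c] times its probability under
    the common law, and these sum to at most 1 over the family. The ratio is
    [n/2 ln(1 + sigma^2)] plus a sum of independent centred quadratic terms.
    Fano's inequality would only bound the mean of that sum; what is needed is
    that it falls below any fixed negative level with a probability bounded
    away from 0. This follows from fourth moments after truncating the signal,
    because the entries of [X] have no moment beyond the second. So if [n] is at
    most [f1] or [f2], the average error stays bounded below as long as
    [n bmin^2] is large. When [n bmin^2] is bounded, two supports that differ by
    a swap cannot be told apart.

    If [n <= k - 1], take a set [B] of [k - 1] indices. With a probability
    bounded below (Odlyzko's column-by-column argument), [n] columns of [B] form
    an invertible matrix. The column of an added index is then a combination of
    them, so adding it amounts to a translation of the coefficients on [B]. When
    these are uniform on a large box the translation is nearly invisible, and
    the supports [B + i] and [B + j] are confused. *)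

From HB Require Import structures.
From mathcomp Require Import measurable_realfun.
From mathcomp Require Import ring lra zify.
Require Import Defs.

Set Implicit Arguments.
Unset Strict Implicit.
Unset Printing Implicit Defensive.

Local Open Scope classical_set_scope.
Local Open Scope ring_scope.

(** * Independence of blocks of coordinates *)

(** No fixed truncation level serves all entry laws and signals. The level is the least power [2^j],
    [j >= 0], at which the [n] rows together lose mass at most 1/2. The truncated law then has
    density at most 2, and minimality makes the level informative: above level 1, either much mass
    is discarded, and truncation lowers the mean of the sum, or much mass sits just below the level,
    and the variance is large. A drop of the mean does no harm, since a small sum is what is wanted.
    Without such a drop, the squared level is at most of the order of the variance, and the fourth
    moment is under control.

    The thresholds [f1] and [f2] belong to two families of flat signals, each centred at its mean:
    all supports of size [k], and the one-point extensions of a fixed set of [k - 1] indices. The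
    squared distance to the centre is the quantity inside the logarithm.

    The decoders are fixed before the signals, so every support may receive its own worst signal.
    Hence it suffices to bound from below an average of suprema over signals, and an average over a
    box of signals may be replaced by such a supremum. *)

Section independence.
Context (R : realType) (d : measure_display) (Omega : measurableType d)
  (P : probability Omega R) (I : finType).
Variable Z : I -> Omega -> R.
Hypothesis mZ : forall i, measurable_fun setT (Z i).
Hypothesis indZ : mutually_independent P Z.

Definition coord_events (J : {set I}) : set (set Omega) :=
  [set A | exists i, i \in J /\ exists2 B : set R, measurable B & A = Z i @^-1` B].

(** A pi-system that contains [coord_events J]. The hypothesis [mutually_independent] speaks of
    exactly these events. *)
Definition rect_events (J : {set I}) : set (set Omega) :=
  [set A | exists2 B : I -> set R, (forall i, measurable (B i)) &
     A = \bigcap_(i in [set` J]) (Z i @^-1` B i)].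

Lemma measurable_rect_events J : rect_events J `<=` measurable.
Proof.
move=> _ [B mB ->]; apply: fin_bigcap_measurable => // i _.
by rewrite -[X in measurable X]setTI; exact: mZ.
Qed.

Lemma setI_rect_events J : setI_closed (rect_events J).
Proof.
move=> _ _ [B mB ->] [C mC ->]; exists (fun i => B i `&` C i) => [i|].
  exact: measurableI.
by rewrite -bigcapI.
Qed.

Lemma sub_coord_rect_events J : coord_events J `<=` rect_events J.
Proof.
move=> _ [i [iJ [B mB ->]]].
exists (fun j => if j == i then B else setT) => [j|]; first by case: ifP.
apply/seteqP; split => w /=; first by move=> Bw j /= jJ; case: eqP => [->|].
by move/(_ i iJ); rewrite eqxx.
Qed.

Lemma setT_rect_events J : rect_events J setT.
Proof. by exists (fun=> setT) => //; apply/seteqP; split. Qed.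

(** Disjointness lets the two families of sets be glued into one family [C]. The intersection is
    then a rectangle over the union of the blocks, and its probability splits into the two
    products. *)
Lemma rect_events_indep (J1 J2 : {set I}) A B : (forall i, i \in J1 -> i \notin J2) ->
  rect_events J1 A -> rect_events J2 B -> (P (A `&` B) = P A * P B)%E.
Proof.
move=> dJ [B1 mB1 ->] [B2 mB2 ->].
pose C i := if i \in J1 then B1 i else B2 i.
have mC i : measurable (C i) by rewrite /C; case: ifP.
have J2J1 i : i \in J2 -> (i \in J1) = false.
  by move=> iJ2; apply/negP => /dJ; rewrite iJ2.
have -> : \bigcap_(i in [set` J1]) (Z i @^-1` B1 i) =
          \bigcap_(i in [set` J1]) (Z i @^-1` C i).
  by apply: eq_bigcapr => i /= iJ; rewrite /C iJ.
have -> : \bigcap_(i in [set` J2]) (Z i @^-1` B2 i) =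
          \bigcap_(i in [set` J2]) (Z i @^-1` C i).
  by apply: eq_bigcapr => i /= iJ; rewrite /C J2J1.
rewrite -bigcap_setU.
have -> : [set` J1] `|` [set` J2] = [set` (J1 :|: J2)%SET].
  by apply/seteqP; split => i /=; rewrite inE => /orP.
rewrite !indZ// (big_setID J1)/=; congr (_ * _)%E; apply: eq_bigl => i; rewrite !inE.
  by case: (i \in J1) => //=; rewrite andbF.
by case: (boolP (i \in J1)) => //= /dJ /negbTE ->.
Qed.

Lemma sigma_rect_events J : <<s coord_events J >> `<=` <<s rect_events J >>.
Proof.
apply: smallest_sub; first exact: smallest_sigma_algebra.
exact: subset_trans (@sub_coord_rect_events J) (@sub_gen_smallest _ _ _).
Qed.

Lemma sigma_rect_measurable J : <<s rect_events J >> `<=` measurable.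
Proof.
by apply: smallest_sub; [exact: sigma_algebra_measurable|exact: measurable_rect_events].
Qed.

Lemma coord_events_measurable J : <<s coord_events J >> `<=` measurable.
Proof. by move=> A /sigma_rect_events; exact: sigma_rect_measurable. Qed.

(** With [A] fixed, both sides are finite measures in [B] that agree on a pi-system, hence on the
    sigma-algebra it generates. *)
Lemma sigma_rect_indep (J1 J2 : {set I}) (A : set Omega) (B : set Omega) :
  measurable A ->
  (forall C, rect_events J2 C -> (P (A `&` C) = P A * P C)%E) ->
  <<s rect_events J2 >> B -> (P (A `&` B) = P A * P B)%E.
Proof.
move=> mA AC sB.
have PA_ge0 : 0 <= fine (P A) by rewrite fine_ge0.
pose m1 : {measure set Omega -> \bar R} := mrestr P mA.
pose m2 : {measure set Omega -> \bar R} := mscale (NngNum PA_ge0) P.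
have H : forall E, <<s rect_events J2 >> E -> m1 E = m2 E.
  apply: (@g_sigma_algebra_measure_unique _ R Omega (rect_events J2)
    (@measurable_rect_events J2) (fun=> setT)).
  - by move=> _; exact: setT_rect_events.
  - by rewrite bigcup_const.
  - exact: setI_rect_events.
  - move=> C rC; rewrite /m1 /m2 /= /mrestr /mscale/= fineK ?fin_num_measure//.
    by rewrite setIC AC.
  - by move=> _; rewrite /m1/= /mrestr setTI (le_lt_trans (probability_le1 P mA)) ?ltry.
have := H B sB; rewrite /m1 /m2 /= /mrestr /mscale/= fineK ?fin_num_measure//.
by rewrite setIC.
Qed.

(** The passage from rectangles to the sigma-algebra is made twice, once per block, with the other
    event held fixed. *)
Lemma block_independence (J1 J2 : {set I}) A B : (forall i, i \in J1 -> i \notin J2) ->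
  <<s coord_events J1 >> A -> <<s coord_events J2 >> B ->
  (P (A `&` B) = P A * P B)%E.
Proof.
move=> dJ sA sB.
apply: (sigma_rect_indep J1 (coord_events_measurable sA) _ (sigma_rect_events sB)).
move=> C rC; rewrite setIC muleC.
apply: (sigma_rect_indep J2 (measurable_rect_events rC) _ (sigma_rect_events sA)).
by move=> D rD; rewrite setIC muleC; exact: rect_events_indep dJ _ _.
Qed.

End independence.

(** * Integrals of functions of independent variables *)

Section decoupling.
Context (R : realType) (d : measure_display) (Omega : measurableType d)
  (P : probability Omega R).
Context (d1 d2 : measure_display) (T1 : measurableType d1) (T2 : measurableType d2).
Variables (U : Omega -> T1) (V : Omega -> T2).
Hypotheses (mU : measurable_fun setT U) (mV : measurable_fun setT V).
Hypothesis indUV : forall A B, measurable A -> measurable B ->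
  (P (U @^-1` A `&` V @^-1` B) = P (U @^-1` A) * P (V @^-1` B))%E.

HB.instance Definition _ := isMeasurableFun.Build _ _ _ _ U mU.
HB.instance Definition _ := isMeasurableFun.Build _ _ _ _ V mV.

Let UV w := (U w, V w).

Let mUV : measurable_fun setT UV.
Proof. exact/measurable_fun_pairP. Qed.

HB.instance Definition _ := isMeasurableFun.Build _ _ _ _ UV mUV.

Let distribution_UV X : measurable X ->
  (distribution P U \x distribution P V)%E X = distribution P UV X.
Proof. by move=> mX; apply: product_measure_unique => // A B mA mB; rewrite /= -indUV. Qed.

(** The joint law of [U] and [V] is the product of their laws, and Tonelli's theorem applies to that
    product. *)
Lemma indep_ge0_integral (f : T1 * T2 -> \bar R) :
  measurable_fun setT f -> (forall x, 0 <= f x)%E ->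
  (\int[P]_w f (U w, V w) = \int[P]_w \int[P]_v f (U w, V v))%E.
Proof.
move=> mf f0.
have -> : (\int[P]_w f (U w, V w) = \int[distribution P UV]_x f x)%E.
  by rewrite ge0_integral_distribution.
rewrite (eq_measure_integral (distribution P U \x distribution P V)%E); last first.
  by move=> A mA _; exact/esym/distribution_UV.
rewrite fubini_tonelli1// ge0_integral_distribution//; last 2 first.
- exact: measurable_fun_fubini_tonelli_F.
- by move=> x; apply: integral_ge0.
apply: eq_integral => w _ /=; rewrite /fubini_F ge0_integral_distribution//.
exact: measurableT_comp.
Qed.

End decoupling.

Section decoupling_real.
Context (R : realType) (d : measure_display) (Omega : measurableType d)
  (P : probability Omega R).
Variables (U V : Omega -> R).
Hypotheses (mU : measurable_fun setT U) (mV : measurable_fun setT V).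
Hypothesis indUV : forall A B, measurable A -> measurable B ->
  (P (U @^-1` A `&` V @^-1` B) = P (U @^-1` A) * P (V @^-1` B))%E.
Hypotheses (iU : P.-integrable setT (EFin \o U)) (iV : P.-integrable setT (EFin \o V)).

HB.instance Definition _ := isMeasurableFun.Build _ _ _ _ U mU.
HB.instance Definition _ := isMeasurableFun.Build _ _ _ _ V mV.

Lemma indep_integrableM : P.-integrable setT (EFin \o (fun w => U w * V w)).
Proof.
apply/integrableP; split; first exact/measurable_EFinP/measurable_funM.
have := indep_ge0_integral mU mV indUV (f := fun x => (`|x.1| * `|x.2|)%:E).
move=> H; under eq_integral do rewrite /= normrM.
rewrite H; last 2 first.
- apply/measurable_EFinP/measurable_funM; apply: measurableT_comp => //.
- by move=> x; rewrite lee_fin mulr_ge0.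
have /integrableP[_ /= fU] := iU; have /integrableP[_ /= fV] := iV.
have mabs (W : Omega -> R) : measurable_fun setT W ->
    measurable_fun setT (fun v => `|W v|%:E).
  by move=> mW; apply/measurable_EFinP; exact: measurableT_comp.
under eq_integral => w _.
  under eq_integral do rewrite /= EFinM.
  rewrite ge0_integralZl//; last exact: mabs.
  over.
rewrite ge0_integralZr//; last 2 first.
- exact: mabs.
- by apply: integral_ge0 => *; rewrite lee_fin.
by rewrite lte_mul_pinfty// ?integral_ge0// ge0_fin_numE ?integral_ge0.
Qed.

Let UV w := (U w, V w).
Let mUV : measurable_fun setT UV.
Proof. exact/measurable_fun_pairP. Qed.
HB.instance Definition _ := isMeasurableFun.Build _ _ _ _ UV mUV.

Lemma indep_RintegralM :
  \int[P]_w (U w * V w) = (\int[P]_w U w) * (\int[P]_w V w).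
Proof.
rewrite /Rintegral -fineM; last 2 first.
- exact: integrable_fin_num.
- exact: integrable_fin_num.
congr fine.
have D X : measurable X ->
    (distribution P U \x distribution P V)%E X = distribution P UV X.
  by move=> mX; apply: product_measure_unique => // A B mA mB; rewrite /= -indUV.
pose f (x : R * R) := (x.1 * x.2)%:E.
have mf : measurable_fun setT f by exact/measurable_EFinP/measurable_funM.
have -> : (\int[P]_w (U w * V w)%:E = \int[distribution P UV]_x f x)%E.
  by rewrite integral_distribution//; exact: indep_integrableM.
rewrite (eq_measure_integral (distribution P U \x distribution P V)%E); last first.
  by move=> A mA _; exact/esym/D.
have If : (distribution P U \x distribution P V)%E.-integrable setT f.
  apply/integrableP; split => //.
  rewrite (eq_measure_integral (distribution P UV)); last by move=> A mA _; exact: D.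
  have : (distribution P UV).-integrable setT f.
    by apply: integrable_pushforward => //; exact: indep_integrableM.
  by case/integrableP.
rewrite -integral12_prod_meas1// .
have EU : (\int[distribution P U]_x x%:E = \int[P]_w (U w)%:E)%E.
  by rewrite integral_distribution.
have EV : (\int[distribution P V]_x x%:E = \int[P]_w (V w)%:E)%E.
  by rewrite integral_distribution.
have IU : (distribution P U).-integrable setT (EFin : R -> \bar R).
  exact: integrable_pushforward.
have IV : (distribution P V).-integrable setT (EFin : R -> \bar R).
  exact: integrable_pushforward.
rewrite -EU -EV.
rewrite -(fineK (integrable_fin_num measurableT IV)) -integralZr//.
apply: eq_integral => x _; rewrite fineK ?(integrable_fin_num measurableT IV)//.
by rewrite /f/= -integralZl.
Qed.

End decoupling_real.

(** The carrier [Omega] with the sigma-algebra of the coordinates in [J]. That a function depends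
    only on these coordinates becomes measurability from [sub_sigma Z J], and independence of two
    functions follows from disjointness of their index sets. *)
Definition sub_sigma (R : realType) (d : measure_display) (Omega : measurableType d)
    (I : finType) (Z : I -> Omega -> R) (J : {set I}) :=
  g_sigma_algebraType (coord_events Z J).

Section sub_sigma.
Context (R : realType) (d : measure_display) (Omega : measurableType d)
  (P : probability Omega R) (I : finType).
Variable Z : I -> Omega -> R.
Hypothesis mZ : forall i, measurable_fun setT (Z i).
Hypothesis indZ : mutually_independent P Z.

Lemma measurable_sub_sigma_coord (J : {set I}) i : i \in J ->
  measurable_fun setT (Z i : sub_sigma Z J -> R).
Proof.
move=> iJ _ B mB; rewrite setTI; apply: sub_sigma_algebra.
by exists i; split => //; exists B.
Qed.

Lemma measurable_sub_sigma_id J :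
  measurable_fun setT (id : Omega -> sub_sigma Z J).
Proof.
by move=> _ B mB; rewrite setTI; exact: (coord_events_measurable mZ mB).
Qed.

Lemma measurable_sub_sigma d' (T : measurableType d') J (f : Omega -> T) :
  measurable_fun setT (f : sub_sigma Z J -> T) -> measurable_fun setT f.
Proof. by move=> mf; exact: (measurableT_comp mf (@measurable_sub_sigma_id J)). Qed.

Lemma sub_sigma_indep d1 d2 (T1 : measurableType d1) (T2 : measurableType d2)
    (J1 J2 : {set I}) (f : Omega -> T1) (g : Omega -> T2) A B :
  (forall i, i \in J1 -> i \notin J2) ->
  measurable_fun setT (f : sub_sigma Z J1 -> T1) ->
  measurable_fun setT (g : sub_sigma Z J2 -> T2) ->
  measurable A -> measurable B ->
  (P (f @^-1` A `&` g @^-1` B) = P (f @^-1` A) * P (g @^-1` B))%E.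
Proof.
move=> dJ mf mg mA mB; apply: (block_independence mZ indZ dJ).
  by rewrite -[X in <<s _ >> X]setTI; exact: mf.
by rewrite -[X in <<s _ >> X]setTI; exact: mg.
Qed.

Lemma sub_sigma_integrableM (J1 J2 : {set I}) (U V : Omega -> R) :
  (forall i, i \in J1 -> i \notin J2) ->
  measurable_fun setT (U : sub_sigma Z J1 -> R) ->
  measurable_fun setT (V : sub_sigma Z J2 -> R) ->
  P.-integrable setT (EFin \o U) -> P.-integrable setT (EFin \o V) ->
  P.-integrable setT (EFin \o (fun w => U w * V w)).
Proof.
move=> dJ mU mV iU iV; apply: indep_integrableM => //.
- exact: measurable_sub_sigma mU.
- exact: measurable_sub_sigma mV.
- by move=> *; exact: sub_sigma_indep dJ _ _ _ _.
Qed.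

Lemma sub_sigma_RintegralM (J1 J2 : {set I}) (U V : Omega -> R) :
  (forall i, i \in J1 -> i \notin J2) ->
  measurable_fun setT (U : sub_sigma Z J1 -> R) ->
  measurable_fun setT (V : sub_sigma Z J2 -> R) ->
  P.-integrable setT (EFin \o U) -> P.-integrable setT (EFin \o V) ->
  \int[P]_w (U w * V w) = (\int[P]_w U w) * (\int[P]_w V w).
Proof.
move=> dJ mU mV iU iV; apply: indep_RintegralM => //.
- exact: measurable_sub_sigma mU.
- exact: measurable_sub_sigma mV.
- by move=> *; exact: sub_sigma_indep dJ _ _ _ _.
Qed.

(** Coordinate [i] may be redrawn from its law while the others stay, because [f] reads its first
    argument through the sigma-algebra of the other coordinates. Both the Gaussian change of measure
    and the bound on singular matrices reduce to one real variable in this way. *)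
Lemma resample_coord i (m : {measure set R -> \bar R})
    (f : sub_sigma Z [set~ i] * R -> \bar R) :
  (forall A, measurable A -> P (Z i @^-1` A) = m A) ->
  measurable_fun setT f -> (forall x, 0 <= f x)%E ->
  (\int[P]_w f (w, Z i w) = \int[P]_w \int[m]_t f (w, t))%E.
Proof.
move=> lawZ mf f0.
(* The other coordinates are represented by the identity from [Omega] to [sub_sigma Z [set~ i]], so
   no product space has to be built. *)
rewrite (@indep_ge0_integral _ _ _ P _ _ (sub_sigma Z [set~ i]) R id (Z i))//.
- apply: eq_integral => w _.
  pose Zi : {mfun Omega >-> R} := HB.pack (Z i) (isMeasurableFun.Build _ _ _ _ _ (mZ i)).
  have mfw : measurable_fun setT (fun t : R => f (w, t)).
    by apply: (@measurableT_comp _ _ _ _ _ _ f) => //; exact: measurable_pair1.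
  rewrite -(@ge0_integral_distribution _ _ _ _ _ P Zi (fun t => f (w, t)))//.
  by apply: eq_measure_integral => A mA _; exact: lawZ.
- exact: measurable_sub_sigma_id.
- move=> A B mA mB; apply: (@sub_sigma_indep _ _ _ R [set~ i] [set i]) => //.
  + by move=> j; rewrite !inE.
  + by apply: measurable_sub_sigma_coord; rewrite inE.
Qed.

End sub_sigma.

(** * Real-valued expectations *)

Section real_expectation.
Context (R : realType) (d : measure_display) (T : measurableType d).
Variable P : probability T R.
Implicit Types f g : T -> R.

Definition rintegrable f := P.-integrable setT (EFin \o f).

Lemma rintegrable_cst c : rintegrable (fun=> c).
Proof. exact: finite_measure_integrable_cst. Qed.

Lemma rintegrable_measurable f : rintegrable f -> measurable_fun setT f.
Proof. by move=> /measurable_int/measurable_EFinP. Qed.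

Lemma rintegrableD f g : rintegrable f -> rintegrable g ->
  rintegrable (fun x => f x + g x).
Proof. by move=> intf intg; exact: (integrableD measurableT intf intg). Qed.

Lemma rintegrableB f g : rintegrable f -> rintegrable g ->
  rintegrable (fun x => f x - g x).
Proof. by move=> intf intg; exact: (integrableB measurableT intf intg). Qed.

Lemma rintegrableZ c f : rintegrable f -> rintegrable (fun x => c * f x).
Proof. by move=> intf; exact: (integrableZl measurableT c intf). Qed.

Lemma rintegrable_sum (I : Type) (s : seq I) (F : I -> T -> R) :
  (forall i, rintegrable (F i)) -> rintegrable (fun x => \sum_(i <- s) F i x).
Proof.
move=> intF; elim: s => [|i s IH].
  rewrite (_ : (fun x => _) = fun=> 0); first exact: rintegrable_cst.
  by apply/funext => x; rewrite big_nil.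
rewrite (_ : (fun x => _) = fun x => F i x + \sum_(j <- s) F j x).
  exact: rintegrableD.
by apply/funext => x; rewrite big_cons.
Qed.

Lemma rintegrable_le f g : measurable_fun setT f -> (forall x, `|f x| <= g x) ->
  rintegrable g -> rintegrable f.
Proof.
move=> mf fg; apply: le_integrable => //; first exact/measurable_EFinP.
by move=> x _ /=; rewrite lee_fin (le_trans (fg x))// ler_norm.
Qed.

Lemma rintegrable_bounded f c : measurable_fun setT f -> (forall x, `|f x| <= c) ->
  rintegrable f.
Proof. by move=> mf fc; exact: (rintegrable_le mf fc (rintegrable_cst c)). Qed.

Lemma ERintegral_cst c : \int[P]_x c = c.
Proof. by rewrite Rintegral_cst// [X in fine X]probability_setT mulr1. Qed.

Lemma ERintegralD f g : rintegrable f -> rintegrable g ->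
  \int[P]_x (f x + g x) = \int[P]_x f x + \int[P]_x g x.
Proof. by move=> intf intg; rewrite RintegralD. Qed.

Lemma ERintegralB f g : rintegrable f -> rintegrable g ->
  \int[P]_x (f x - g x) = \int[P]_x f x - \int[P]_x g x.
Proof. by move=> intf intg; rewrite RintegralB. Qed.

Lemma ERintegralZ c f : rintegrable f ->
  \int[P]_x (c * f x) = c * \int[P]_x f x.
Proof. by move=> intf; rewrite RintegralZl. Qed.

Lemma ERintegral_le f g : rintegrable f -> rintegrable g ->
  (forall x, f x <= g x) -> \int[P]_x f x <= \int[P]_x g x.
Proof. by move=> intf intg fg; apply: le_Rintegral. Qed.

Lemma ERintegral_ge0 f : (forall x, 0 <= f x) -> 0 <= \int[P]_x f x.
Proof. by move=> f0; apply: Rintegral_ge0. Qed.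

Lemma ERintegral_sum (I : Type) (s : seq I) (F : I -> T -> R) :
  (forall i, rintegrable (F i)) ->
  \int[P]_x (\sum_(i <- s) F i x) = \sum_(i <- s) \int[P]_x F i x.
Proof.
move=> intF; elim: s => [|i s IH].
  rewrite big_nil (_ : (fun x => _) = fun=> 0); first exact: ERintegral_cst.
  by apply/funext => x; rewrite big_nil.
rewrite big_cons -IH -ERintegralD//; last exact: rintegrable_sum.
by congr (Rintegral _ _ _); apply/funext => x; rewrite big_cons.
Qed.

Lemma rintegrable_indic A : measurable A -> rintegrable \1_A.
Proof.
move=> mA; apply: (rintegrable_bounded (c := 1)) => [|x].
  exact: measurable_indic.
by rewrite indicE; case: (x \in A) => /=; rewrite ?normr1 ?normr0.
Qed.

Lemma ERintegral_indic A : measurable A -> \int[P]_x (\1_A x) = fine (P A).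
Proof. by move=> mA; rewrite /Rintegral integral_indic// setIT. Qed.

Lemma ERintegralE f : rintegrable f ->
  (\int[P]_x (f x)%:E)%E = (\int[P]_x f x)%:E.
Proof. by move=> intf; rewrite /Rintegral fineK//; exact: integrable_fin_num. Qed.

Lemma rintegrable_ge0 f : measurable_fun setT f -> (forall x, 0 <= f x) ->
  (\int[P]_x (f x)%:E < +oo)%E -> rintegrable f.
Proof.
move=> mf f0 fy; apply/integrableP; split; first exact/measurable_EFinP.
by under eq_integral do rewrite /= ger0_norm//.
Qed.

Lemma markov_prob f c : rintegrable f -> (forall x, 0 <= f x) -> 0 < c ->
  fine (P [set x | c <= f x]) <= (\int[P]_x f x) / c.
Proof.
move=> intf f0 c0; have mf := rintegrable_measurable intf.
have mA : measurable [set x | c <= f x].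
  by rewrite -[X in measurable X]setTI; exact: measurable_fun_le.
rewrite -ERintegral_indic// ler_pdivlMr// mulrC -ERintegralZ; last exact: rintegrable_indic.
apply: ERintegral_le => //; first exact/rintegrableZ/rintegrable_indic.
by move=> x; rewrite indicE; case: (boolP (x \in _)) => [|_]; rewrite ?mulr0 ?mulr1// inE.
Qed.

Lemma fine_probD (A B : set T) : measurable A -> measurable B ->
  fine (P (A `|` B)) <= fine (P A) + fine (P B).
Proof.
move=> mA mB; rewrite -fineD ?fin_num_measure//.
by rewrite fine_le ?fin_numD ?fin_num_measure//; [exact: measurableU|exact: measureU2].
Qed.

Lemma fine_probC (A : set T) : measurable A ->
  fine (P (~` A)) = 1 - fine (P A).
Proof.
by move=> mA; rewrite probability_setC// fineB ?fin_num_measure.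
Qed.

Lemma fine_prob_le (A B : set T) : measurable A -> measurable B -> A `<=` B ->
  fine (P A) <= fine (P B).
Proof.
by move=> mA mB AB; rewrite fine_le ?fin_num_measure// le_measure// ?inE.
Qed.

Lemma fine_prob_le1 (A : set T) : measurable A -> fine (P A) <= 1.
Proof.
by move=> mA; rewrite -[leRHS]/(fine 1%E) fine_le ?fin_num_measure ?probability_le1.
Qed.

End real_expectation.

(** * Gaussian variables *)

Section gaussian.
Context {R : realType}.
Local Notation leb := (@lebesgue_measure R).

Lemma measurable_affine (b s : R) : measurable_fun setT (fun t : R => b + s * t).
Proof. by apply: measurable_funD => //; apply: measurable_funM. Qed.

Lemma lebesgue_affine (b s : R) (A : set R) : 0 < s -> measurable A ->
  leb A = (s%:E * leb [set t : R | A (b + s * t)%R])%E.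
Proof.
move=> s0 mA.
have maff : measurable_fun setT
    ((fun t : R => b + s * t) : measurableTypeR R -> measurableTypeR R).
  exact: measurable_affine.
pose m' : {measure set (measurableTypeR R) -> \bar R} :=
  mscale (NngNum (ltW s0)) (pushforward leb (fun t => b + s * t : measurableTypeR R)).
pose m := m' maff.
have -> : (s%:E * leb [set t : R | A (b + s * t)%R])%E = m A by [].
apply: lebesgue_measure_unique => // X /= ocX.
have [xy _ <-] := ocX.
rewrite /m/= /mscale/= /pushforward/=.
have -> : (fun t : R => b + s * t) @^-1` `]xy.1, xy.2]%classic =
    `](xy.1 - b) / s, (xy.2 - b) / s]%classic.
  apply/seteqP; split => t /=; rewrite !in_itv/= ltr_pdivrMr// ler_pdivlMr//.
    by move=> /andP[h1 h2]; apply/andP; split; lra.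
  by move=> /andP[h1 h2]; apply/andP; split; lra.
rewrite !lebesgue_measure_itv/= !lte_fin ltr_pM2r ?invr_gt0// ltrD2r.
case: ifPn => // _; last by rewrite mule0.
rewrite -EFinM; congr EFin; rewrite -mulrBl mulrCA divff ?gt_eqF//; lra.
Qed.

Lemma ge0_integral_affine (b s : R) (f : R -> \bar R) : 0 < s ->
  measurable_fun setT f -> (forall x, 0 <= f x)%E ->
  (\int[leb]_y f y = s%:E * \int[leb]_t f (b + s * t)%R)%E.
Proof.
move=> s0 mf f0.
have maff : measurable_fun setT
    ((fun t : R => b + s * t) : measurableTypeR R -> measurableTypeR R).
  exact: measurable_affine.
pose m' : {measure set (measurableTypeR R) -> \bar R} :=
  mscale (NngNum (ltW s0)) (pushforward leb (fun t => b + s * t : measurableTypeR R)).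
pose m := m' maff.
rewrite (eq_measure_integral m); last first.
  by move=> A mA _; rewrite [LHS](lebesgue_affine b s0).
rewrite ge0_integral_mscale//=; congr (_ * _)%E.
by rewrite ge0_integral_pushforward//; exact: measurable_affine.
Qed.

(** The Radon-Nikodym derivative is determined only almost everywhere; it is identified with
    [normal_pdf] by comparing integrals over measurable sets. *)
Lemma ge0_integral_normal_prob (m s : R) (f : R -> \bar R) :
  measurable_fun setT f -> (forall x, 0 <= f x)%E ->
  (\int[normal_prob m s]_x f x = \int[leb]_x (f x * (normal_pdf m s x)%:E))%E.
Proof.
move=> mf f0.
have dom := @normal_prob_dominates R m s.
rewrite -(Radon_Nikodym_SigmaFinite.change_of_variables dom f0 measurableT mf).
have intf := Radon_Nikodym_SigmaFinite.f_integrable dom.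
have mpdf : measurable_fun setT (fun x => (normal_pdf m s x)%:E).
  by apply/measurable_EFinP; exact: measurable_normal_pdf.
apply: ae_eq_integral => //.
- by apply: emeasurable_funM => //; exact: (measurable_int _ intf).
- exact: emeasurable_funM.
- apply: ae_eqe_mul2l => /=; apply: integral_ae_eq => // E _ mE.
  by rewrite -(Radon_Nikodym_SigmaFinite.f_integral dom).
Qed.

Definition borel_id (x : measurableTypeR R) : R := x.

Lemma measurable_borel_id : measurable_fun setT borel_id.
Proof. by move=> _ B mB; rewrite setTI. Qed.

HB.instance Definition _ := isMeasurableFun.Build _ _ _ _ borel_id measurable_borel_id.

(* [normal_prob] lives on [measurableTypeR R], whose display differs from that
   of [R]; this is the same measure, on [R]. *)
Definition gauss : probability R R :=
  distribution (normal_prob (0 : R) 1) borel_id.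

Lemma ge0_integral_gauss (f : R -> \bar R) :
  measurable_fun setT f -> (forall x, 0 <= f x)%E ->
  (\int[gauss]_x f x = \int[leb]_x (f x * (normal_pdf 0 1 x)%:E))%E.
Proof.
move=> mf f0; rewrite -ge0_integral_normal_prob//.
by rewrite ge0_integral_distribution.
Qed.

Lemma ge0_integral_gauss_shift (a : R) (f : R -> \bar R) :
  measurable_fun setT f -> (forall x, 0 <= f x)%E ->
  (\int[gauss]_t f (a + t)%R = \int[leb]_y (f y * (normal_pdf 0 1 (y - a)%R)%:E))%E.
Proof.
move=> mf f0; have mfa : measurable_fun setT (fun t : R => f (a + t)).
  by apply: measurableT_comp => //; apply: measurable_funD.
rewrite (ge0_integral_gauss mfa (fun=> f0 _)).
rewrite [RHS](ge0_integral_affine a ltr01)//.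
- rewrite mul1e; apply: eq_integral => x _; rewrite mul1r.
  by congr (_ * (normal_pdf _ _ _)%:E)%E; lra.
- apply: emeasurable_funM => //; apply/measurable_EFinP.
  apply: (measurableT_comp (measurable_normal_pdf _ _)).
  by apply: measurable_funB.
- by move=> x; rewrite mule_ge0// lee_fin normal_pdf_ge0.
Qed.

Lemma normal_pdf01E (t : R) : normal_pdf 0 1 t = normal_peak 1 * expR (- t ^+ 2 / 2).
Proof.
by rewrite normal_pdfE ?oner_eq0// /normal_fun subr0 expr1n.
Qed.

(* [r y] is the ratio at [y] of the density of [N(a, 1)] to that of [N(b, s^2)]. *)
Lemma gauss_change_of_measure (a b s : R) (f : R -> \bar R) : 0 < s ->
  measurable_fun setT f -> (forall x, 0 <= f x)%E ->
  let r y := s * expR (- (y - a) ^+ 2 / 2 + ((y - b) / s) ^+ 2 / 2) in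
  (\int[gauss]_t f (a + t)%R =
   \int[gauss]_t (f (b + s * t)%R * (r (b + s * t)%R)%:E))%E.
Proof.
move=> s0 mf f0 r.
have mr : measurable_fun setT r.
  apply: measurable_funM => //; apply: measurableT_comp => //.
  apply: measurable_funD; apply: measurable_funM => //.
    by apply: measurableT_comp => //; apply: measurable_funX; apply: measurable_funB.
  by apply: measurable_funX; apply: measurable_funM => //; apply: measurable_funB.
have r0 y : 0 <= r y by rewrite mulr_ge0 ?expR_ge0// ltW.
rewrite ge0_integral_gauss_shift// (ge0_integral_affine b s0); last 2 first.
- apply: emeasurable_funM => //; apply/measurable_EFinP.
  apply: (measurableT_comp (measurable_normal_pdf _ _)).
  by apply: measurable_funB.
- by move=> x; rewrite mule_ge0// lee_fin normal_pdf_ge0.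
have maff := @measurable_affine b s.
have mfa : measurable_fun setT (fun x : R => f (b + s * x)).
  exact: measurableT_comp.
have mpdf : measurable_fun setT (fun x : R => (normal_pdf 0 1 (b + s * x - a))%:E).
  apply/measurable_EFinP; apply: (measurableT_comp (measurable_normal_pdf _ _)).
  by apply: measurable_funB.
rewrite ge0_integral_gauss; last 2 first.
- by apply: emeasurable_funM => //; apply/measurable_EFinP; apply: measurableT_comp.
- by move=> x; rewrite mule_ge0// lee_fin.
rewrite -ge0_integralZl//; last 3 first.
- exact: emeasurable_funM.
- by move=> x _; rewrite mule_ge0// lee_fin normal_pdf_ge0.
- by rewrite lee_fin ltW.
apply: eq_integral => t _; rewrite muleCA -muleA; congr (_ * _)%E.
rewrite -!EFinM; congr EFin; rewrite !normal_pdf01E /r.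
have -> : (b + s * t - b) / s = t by field; rewrite gt_eqF.
rewrite [RHS]mulrACA -expRD mulrA; congr (_ * expR _); lra.
Qed.

(** The exponent is parametrized so that its product with the standard density is [1 / q] times the
    density of variance [q^-2]. The even moments used later are all bounded or computed from this
    identity. *)
Lemma gauss_exp_moment (q : R) : 0 < q ->
  (\int[gauss]_t (expR (- ((q ^+ 2 - 1) / 2) * t ^+ 2))%:E = (q^-1)%:E)%E.
Proof.
move=> q0; have q'0 : q^-1 != 0 by rewrite invr_eq0 gt_eqF.
have mexp : measurable_fun setT
    (fun t : R => (expR (- ((q ^+ 2 - 1) / 2) * t ^+ 2))%:E).
  apply/measurable_EFinP; apply: measurableT_comp => //.
  by apply: measurable_funM => //; exact: measurable_funX.
rewrite (ge0_integral_gauss mexp); last by move=> x; rewrite lee_fin expR_ge0.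
under eq_integral => t _.
  have -> : ((expR (- ((q ^+ 2 - 1) / 2) * t ^+ 2))%:E * (normal_pdf 0 1 t)%:E =
      (q^-1)%:E * (normal_pdf 0 q^-1 t)%:E)%E.
    rewrite -!EFinM; congr EFin.
    rewrite normal_pdf01E normal_pdfE// /normal_fun subr0 /normal_peak.
    rewrite mulrCA -expRD [RHS]mulrA; congr (_ * expR _); last first.
      by rewrite exprVn; field; rewrite gt_eqF.
    rewrite expr1n mul1r -mulrnAr sqrtrM ?sqr_ge0// invfM sqrtr_sqr.
    by rewrite gtr0_norm ?invr_gt0// invrK mulrA mulVf ?mul1r// gt_eqF.
  over.
rewrite ge0_integralZl//.
- by rewrite integral_normal_pdf mule1.
- by apply/measurable_EFinP; exact: measurable_normal_pdf.
- by move=> t _; rewrite lee_fin normal_pdf_ge0.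
- by rewrite lee_fin invr_ge0 ltW.
Qed.

End gaussian.

Section gauss_moments.
Context {R : realType}.
Local Notation leb := (@lebesgue_measure R).

Lemma measurable_gauss_exp (c : R) : measurable_fun setT (fun t : R => expR (c * t ^+ 2)).
Proof. by apply: measurableT_comp => //; apply: measurable_funM => //; exact: measurable_funX. Qed.

Lemma rintegrable_gauss_exp (q : R) : 0 < q ->
  rintegrable (@gauss R) (fun t => expR (- ((q ^+ 2 - 1) / 2) * t ^+ 2)).
Proof.
move=> q0; apply: rintegrable_ge0; first exact: measurable_gauss_exp.
  by move=> x; exact: expR_ge0.
by rewrite (gauss_exp_moment q0) ltry.
Qed.

Lemma Rintegral_gauss_exp (q : R) : 0 < q ->
  \int[@gauss R]_t (expR (- ((q ^+ 2 - 1) / 2) * t ^+ 2)) = q^-1.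
Proof. by move=> q0; rewrite /Rintegral (gauss_exp_moment q0). Qed.

(** The value [q = 1/2] in [gauss_exp_moment] yields [expR (3/8 t^2)], which is still integrable,
    and the fourth-order Taylor term of this exponential is a multiple of [t^8]. *)
Let pow8_le (t : R) :
  `|t ^+ 8| <= 24 * (8 / 3) ^+ 4 * expR (- ((2^-1 ^+ 2 - 1) / 2) * t ^+ 2).
Proof.
set x := _ * t ^+ 2; have xE : x = 3 / 8 * t ^+ 2 by rewrite /x; field.
have x0 : 0 <= x by rewrite xE mulr_ge0 ?sqr_ge0// divr_ge0.
have := expR_ge1Dxn 3 x0; rewrite ger0_norm ?exprn_even_ge0//.
have -> : x ^+ 4 / 4`!%:R = (3 / 8) ^+ 4 / 24 * t ^+ 8.
  by rewrite xE (_ : 4`!%:R = 24)//; field.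
by set y := t ^+ 8; set e := expR x; lra.
Qed.

Lemma rintegrable_gauss_pow8 : rintegrable (@gauss R) (fun t => t ^+ 8).
Proof.
refine (rintegrable_le _ pow8_le _); first exact: measurable_funX.
by apply: rintegrableZ; apply: rintegrable_gauss_exp; rewrite invr_gt0.
Qed.

Lemma Rintegral_gauss_pow8 : \int[@gauss R]_t (t ^+ 8) <= 2500.
Proof.
have q0 : 0 < 2^-1 :> R by rewrite invr_gt0.
apply: (@le_trans _ _ (\int[@gauss R]_t
   (24 * (8 / 3) ^+ 4 * expR (- ((2^-1 ^+ 2 - 1) / 2) * t ^+ 2)))).
  apply: ERintegral_le; first exact: rintegrable_gauss_pow8.
    by apply: rintegrableZ; exact: rintegrable_gauss_exp.
  by move=> t; rewrite (le_trans _ (pow8_le t))// ler_norm.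
rewrite ERintegralZ; last exact: rintegrable_gauss_exp.
(* The bound is [24 (8/3)^4] times 2, about 2427. *)
rewrite Rintegral_gauss_exp// invrK; lra.
Qed.

Lemma rintegrable_gauss_pow k : (k <= 8)%N -> rintegrable (@gauss R) (fun t => t ^+ k).
Proof.
move=> k8; have I8 := rintegrableD (rintegrable_cst (@gauss R) 1) rintegrable_gauss_pow8.
refine (rintegrable_le _ _ I8); first exact: measurable_funX.
move=> t; rewrite normrX; have [t1|t1] := leP `|t| 1.
  by rewrite (le_trans (exprn_ile1 _ (normr_ge0 t) t1))// lerDl exprn_even_ge0.
have -> : t ^+ 8 = `|t| ^+ 8 by rewrite -normrX ger0_norm// exprn_even_ge0.
by rewrite (le_trans (ler_weXn2l (ltW t1) k8))// lerDr.
Qed.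

Lemma gauss_sqr_exp_le (q : R) : 0 < q ->
  1 - (q ^+ 2 - 1) / 2 * \int[@gauss R]_t (t ^+ 2) <= q^-1.
Proof.
move=> q0; rewrite -(Rintegral_gauss_exp q0) -ERintegralZ; last exact: rintegrable_gauss_pow.
rewrite -[X in X - _](ERintegral_cst (@gauss R) 1) -ERintegralB.
- apply: ERintegral_le.
  + apply: rintegrableB; first exact: rintegrable_cst.
    by apply: rintegrableZ; exact: rintegrable_gauss_pow.
  + exact: rintegrable_gauss_exp.
  + by move=> t; rewrite -mulNr; exact: expR_ge1Dx.
- exact: rintegrable_cst.
- by apply: rintegrableZ; exact: rintegrable_gauss_pow.
Qed.

(** No differentiation under the integral: [gauss_sqr_exp_le] is an equality at [q = 1], so the two
    sides must be tangent there, which forces the value 1. The points [1 - r] and [1 + r] refute a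
    larger and a smaller value. *)
Lemma Rintegral_gauss_sqr : \int[@gauss R]_t (t ^+ 2) = 1 :> R.
Proof.
set e := \int[@gauss R]_t (t ^+ 2).
have e0 : 0 <= e by apply: ERintegral_ge0 => t; exact: sqr_ge0.
have H (q : R) : 0 < q -> 0 <= (q - 1) * (q * (q + 1) * e - 2).
  move=> q0; have := gauss_sqr_exp_le q0; rewrite -/e => qe.
  have : q * (1 - (q ^+ 2 - 1) / 2 * e) <= q * q^-1 by rewrite ler_pM2l.
  by rewrite divff ?gt_eqF//; nra.
apply/eqP; rewrite eq_le; apply/andP; split; rewrite leNgt; apply/negP => e1.
- have e'0 : 0 < e by lra.
  pose r := (e - 1) / (3 * e); have rE : 3 * e * r = e - 1 by rewrite /r; field; rewrite gt_eqF.
  have r0 : 0 < r by rewrite divr_gt0//; lra.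
  have r1 : r < 1 by rewrite ltr_pdivrMr//; lra.
  have := H (1 - r); rewrite subr_gt0 => /(_ r1).
  have : 0 < (1 - r) * (1 - r + 1) * e - 2 by nra.
  by nra.
- pose r := (1 - e) / 4; have r0 : 0 < r by rewrite /r; lra.
  have := H (1 + r); have r1 : 0 < 1 + r by lra.
  move=> /(_ r1).
  have : (1 + r) * (1 + r + 1) * e - 2 < 0 by rewrite /r; nra.
  by nra.
Qed.

(** [(1 + x/4)^4] bounds [expR x] from below, and 5/8 is the coefficient at which its product with
    the quadratic has no [x^2] term. Beyond 1 there remains [x^3] times a polynomial with positive
    coefficients. *)
Lemma expRN_le_quadratic (x : R) : 0 <= x -> expR (- x) <= 1 - x + 5 / 8 * x ^+ 2.
Proof.
move=> x0; rewrite expRN -[leRHS]invrK lef_pV2 ?posrE ?expR_gt0//; last first.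
  by rewrite invr_gt0; nra.
apply: (@le_trans _ _ ((1 + x / 4) ^+ 4)); last first.
  have -> : expR x = expR (x / 4) ^+ 4 by rewrite -expRM_natl; congr expR; field.
  by apply: lerXn2r; rewrite ?nnegrE ?expR_ge0 ?expR_ge1Dx// addr_ge0// divr_ge0.
have p0 : 0 < 1 - x + 5 / 8 * x ^+ 2 by nra.
rewrite -[leLHS]mul1r ler_pdivrMr// -subr_ge0.
have -> : (1 + x / 4) ^+ 4 * (1 - x + 5 / 8 * x ^+ 2) - 1 = x ^+ 3 *
   (5 / 16 + (1 / 256 - 1 / 16 + 15 / 64) * x + (5 / 128 - 1 / 256) * x ^+ 2
    + 5 / 2048 * x ^+ 3) by field.
have x2 : 0 <= x ^+ 2 by exact: exprn_ge0.
have x3 : 0 <= x ^+ 3 by exact: exprn_ge0.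
apply: mulr_ge0; [exact: x3|lra].
Qed.

(** The true value is 3, but a margin above 1 is enough to give [t^2 - 1] a positive variance. With
    [q = 3/2], the quadratic bound on the exponential yields about 1.19. *)
Lemma Rintegral_gauss_pow4_ge : 11 / 10 <= \int[@gauss R]_t (t ^+ 4) :> R.
Proof.
have q0 : 0 < 3 / 2 :> R by lra.
have := Rintegral_gauss_exp q0; set f := (fun t => _) => Ef.
have : \int[@gauss R]_t f t <= \int[@gauss R]_t
    (1 - 5 / 8 * t ^+ 2 + 5 / 8 * (25 / 64) * t ^+ 4).
  apply: ERintegral_le; first exact: rintegrable_gauss_exp.
    apply: rintegrableD; last by apply: rintegrableZ; exact: rintegrable_gauss_pow.
    apply: rintegrableB; first exact: rintegrable_cst.
    by apply: rintegrableZ; exact: rintegrable_gauss_pow.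
  move=> t; rewrite /f; have x0 : 0 <= 5 / 8 * t ^+ 2 by rewrite mulr_ge0// ?sqr_ge0// divr_ge0.
  have := expRN_le_quadratic x0.
  have -> : - (((3 / 2) ^+ 2 - 1) / 2) * t ^+ 2 = - (5 / 8 * t ^+ 2) by field.
  have -> : (5 / 8 * t ^+ 2) ^+ 2 = 25 / 64 * t ^+ 4 by field.
  lra.
rewrite Ef ERintegralD; last 2 first.
- apply: rintegrableB; first exact: rintegrable_cst.
  by apply: rintegrableZ; exact: rintegrable_gauss_pow.
- by apply: rintegrableZ; exact: rintegrable_gauss_pow.
rewrite ERintegralB; last 2 first.
- exact: rintegrable_cst.
- by apply: rintegrableZ; exact: rintegrable_gauss_pow.
rewrite !ERintegralZ; [|exact: rintegrable_gauss_pow..].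
rewrite ERintegral_cst Rintegral_gauss_sqr; lra.
Qed.

Lemma lebesgue_opp (A : set R) : measurable A -> leb A = leb [set t : R | A (- t)%R].
Proof.
move=> mA.
have mo : measurable_fun setT (-%R : measurableTypeR R -> measurableTypeR R).
  exact: measurable_funN.
pose m' : {measure set (measurableTypeR R) -> \bar R} := pushforward leb (fun t => - t : measurableTypeR R).
have -> : leb [set t | A (- t)%R] = m' mo A by [].
apply: lebesgue_measure_unique => // X /= [xy _ <-].
rewrite /pushforward.
have -> : -%R @^-1` `]xy.1, xy.2]%classic = `[- xy.2, - xy.1[%classic.
  apply/seteqP; split => t /=; rewrite !in_itv/=.
    by move=> /andP[h1 h2]; apply/andP; split; lra.
  by move=> /andP[h1 h2]; apply/andP; split; lra.
by rewrite !lebesgue_measure_itv/= !lte_fin ltrN2; case: ifPn => // _; rewrite -!EFinB; congr EFin; lra.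
Qed.

Lemma gauss_opp (A : set R) : measurable A -> gauss A = gauss [set t : R | A (- t)%R].
Proof.
move=> mA; rewrite /gauss/= /distribution/= /pushforward /normal_prob.
have mo : measurable_fun setT (-%R : measurableTypeR R -> measurableTypeR R).
  exact: measurable_funN.
pose m' : {measure set (measurableTypeR R) -> \bar R} := pushforward leb (fun t => - t : measurableTypeR R).
rewrite (eq_measure_integral (m' mo)); last first.
  by move=> B mB _; exact: lebesgue_opp.
rewrite ge0_integral_pushforward//; last 2 first.
- apply/measurable_EFinP; apply/measurable_funTS; exact: measurable_normal_pdf.
- by move=> x _; rewrite lee_fin normal_pdf_ge0.
by apply: eq_integral => t _ /=; rewrite !normal_pdf01E sqrrN.
Qed.

Lemma Rintegral_gauss_odd (f : R -> R) : rintegrable (@gauss R) f ->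
  (forall t, f (- t) = - f t) -> \int[@gauss R]_t (f t) = 0.
Proof.
move=> intf oddf; have mf := rintegrable_measurable intf.
have mo : measurable_fun setT (-%R : R -> R) by exact: measurable_funN.
have fN : f \o -%R = -%R \o f by apply/funext => t; rewrite /= oddf.
have : (\int[@gauss R]_t (f t)%:E = \int[@gauss R]_t (f (- t)%R)%:E)%E.
  pose m' : {measure set R -> \bar R} := pushforward gauss -%R.
  rewrite [LHS](eq_measure_integral (m' mo)); last first.
    by move=> B mB _; exact: gauss_opp.
  rewrite integral_pushforward//; first exact/measurable_EFinP.
  rewrite preimage_setT.
  have -> : (EFin \o f) \o -%R = EFin \o (fun t => - 1 * f t).
    by apply/funext => t; rewrite /= oddf mulN1r.
  exact: rintegrableZ.
have -> : (\int[@gauss R]_t (f (- t)%R)%:E = (- \int[@gauss R]_t f t)%R%:E)%E.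
  under eq_integral do rewrite oddf -mulN1r.
  by rewrite ERintegralE ?ERintegralZ ?mulN1r//; exact: rintegrableZ.
rewrite ERintegralE// => -[]; lra.
Qed.

End gauss_moments.

(** * Moments of weighted sums *)

Section weighted_sums.
Context (R : realType) (d : measure_display) (Omega : measurableType d)
  (P : probability Omega R) (I : finType).
Variable Z : I -> Omega -> R.
Hypothesis mZ : forall i, measurable_fun setT (Z i).
Hypothesis indZ : mutually_independent P Z.

Lemma measurable_sub_sigmaS d' (T : measurableType d') (J1 J2 : {set I})
    (f : Omega -> T) : (forall i, i \in J1 -> i \in J2) ->
  measurable_fun setT (f : sub_sigma Z J1 -> T) ->
  measurable_fun setT (f : sub_sigma Z J2 -> T).
Proof.
move=> J12 mf _ B mB.
suff H : <<s coord_events Z J1 >> `<=` <<s coord_events Z J2 >> by apply: H; exact: mf.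
apply: smallest_sub; first exact: smallest_sigma_algebra.
move=> A [i [iJ [C mC ->]]]; apply: sub_sigma_algebra.
by exists i; split; [exact: J12|exists C].
Qed.

Variable rk : I -> nat.
(** [rk] distributes the coordinates among rows. Row [i] of a sum reads only the coordinates of rank
    [i], so distinct rows are independent. *)
Definition block n : {set I} := [set i | rk i == n]%SET.
Definition blocks_lt n : {set I} := [set i | rk i < n]%N%SET.

Variables (phi z : nat -> Omega -> R).
Hypothesis mphi : forall i, measurable_fun setT (phi i : sub_sigma Z (block i) -> R).
Hypothesis mz : forall i, measurable_fun setT (z i : sub_sigma Z (block i) -> R).
Hypothesis int_phiz : forall i l, (l <= 4)%N ->
  rintegrable P (fun w => phi i w * z i w ^+ l).

(** A product of independent factors of mean 1 acts as a density: it conditions each row without a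
    new probability space. [wmoment n k] is then the k-th moment of [wsum] under the weighted
    law. *)
Definition wprod n w := \prod_(i < n) phi i w.
Definition wsum n w := \sum_(i < n) z i w.

Let sub_block_lt i n : (i < n)%N -> forall j, j \in block i -> j \in blocks_lt n.
Proof. by move=> i_n j; rewrite !inE => /eqP ->. Qed.

Lemma measurable_wprod n : measurable_fun setT (wprod n : sub_sigma Z (blocks_lt n) -> R).
Proof.
apply: measurable_prod => i _.
exact: (measurable_sub_sigmaS (@sub_block_lt _ _ (ltn_ord i)) (@mphi i)).
Qed.

Lemma measurable_wsum n : measurable_fun setT (wsum n : sub_sigma Z (blocks_lt n) -> R).
Proof.
apply: measurable_sum => i.
exact: (measurable_sub_sigmaS (@sub_block_lt _ _ (ltn_ord i)) (@mz i)).
Qed.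

Let disj n i : i \in blocks_lt n -> i \notin block n.
Proof. by rewrite !inE => /ltn_eqF ->. Qed.

Definition wmoment n k := \int[P]_w (wprod n w * wsum n w ^+ k).
Definition step_moment n l := \int[P]_w (phi n w * z n w ^+ l).

Let term n k (l : nat) w := (wprod n w * wsum n w ^+ (k - l)) * (phi n w * z n w ^+ l) *+ 'C(k, l).

Let wstepE n k : (fun w => wprod n.+1 w * wsum n.+1 w ^+ k) =
  (fun w => \sum_(l < k.+1) term n k l w).
Proof.
apply/funext => w; rewrite [in LHS]/wprod [in LHS]/wsum ![in LHS]big_ord_recr/= exprDn mulr_sumr.
apply: eq_bigr => l _; rewrite /term /wprod /wsum mulrnAr; congr (_ *+ _).
by rewrite mulrACA.
Qed.

Lemma rintegrable_wmoment n k : (k <= 4)%N ->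
  rintegrable P (fun w => wprod n w * wsum n w ^+ k).
Proof.
elim: n k => [|n IH] k k4.
  rewrite (_ : (fun w => _) = fun=> 0 ^+ k); first exact: rintegrable_cst.
  by apply/funext => w; rewrite /wprod /wsum !big_ord0 mul1r.
rewrite wstepE; apply: rintegrable_sum => l.
have l4 : (l <= 4)%N by rewrite (leq_trans _ k4)// -ltnS.
rewrite (_ : term n k l = fun w => 'C(k, l)%:R *
   ((wprod n w * wsum n w ^+ (k - l)) * (phi n w * z n w ^+ l))).
  apply: rintegrableZ; apply: (sub_sigma_integrableM mZ indZ (@disj n)).
  - apply: measurable_funM; first exact: measurable_wprod.
    by apply: measurable_funX; exact: measurable_wsum.
  - by apply: measurable_funM => //; apply: measurable_funX.
  - by apply: IH; rewrite (leq_trans (leq_subr _ _)).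
  - exact: int_phiz.
by apply/funext => w; rewrite /term mulr_natl.
Qed.

(** Binomial expansion in the last row, which is independent of the earlier ones. *)
Lemma wmomentS n k : (k <= 4)%N -> wmoment n.+1 k =
  \sum_(l < k.+1) wmoment n (k - l) * step_moment n l *+ 'C(k, l).
Proof.
move=> k4; rewrite /wmoment wstepE.
have intt (l : 'I_k.+1) : rintegrable P (fun w => (wprod n w * wsum n w ^+ (k - l)) *
    (phi n w * z n w ^+ l)).
  have l4 : (l <= 4)%N by rewrite (leq_trans _ k4)// -ltnS.
  apply: (sub_sigma_integrableM mZ indZ (@disj n)).
  - apply: measurable_funM; first exact: measurable_wprod.
    by apply: measurable_funX; exact: measurable_wsum.
  - by apply: measurable_funM => //; apply: measurable_funX.
  - by apply: rintegrable_wmoment; rewrite (leq_trans (leq_subr _ _)).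
  - exact: int_phiz.
have tE (l : 'I_k.+1) : term n k l = fun w => 'C(k, l)%:R *
   ((wprod n w * wsum n w ^+ (k - l)) * (phi n w * z n w ^+ l)).
  by apply/funext => w; rewrite /term mulr_natl.
rewrite ERintegral_sum; last first.
  by move=> l; rewrite tE; exact: rintegrableZ.
apply: eq_bigr => l _; rewrite tE ERintegralZ// mulr_natl; congr (_ *+ _).
have l4 : (l <= 4)%N by rewrite (leq_trans _ k4)// -ltnS.
apply: (sub_sigma_RintegralM mZ indZ (@disj n)).
- apply: measurable_funM; first exact: measurable_wprod.
  by apply: measurable_funX; exact: measurable_wsum.
- by apply: measurable_funM => //; apply: measurable_funX.
- by apply: rintegrable_wmoment; rewrite (leq_trans (leq_subr _ _)).
- exact: int_phiz.
Qed.

Hypothesis phi_mean : forall i, step_moment i 0 = 1.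
Hypothesis z_mean : forall i, step_moment i 1 = 0.
Hypothesis phi_ge0 : forall i w, 0 <= phi i w.

Lemma wmoment0 n : wmoment n 0 = 1.
Proof.
elim: n => [|n IH].
  rewrite /wmoment (_ : (fun w => _) = fun=> 1); first exact: ERintegral_cst.
  by apply/funext => w; rewrite /wprod /wsum !big_ord0 mul1r expr0.
by rewrite wmomentS// big_ord1 IH phi_mean mulr1.
Qed.

Lemma wmoment1 n : wmoment n 1 = 0.
Proof.
elim: n => [|n IH].
  rewrite /wmoment (_ : (fun w => _) = fun=> 0); first exact: ERintegral_cst.
  by apply/funext => w; rewrite /wprod /wsum !big_ord0 mul1r.
by rewrite wmomentS// !big_ord_recl big_ord0/= IH z_mean mul0r mulr0 !mul0rn !addr0.
Qed.

Lemma wmoment2 n : wmoment n 2 = \sum_(i < n) step_moment i 2.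
Proof.
elim: n => [|n IH].
  rewrite big_ord0 /wmoment (_ : (fun w => _) = fun=> 0); first exact: ERintegral_cst.
  by apply/funext => w; rewrite /wprod /wsum !big_ord0 mul1r expr0n.
rewrite wmomentS// ![in LHS]big_ord_recl [in LHS]big_ord0/= /bump/= IH z_mean phi_mean wmoment0.
by rewrite [in RHS]big_ord_recr/= !addr0 mulr0 mul0rn mul1r mulr1 add0r.
Qed.

Lemma step_moment_even_ge0 i l : 0 <= step_moment i (l * 2).
Proof. by apply: ERintegral_ge0 => w; rewrite mulr_ge0// exprM sqr_ge0. Qed.

(** In the recursion each third moment is multiplied by a mean, which is zero. What remains is the
    fourth moment of the new row and [6 A s], with [s] its variance; the latter is covered by the
    growth of [3 A^2] when [A] becomes [A + s]. *)
Lemma wmoment4_le n : wmoment n 4 <=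
  3 * (\sum_(i < n) step_moment i 2) ^+ 2 + \sum_(i < n) step_moment i 4.
Proof.
elim: n => [|n IH].
  rewrite !big_ord0 /wmoment (_ : (fun w => _) = fun=> 0).
    by rewrite ERintegral_cst expr0n/= mulr0 addr0.
  by apply/funext => w; rewrite /wprod /wsum !big_ord0 mul1r expr0n.
rewrite wmomentS// ![in leLHS]big_ord_recl [in leLHS]big_ord0/= /bump/= !(addn0, add1n)/= ?subn0.
rewrite z_mean phi_mean -/(wmoment n) wmoment0 wmoment1 wmoment2.
rewrite ![in leRHS]big_ord_recr/=.
have s0 := step_moment_even_ge0 n 1; rewrite mul1n in s0.
move: IH; set A := \sum_(i < n) step_moment i 2; set B := \sum_(i < n) step_moment i 4 => IH.
rewrite (_ : 'C(4, 2) = 6%N)// (_ : 'C(4, 0) = 1%N)// (_ : 'C(4, 4) = 1%N)//.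
rewrite mulr0 mul0r !mul0rn !mulr1n mul1r mulr1 !add0r addr0 -mulr_natl.
nra.
Qed.

End weighted_sums.

(** * Lower tails from moments by test polynomials *)

Section test_polynomials.
Context (R : realType) (d : measure_display) (Omega : measurableType d)
  (P : probability Omega R).
Variables (Phi S : Omega -> R).
Hypothesis Phi_ge0 : forall w, 0 <= Phi w.
Hypothesis mS : measurable_fun setT S.
Hypothesis int_PhiS : forall k, (k <= 4)%N -> rintegrable P (fun w => Phi w * S w ^+ k).
Variables (V F : R).
Hypothesis E0 : \int[P]_w (Phi w * S w ^+ 0) = 1.
Hypothesis E1 : \int[P]_w (Phi w * S w ^+ 1) = 0.
Hypothesis E2 : \int[P]_w (Phi w * S w ^+ 2) = V.
Hypothesis E4 : \int[P]_w (Phi w * S w ^+ 4) <= F.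

Let poly_int a b c e w := Phi w * (a + b * S w + c * S w ^+ 2 + e * S w ^+ 4).

Let poly_intE a b c e : poly_int a b c e = fun w => a * (Phi w * S w ^+ 0) +
  b * (Phi w * S w ^+ 1) + c * (Phi w * S w ^+ 2) + e * (Phi w * S w ^+ 4).
Proof. by apply/funext => w; rewrite /poly_int; ring. Qed.

Let rintegrable_poly a b c e : rintegrable P (poly_int a b c e).
Proof.
by rewrite poly_intE; do !apply: rintegrableD; apply: rintegrableZ; exact: int_PhiS.
Qed.

Let Rintegral_poly a b c e : \int[P]_w poly_int a b c e w =
  a + c * V + e * \int[P]_w (Phi w * S w ^+ 4).
Proof.
rewrite poly_intE !ERintegralD ?ERintegralZ ?E0 ?E1 ?E2; last 10 first.
all: try (by do ?apply: rintegrableD; apply: rintegrableZ; exact: int_PhiS).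
all: try (exact: int_PhiS).
by ring.
Qed.

Let measurable_le x : measurable [set w | S w <= x].
Proof. by rewrite -[X in measurable X]setTI; exact: measurable_fun_le. Qed.

Let rintegrable_ind x : rintegrable P (fun w => Phi w * \1_[set w | S w <= x] w).
Proof.
have I0 := int_PhiS (leq0n 4).
have mPhi : measurable_fun setT Phi.
  have := rintegrable_measurable I0; congr measurable_fun.
  by apply/funext => w; rewrite expr0 mulr1.
refine (rintegrable_le (g := fun w => Phi w * S w ^+ 0) _ _ I0).
  by apply: measurable_funM => //; exact: measurable_indic.
move=> w; rewrite expr0 indicE; case: (w \in _); rewrite ?mulr0 ?mulr1 ?normr0//.
by rewrite ger0_norm.
Qed.

(** Such a polynomial lies below [C] times the indicator of [s <= x], so its mean bounds a
    probability from below. It has no cubic term because third moments are not controlled. *)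
Let test_poly x C a b c e : 0 < C ->
  (forall s, s <= x -> a + b * s + c * s ^+ 2 + e * s ^+ 4 <= C) ->
  (forall s, x < s -> a + b * s + c * s ^+ 2 + e * s ^+ 4 <= 0) ->
  (a + c * V + e * \int[P]_w (Phi w * S w ^+ 4)) / C <=
  \int[P]_w (Phi w * \1_[set w | S w <= x] w).
Proof.
move=> C0 H1 H2; rewrite ler_pdivrMr// [leRHS]mulrC -(Rintegral_poly a b c e) -ERintegralZ//.
apply: ERintegral_le; [exact: rintegrable_poly|exact: rintegrableZ|].
move=> w; rewrite /poly_int [leRHS]mulrCA; apply: ler_wpM2l => //.
rewrite indicE; case: (lerP (S w) x) => Sx.
  by rewrite mem_set//= mulr1; exact: H1.
by rewrite memNset ?mulr0; [exact: H2|apply/negP; rewrite -ltNge].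
Qed.

(** Cantelli's inequality. The parabola [1 - ((x s + V) / D)^2] has maximum 1 and its larger zero is
    [s = x]. *)
Lemma one_sided_chebyshev x : 0 < x -> 0 <= V ->
  x ^+ 2 / (x ^+ 2 + V) <= \int[P]_w (Phi w * \1_[set w | S w <= x] w).
Proof.
move=> x0 V0.
pose D := x ^+ 2 + V; have D0 : 0 < D by rewrite /D ltr_wpDr// exprn_gt0.
have := @test_poly x 1 (1 - V ^+ 2 / D ^+ 2) (- (2 * x * V / D ^+ 2)) (- (x ^+ 2 / D ^+ 2)) 0 ltr01.
have polE s : 1 - V ^+ 2 / D ^+ 2 + - (2 * x * V / D ^+ 2) * s +
    - (x ^+ 2 / D ^+ 2) * s ^+ 2 + 0 * s ^+ 4 = 1 - ((x * s + V) / D) ^+ 2.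
  by field; rewrite gt_eqF.
rewrite divr1 mul0r addr0 => H.
have <- : 1 - V ^+ 2 / D ^+ 2 + - (x ^+ 2 / D ^+ 2) * V = x ^+ 2 / D.
  by move: D0; rewrite /D => D0; field; rewrite gt_eqF.
apply: H => s xs; rewrite polE; first by rewrite lerBlDr lerDl sqr_ge0.
rewrite subr_le0 -[leLHS](expr1n _ 2) ler_sqr ?nnegrE//; last first.
  by rewrite divr_ge0 ?(ltW D0)//; nra.
by rewrite ler_pdivlMr// mul1r /D; nra.
Qed.

(** Mean zero and a fourth moment of the order of the squared variance force mass well below zero.
    In the unit [y = s / r] the polynomial is [- 1/4 - 2 k y + y^2 - y^4 / (2 k)]. Its linear term
    costs nothing in mean and makes it negative for [y > - 1 / (16 k)]; its mean is at least 1/4 and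
    its maximum at most [4 k^2]. *)
Lemma fourth_moment_lower_tail (k r : R) : 1 <= k -> 0 < r -> V = r ^+ 2 ->
  F <= k * V ^+ 2 ->
  (16 * k ^+ 2)^-1 <= \int[P]_w (Phi w * \1_[set w | S w <= - (r / (16 * k))] w).
Proof.
move=> k1 r0 Vr Fk; have k0 : 0 < k by lra.
have := @test_poly (- (r / (16 * k))) (4 * k ^+ 2) (- 4^-1) (- (2 * k / r)) (r ^- 2) (- ((2 * k * r ^+ 4)^-1)).
have polE s : - 4^-1 + - (2 * k / r) * s + r ^- 2 * s ^+ 2 + - (2 * k * r ^+ 4)^-1 * s ^+ 4 =
    - 4^-1 - 2 * k * (s / r) + (s / r) ^+ 2 - (s / r) ^+ 4 / (2 * k).
  by field; rewrite !gt_eqF.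
have C0 : 0 < 4 * k ^+ 2 by rewrite mulr_gt0// exprn_gt0.
move=> /(_ C0) H.
apply: le_trans (H _ _).
- rewrite ler_pdivlMr//.
  have -> : (16 * k ^+ 2)^-1 * (4 * k ^+ 2) = 4^-1 by field; rewrite gt_eqF.
  have -> : r ^- 2 * V = 1 by rewrite Vr mulVf// gt_eqF// exprn_gt0.
  have r4 : 0 < 2 * k * r ^+ 4 by rewrite !mulr_gt0// exprn_gt0.
  have : (2 * k * r ^+ 4)^-1 * \int[P]_w (Phi w * S w ^+ 4) <= 2^-1.
    rewrite mulrC ler_pdivrMr// (le_trans E4)// (le_trans Fk)// Vr.
    by rewrite -exprM; have -> : 2^-1 * (2 * k * r ^+ 4) = k * r ^+ 4 by field.
  by rewrite mulNr; lra.
- move=> s _; rewrite polE; set y := s / r.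
  have : 0 <= (y ^+ 2 - k) ^+ 2 / (2 * k) by rewrite divr_ge0 ?sqr_ge0// mulr_ge0// ltW.
  have -> : (y ^+ 2 - k) ^+ 2 / (2 * k) = y ^+ 4 / (2 * k) - y ^+ 2 + k / 2.
    by field; rewrite gt_eqF.
  (* This square bounds [y^2 - y^4 / (2 k)] by [9 k / 8 - y^2 / 2]; then [(y + 2 k)^2 >= 0] bounds
     [- 2 k y - y^2 / 2] by [2 k^2]. *)
  have y4 : 0 <= (y ^+ 2 - 3 / 2 * k) ^+ 2 / (2 * k).
    by rewrite divr_ge0 ?sqr_ge0// mulr_ge0// ltW.
  have E' : (y ^+ 2 - 3 / 2 * k) ^+ 2 / (2 * k) = y ^+ 4 / (2 * k) - 3 / 2 * y ^+ 2 + 9 / 8 * k.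
    by field; rewrite gt_eqF.
  by move=> _; move: y4; rewrite E'; set q := y ^+ 4 / (2 * k); have := sqr_ge0 (y + 2 * k); nra.
- move=> s sx; rewrite polE; set y := s / r.
  have : - (16 * k)^-1 < y.
    by rewrite ltr_pdivlMr// mulNr mulrC.
  set e := (16 * k)^-1 => ey.
  have ek : e * (16 * k) = 1 by rewrite mulVf// gt_eqF// mulr_gt0.
  have e0 : 0 < e by rewrite invr_gt0 mulr_gt0.
  have q0 : 0 <= y ^+ 4 / (2 * k) by rewrite divr_ge0 ?exprn_even_ge0// mulr_ge0// ltW.
  have [y0|y0] := leP y 0.
    have : y ^+ 2 <= e ^+ 2 by nra.
    have : e <= 16^-1 by nra.
    have : - (2 * k * y) <= 2 * k * e by nra.
    by nra.
  (* Up to [2 k] the linear term outweighs [y^2]; beyond it the quartic term does. *)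
  have [yk|yk] := leP y (2 * k); first by nra.
  have : y ^+ 2 <= y ^+ 4 / (2 * k).
    rewrite ler_pdivlMr ?mulr_gt0// -[4%N]/(2 + 2)%N exprD ler_wpM2l ?sqr_ge0//.
    by nra.
  by nra.
Qed.

End test_polynomials.

Section law_transfer.
Context (R : realType) (d : measure_display) (Omega : measurableType d)
  (P : probability Omega R) (mu : probability R R).
Variables (W : Omega -> R) (mW : measurable_fun setT W).
Hypothesis lawW : forall A, measurable A -> P (W @^-1` A) = mu A.

HB.instance Definition _ := isMeasurableFun.Build _ _ _ _ W mW.

Let distW A : measurable A -> A `<=` setT -> mu A = distribution P W A.
Proof. by move=> mA _; rewrite -lawW. Qed.

Lemma ge0_integral_law (f : R -> \bar R) : measurable_fun setT f ->
  (forall x, 0 <= f x)%E -> (\int[P]_w f (W w) = \int[mu]_x f x)%E.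
Proof.
move=> mf f0; transitivity (\int[distribution P W]_x f x)%E.
  by rewrite ge0_integral_distribution.
by apply: eq_measure_integral => A mA AT; exact/esym/distW.
Qed.

Lemma rintegrable_law (f : R -> R) : rintegrable mu f -> rintegrable P (f \o W).
Proof.
move=> intf; have mf := rintegrable_measurable intf.
apply/integrableP; split; first by apply/measurable_EFinP; exact: measurableT_comp.
rewrite (ge0_integral_law (f := fun x => `|(f x)%:E|%E))//; last first.
  by apply: measurableT_comp => //; exact/measurable_EFinP.
by have /integrableP[] := intf.
Qed.

Lemma Rintegral_law (f : R -> R) : rintegrable mu f ->
  \int[P]_w f (W w) = \int[mu]_x f x.
Proof.
move=> intf; rewrite /Rintegral; congr fine.
have mf := rintegrable_measurable intf.
transitivity (\int[distribution P W]_x (f x)%:E)%E.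
  by rewrite integral_distribution//; [exact/measurable_EFinP|exact: rintegrable_law].
by apply: eq_measure_integral => A mA AT; exact/esym/distW.
Qed.

End law_transfer.

Section product_expectation.
Context (R : realType) (d : measure_display) (Omega : measurableType d)
  (P : probability Omega R) (I : finType).
Variable Z : I -> Omega -> R.
Hypothesis mZ : forall i, measurable_fun setT (Z i).
Hypothesis indZ : mutually_independent P Z.
Variables (J1 J2 : {set I}) (u w : Omega -> R).
Hypothesis dJ : forall i, i \in J1 -> i \notin J2.
Hypothesis mu_ : measurable_fun setT (u : sub_sigma Z J1 -> R).
Hypothesis mw_ : measurable_fun setT (w : sub_sigma Z J2 -> R).
Variable m : probability R R.
Hypothesis laww : forall A, measurable A -> P (w @^-1` A) = m A.

Let mw : measurable_fun setT w.
Proof. exact (measurable_sub_sigma mZ mw_). Qed.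

Lemma rintegrable_prod_law (f g : R -> R) : measurable_fun setT f ->
  rintegrable P (f \o u) -> rintegrable m g ->
  rintegrable P (fun x => f (u x) * g (w x)).
Proof.
move=> mf fu intg; have mg := rintegrable_measurable intg.
apply: (sub_sigma_integrableM mZ indZ dJ (U := f \o u) (V := g \o w)) => //.
- exact: (measurableT_comp mf mu_).
- exact: (measurableT_comp mg mw_).
- exact: (rintegrable_law mw laww).
Qed.

Lemma Rintegral_prod_law (f g : R -> R) : measurable_fun setT f ->
  rintegrable P (f \o u) -> rintegrable m g ->
  \int[P]_x (f (u x) * g (w x)) = (\int[P]_x f (u x)) * (\int[m]_x g x).
Proof.
move=> mf fu intg; have mg := rintegrable_measurable intg.
rewrite -(Rintegral_law mw laww intg).
apply: (sub_sigma_RintegralM mZ indZ dJ (U := f \o u) (V := g \o w)) => //.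
- exact: (measurableT_comp mf mu_).
- exact: (measurableT_comp mg mw_).
- exact: (rintegrable_law mw laww).
Qed.

End product_expectation.

(** * Moments of one truncated row *)

Section truncated_row.
Context (R : realType) (d : measure_display) (Omega : measurableType d)
  (P : probability Omega R) (I : finType).
Variable Z : I -> Omega -> R.
Hypothesis mZ : forall i, measurable_fun setT (Z i).
Hypothesis indZ : mutually_independent P Z.
Variables (J1 J2 : {set I}) (u w : Omega -> R).
Hypothesis dJ : forall i, i \in J1 -> i \notin J2.
Hypothesis mu_ : measurable_fun setT (u : sub_sigma Z J1 -> R).
Hypothesis mw_ : measurable_fun setT (w : sub_sigma Z J2 -> R).
Hypothesis laww : forall A, measurable A -> P (w @^-1` A) = gauss A.
Hypotheses (int_u : rintegrable P (fun x => u x ^+ 2)) (E_u : \int[P]_x (u x ^+ 2) = 1).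
Variables (L h : R).
Hypotheses (L1 : 1 <= L) (h0 : 0 <= h).

Definition below (t : R) : R := (t ^+ 2 <= L)%R%:R.
Definition below_prob := \int[P]_x below (u x).
Hypothesis q2 : 2^-1 <= below_prob.
(** The density of the law conditioned on [u^2 <= L]. Only the signal is truncated; the Gaussian [w]
    has all moments and stays independent of [u] under the weight. *)
Definition trunc_weight t := below t / below_prob.
Definition trunc_mean := \int[P]_x (trunc_weight (u x) * u x ^+ 2).
Definition trunc_var := \int[P]_x (trunc_weight (u x) * (u x ^+ 2 - trunc_mean) ^+ 2).
(** For a signal [sigma u], noise [w] and [h = 1 / sigma], the log-likelihood ratio of a row is
    [u^2 + 2 h u w - w^2] up to a positive factor and an additive constant. Here each square is
    centred at its mean under the truncated law. *)
Definition row_term x := (u x ^+ 2 - trunc_mean) + 2 * h * (u x * w x) - (w x ^+ 2 - 1).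

Let below01 t : 0 <= below t <= 1.
Proof. by rewrite /below; case: (t ^+ 2 <= L); rewrite ?lexx ?ler01. Qed.

Let measurable_below : measurable_fun setT below.
Proof.
rewrite (_ : below = \1_[set t | t ^+ 2 <= L]).
  apply: measurable_indic; rewrite -[X in measurable X]setTI.
  by apply: measurable_fun_le => //; exact: measurable_funX.
by apply/funext => t; rewrite /below indicE; congr (nat_of_bool _)%:R; apply/idP/idP; rewrite inE.
Qed.

Let mu0 : measurable_fun setT u.
Proof. exact (measurable_sub_sigma mZ mu_). Qed.

Let q0 : 0 < below_prob. Proof. by rewrite (lt_le_trans _ q2)// invr_gt0. Qed.

Lemma trunc_weight_ge0 t : 0 <= trunc_weight t.
Proof. by have /andP[b0 _] := below01 t; rewrite divr_ge0// ltW. Qed.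

Lemma measurable_trunc_weight : measurable_fun setT trunc_weight.
Proof. by apply: measurable_funM. Qed.

Let weight_le2 t : trunc_weight t <= 2.
Proof. by have /andP[_ b1] := below01 t; rewrite ler_pdivrMr//; have := q2; lra. Qed.

(* Functions of [u] that are multiplied by the weight only matter on [u^2 <= L]. *)
Lemma rintegrable_trunc (f : R -> R) c : measurable_fun setT f ->
  (forall t, t ^+ 2 <= L -> `|f t| <= c) ->
  rintegrable P (fun x => trunc_weight (u x) * f (u x)).
Proof.
move=> mf fc; apply: (@rintegrable_bounded _ _ _ _ _ (2 * c)) => [|x].
  apply: (measurableT_comp _ mu0 (f := fun t => trunc_weight t * f t)).
  by apply: measurable_funM => //; exact: measurable_trunc_weight.
have c0 : 0 <= c by rewrite (le_trans _ (fc 0 _))// expr0n/=; have := L1; lra.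
rewrite normrM ger0_norm ?trunc_weight_ge0//.
rewrite /trunc_weight /below; case: (boolP (u x ^+ 2 <= L)) => uL; last first.
  by rewrite mul0r mul0r mulr_ge0.
apply: ler_pM => //; last exact: fc.
by rewrite mul1r invr_ge0 ltW.
by rewrite mul1r -[2]invrK lef_pV2// posrE.
Qed.

Lemma trunc_weight_below t : trunc_weight t != 0 -> t ^+ 2 <= L.
Proof. by rewrite /trunc_weight /below; case: (t ^+ 2 <= L) => //; rewrite mul0r eqxx. Qed.

Let tw x := trunc_weight (u x).
Let e f := \int[P]_x (tw x * f (u x)).
Let E g := \int[@gauss R]_t g t.

Let wbounded (f : R -> R) := measurable_fun setT f /\
  exists c, forall t, t ^+ 2 <= L -> `|f t| <= c.

Let wboundedM f g : wbounded f -> wbounded g -> wbounded (fun t => f t * g t).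
Proof.
move=> [mf [c fc]] [mg [c' gc]]; split; first exact: measurable_funM.
by exists (c * c') => t tL; rewrite normrM ler_pM//; [exact: fc|exact: gc].
Qed.

Let wbounded_cst c : wbounded (fun=> c).
Proof. by split => //; exists `|c|. Qed.

Let wboundedB f g : wbounded f -> wbounded g -> wbounded (fun t => f t - g t).
Proof.
move=> [mf [c fc]] [mg [c' gc]]; split; first exact: measurable_funB.
exists (c + c') => t tL; rewrite (le_trans (ler_normB _ _))//.
by rewrite lerD//; [exact: fc|exact: gc].
Qed.

Let wbounded_id : wbounded id.
Proof.
split => //; exists L => t tL; rewrite -ler_sqr ?nnegrE//; last by have := L1; lra.
by rewrite real_normK ?num_real// (le_trans tL)//; have := L1; nra.
Qed.

Let wboundedX f k : wbounded f -> wbounded (fun t => f t ^+ k).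
Proof.
move=> bf; elim: k => [|k IH].
  rewrite (_ : (fun t => _) = fun=> 1); first exact: wbounded_cst.
  by apply/funext => t; rewrite expr0.
rewrite (_ : (fun t => _) = fun t => f t * f t ^+ k); first exact: wboundedM.
by apply/funext => t; rewrite exprS.
Qed.

Let rintegrable_tw f : wbounded f -> rintegrable P (fun x => tw x * f (u x)).
Proof. by move=> [mf [c fc]]; exact: (rintegrable_trunc mf fc). Qed.

Let rintegrable_twM f g : wbounded f -> rintegrable (@gauss R) g ->
  rintegrable P (fun x => tw x * f (u x) * g (w x)).
Proof.
move=> bf ig; have [mf [c fc]] := bf.
apply: (rintegrable_prod_law mZ indZ dJ mu_ mw_ laww (f := fun t => trunc_weight t * f t)) => //.
  by apply: measurable_funM => //; exact: measurable_trunc_weight.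
exact: rintegrable_tw.
Qed.

Let Rintegral_twM f g : wbounded f -> rintegrable (@gauss R) g ->
  \int[P]_x (tw x * f (u x) * g (w x)) = e f * E g.
Proof.
move=> bf ig; have [mf [c fc]] := bf.
apply: (Rintegral_prod_law mZ indZ dJ mu_ mw_ laww (f := fun t => trunc_weight t * f t)) => //.
  by apply: measurable_funM => //; exact: measurable_trunc_weight.
exact: rintegrable_tw.
Qed.

Lemma Rintegral_trunc_weight : \int[P]_x trunc_weight (u x) = 1.
Proof.
rewrite /trunc_weight; under eq_Rintegral do rewrite mulrC.
rewrite ERintegralZ ?mulVf ?gt_eqF//.
apply: (@rintegrable_bounded _ _ _ _ _ 1) => [|x]; first exact: (measurableT_comp measurable_below mu0).
by have /andP[b0 b1] := below01 (u x); rewrite ger0_norm.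
Qed.

Let e1 : e (fun=> 1) = 1.
Proof. by rewrite /e; under eq_Rintegral do rewrite mulr1; exact: Rintegral_trunc_weight. Qed.

Let eB f g : wbounded f -> wbounded g -> e (fun t => f t - g t) = e f - e g.
Proof.
move=> bf bg; rewrite /e -ERintegralB; [|exact: rintegrable_tw..].
by apply: eq_Rintegral => x _; rewrite mulrBr.
Qed.

Let e_cst c : e (fun=> c) = c.
Proof.
rewrite /e; under eq_Rintegral do rewrite mulrC.
have I1 := rintegrable_tw (wbounded_cst 1).
rewrite ERintegralZ ?Rintegral_trunc_weight ?mulr1//.
by move: I1; congr rintegrable; apply/funext => x; rewrite mulr1.
Qed.

Lemma trunc_mean_ge0 : 0 <= trunc_mean.
Proof. by apply: ERintegral_ge0 => x; rewrite mulr_ge0 ?sqr_ge0// trunc_weight_ge0. Qed.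

Let rintegrable_below f : rintegrable P f -> rintegrable P (fun x => below (u x) * f x).
Proof.
move=> intf; have mf := rintegrable_measurable intf.
have Inf : rintegrable P (fun x => `|f x|).
  exact: (integrable_norm intf).
refine (rintegrable_le _ _ Inf).
  by apply: measurable_funM => //; exact: (measurableT_comp measurable_below mu0).
by move=> x; have /andP[b0 b1] := below01 (u x); rewrite normrM ger0_norm// ler_piMl.
Qed.

Let rintegrable_below1 : rintegrable P (fun x => below (u x)).
Proof.
have := rintegrable_below (rintegrable_cst P 1); congr rintegrable.
by apply/funext => x; rewrite mulr1.
Qed.

(* Discarding the mass [1 - below_prob], which sits above [L], lowers the mean. *)
Lemma trunc_mean_deficit : (1 - below_prob) * (L - 1) <= 1 - trunc_mean.
Proof.
have mE : trunc_mean = (\int[P]_x (below (u x) * u x ^+ 2)) / below_prob.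
  rewrite mulrC -ERintegralZ; last exact: rintegrable_below.
  by apply: eq_Rintegral => x _; rewrite /trunc_weight; ring.
have q1 : below_prob <= 1.
  rewrite -(ERintegral_cst P 1); apply: ERintegral_le => //; first exact: rintegrable_cst.
  by move=> x; have /andP[] := below01 (u x).
have H : \int[P]_x (below (u x) * u x ^+ 2) <= 1 - L * (1 - below_prob).
  have -> : 1 - L * (1 - below_prob) = \int[P]_x (u x ^+ 2 - L * (1 - below (u x))).
    rewrite ERintegralB//; last first.
      by apply: rintegrableZ; apply: rintegrableB => //; exact: rintegrable_cst.
    rewrite E_u ERintegralZ; last by apply: rintegrableB => //; exact: rintegrable_cst.
    by rewrite ERintegralB ?ERintegral_cst//; exact: rintegrable_cst.
  apply: ERintegral_le; first exact: rintegrable_below.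
    apply: rintegrableB => //; apply: rintegrableZ; apply: rintegrableB => //.
    exact: rintegrable_cst.
  move=> x; rewrite /below; case: (leP (u x ^+ 2) L) => uL /=.
    by rewrite subrr mulr0 mul1r subr0.
  by rewrite mul0r subr0 mulr1 subr_ge0 ltW.
have : trunc_mean * below_prob = \int[P]_x (below (u x) * u x ^+ 2).
  by rewrite mE divfK// gt_eqF.
move=> mq; rewrite -(ler_pM2r q0).
have p0 : 0 <= (1 - below_prob) * (L - 1).
  by apply: mulr_ge0; [|have := L1]; lra.
have := ler_piMr p0 q1; move: p0 H mq; set I0 := \int[P]_x _; set q := below_prob.
by set mm := trunc_mean => p0 H mq; lra.
Qed.

Lemma trunc_mean_le1 : trunc_mean <= 1.
Proof.
have := trunc_mean_deficit; have := L1.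
suff : below_prob <= 1 by nra.
rewrite -(ERintegral_cst P 1); apply: ERintegral_le => //; first exact: rintegrable_cst.
by move=> x; have /andP[] := below01 (u x).
Qed.

Let m := trunc_mean.
Let cu t := t ^+ 2 - m.

Let b_cu : wbounded cu.
Proof. by apply: wboundedB; [apply: wboundedX|exact: wbounded_cst]. Qed.

Let e_cu : e cu = 0.
Proof.
rewrite /cu eB; [|exact: wboundedX|exact: wbounded_cst].
by rewrite e_cst /m /trunc_mean subrr.
Qed.

Let cu_le t : t ^+ 2 <= L -> `|cu t| <= L.
Proof.
move=> tL; rewrite /cu /m; have := trunc_mean_ge0; have := trunc_mean_le1.
by have := L1; have := sqr_ge0 t; rewrite ler_norml => *; apply/andP; split; lra.
Qed.

Let e_pow4 : e (fun t => t ^+ 4) = trunc_var + m ^+ 2.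
Proof.
have -> : trunc_var = e (fun t => t ^+ 4 - (2 * m * t ^+ 2 - m ^+ 2)).
  by apply: eq_Rintegral => x _; rewrite /tw -/m; congr (_ * _); ring.
have b2 : wbounded (fun t => 2 * m * t ^+ 2).
  by apply: wboundedM; [exact: wbounded_cst|exact: wboundedX].
rewrite !eB ?e_cst; [|exact: b2|exact: wbounded_cst|exact: wboundedX|]; last first.
  by apply: wboundedB => //; exact: wbounded_cst.
have -> : e (fun t => 2 * m * t ^+ 2) = 2 * m * m.
  rewrite /e; under eq_Rintegral do rewrite mulrCA.
  by rewrite ERintegralZ//; exact: (rintegrable_tw (wboundedX 2 wbounded_id)).
by ring.
Qed.

(** Where the weight is non-zero, [u^4 <= L u^2], and the truncated mean of [u^2] is at most 1. *)
Lemma trunc_var_le : trunc_var <= L.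
Proof.
have : e (fun t => t ^+ 4) <= L * m.
  rewrite /m /trunc_mean -ERintegralZ; last exact: (rintegrable_tw (wboundedX 2 wbounded_id)).
  apply: ERintegral_le.
  - exact: (rintegrable_tw (wboundedX 4 wbounded_id)).
  - by apply: rintegrableZ; exact: (rintegrable_tw (wboundedX 2 wbounded_id)).
  move=> x; have [t0|/trunc_weight_below uL] := eqVneq (tw x) 0.
    by rewrite /tw in t0; rewrite /tw t0 !mul0r mulr0.
  rewrite [leRHS]mulrCA ler_wpM2l ?trunc_weight_ge0//.
  by rewrite -[4%N]/(2 + 2)%N exprD ler_wpM2r ?sqr_ge0.
rewrite e_pow4; have := trunc_mean_le1; have := trunc_mean_ge0; have := L1.
by rewrite -/m; nra.
Qed.

(** The truncated mean is at most 1, so the values of [u^2] above [L / 2] are at distance at least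
    [L / 2 - 1] from it, and the weight there is at least 1. *)
Lemma trunc_var_ge : 2 <= L ->
  fine (P [set x | L / 2 < u x ^+ 2 <= L]) * (L / 2 - 1) ^+ 2 <= trunc_var.
Proof.
move=> L2; set A := [set x | _].
have mA : measurable A.
  have mle c : measurable [set x | u x ^+ 2 <= c].
    rewrite -[X in measurable X]setTI; apply: measurable_fun_le => //.
    exact: measurable_funX.
  rewrite (_ : A = ~` [set x | u x ^+ 2 <= L / 2] `&` [set x | u x ^+ 2 <= L]).
    by apply: measurableI => //; apply: measurableC.
  apply/seteqP; split => x /=; first by move=> /andP[u1 u2]; split => //; apply/negP; rewrite -ltNge.
  by move=> [/negP u1 u2]; rewrite /A/= u2 andbT ltNge.
rewrite -ERintegral_indic// mulrC -ERintegralZ; last exact: rintegrable_indic.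
apply: ERintegral_le.
- by apply: rintegrableZ; exact: rintegrable_indic.
- exact: (rintegrable_tw (wboundedX 2 b_cu)).
move=> x; rewrite indicE; case: (boolP (x \in A)) => [|_]; last first.
  by rewrite mulr0 mulr_ge0 ?sqr_ge0// trunc_weight_ge0.
rewrite inE/= => /andP[u1 u2]; rewrite mulr1 /trunc_weight /below u2 -/m.
have w1 : 1 <= (1 : R) / below_prob.
  rewrite ler_pdivlMr// mul1r -(ERintegral_cst P 1); apply: ERintegral_le => //.
    exact: rintegrable_cst.
  by move=> y; have /andP[] := below01 (u y).
apply: (@le_trans _ _ (1 * (u x ^+ 2 - m) ^+ 2)); last by rewrite ler_wpM2r ?sqr_ge0.
have := trunc_mean_le1; rewrite mul1r -/m => m1.
by rewrite ler_sqr ?nnegrE; lra.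
Qed.

Let zb := (1 + L) * (1 + h).

Let row_term_le x : u x ^+ 2 <= L -> `|row_term x| <= zb * (1 + w x ^+ 2).
Proof.
move=> uL; rewrite /row_term -/m.
have := cu_le uL; rewrite /cu => cL.
have uw : `|2 * h * (u x * w x)| <= h * (L + w x ^+ 2).
  rewrite !normrM (ger0_norm h0) normr_nat.
  have := sqr_ge0 (`|u x| - `|w x|); rewrite sqrrB !real_normK ?num_real//.
  set a := `|u x|; set b := `|w x| => ab.
  move: ab; rewrite mulr2n => ab.
  have -> : 2 * h * (a * b) = h * (a * b + a * b) by ring.
  by apply: ler_wpM2l => //; lra.
have ww : `|w x ^+ 2 - 1| <= w x ^+ 2 + 1.
  by rewrite ler_norml; have := sqr_ge0 (w x) => *; apply/andP; split; lra.
have := ler_normB (u x ^+ 2 - m + 2 * h * (u x * w x)) (w x ^+ 2 - 1).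
have := ler_normD (u x ^+ 2 - m) (2 * h * (u x * w x)).
rewrite /zb; have := h0; have := L1; have := sqr_ge0 (w x).
have : 0 <= h * (L * w x ^+ 2) by rewrite mulr_ge0// mulr_ge0 ?sqr_ge0//; have := L1; lra.
have : 0 <= L * w x ^+ 2 by rewrite mulr_ge0 ?sqr_ge0//; have := L1; lra.
by lra.
Qed.

Let measurable_row_term : measurable_fun setT row_term.
Proof.
have mw0 : measurable_fun setT w by exact (measurable_sub_sigma mZ mw_).
apply: measurable_funB; last by apply: measurable_funB => //; exact: measurable_funX.
apply: measurable_funD; first by apply: measurable_funB => //; exact: measurable_funX.
by apply: measurable_funM => //; exact: measurable_funM.
Qed.

Lemma rintegrable_row l : (l <= 4)%N ->
  rintegrable P (fun x => trunc_weight (u x) * row_term x ^+ l).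
Proof.
move=> l4; have mw0 : measurable_fun setT w by exact (measurable_sub_sigma mZ mw_).
have I8 : rintegrable P (fun x => 2 * (zb ^+ 4 * 8) * (1 + w x ^+ 8)).
  apply: rintegrableZ; apply: rintegrableD; first exact: rintegrable_cst.
  exact: (rintegrable_law mw0 laww (rintegrable_gauss_pow8 (R := R))).
refine (rintegrable_le _ _ I8).
  apply: measurable_funM; first exact: (measurableT_comp measurable_trunc_weight mu0).
  exact: measurable_funX.
move=> x; have [t0|/trunc_weight_below uL] := eqVneq (tw x) 0.
  rewrite /tw in t0; rewrite t0 mul0r normr0; apply: mulr_ge0.
    by apply: mulr_ge0 => //; apply: mulr_ge0 => //; rewrite exprn_even_ge0.
  by rewrite addr_ge0// exprn_even_ge0.
rewrite normrM (ger0_norm (trunc_weight_ge0 _)) -mulrA.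
apply: ler_pM; [exact: trunc_weight_ge0|by []|exact: weight_le2|].
rewrite normrX.
have z1 : 1 <= zb by rewrite /zb; have := L1; have := h0; nra.
set y := w x ^+ 2; have y0 : 0 <= y by exact: sqr_ge0.
have b1 : 1 <= zb * (1 + y) by nra.
apply: (@le_trans _ _ ((zb * (1 + y)) ^+ l)).
  by apply: lerXn2r; rewrite ?nnegrE//; [lra|exact: row_term_le].
apply: (le_trans (ler_weXn2l b1 l4)).
rewrite exprMn -mulrA; apply: ler_wpM2l; first by apply: exprn_ge0; lra.
rewrite -[8%N]/(2 * 4)%N exprM -/y -subr_ge0.
have -> : 8 * (1 + y ^+ 4) - (1 + y) ^+ 4 = (y - 1) ^+ 2 * (7 * y ^+ 2 + 10 * y + 7) by ring.
by apply: mulr_ge0; [exact: sqr_ge0|have := sqr_ge0 y; lra].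
Qed.

Let ig k : (k <= 8)%N -> rintegrable (@gauss R) (fun t => t ^+ k).
Proof. exact: rintegrable_gauss_pow. Qed.

Let ig1 : rintegrable (@gauss R) (fun t => t).
Proof. by have := @ig 1 isT; congr rintegrable; apply/funext => t; rewrite expr1. Qed.

Let E_id : E (fun t => t) = 0.
Proof. exact: Rintegral_gauss_odd. Qed.

Let igcw : rintegrable (@gauss R) (fun t => t ^+ 2 - 1).
Proof. by apply: rintegrableB; [exact: ig|exact: rintegrable_cst]. Qed.

Let E_cw : E (fun t => t ^+ 2 - 1) = 0.
Proof.
rewrite /E ERintegralB; [|exact: ig|exact: rintegrable_cst].
by rewrite Rintegral_gauss_sqr ERintegral_cst subrr.
Qed.

Lemma row_mean : \int[P]_x (trunc_weight (u x) * row_term x) = 0.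
Proof.
have -> : \int[P]_x (trunc_weight (u x) * row_term x) = \int[P]_x (tw x * cu (u x) +
    2 * h * (tw x * id (u x) * w x) - tw x * (fun=> 1) (u x) * (w x ^+ 2 - 1)).
  by apply: eq_Rintegral => x _; rewrite /row_term /cu /tw -/m /=; ring.
have i1 := rintegrable_tw b_cu.
have i2 := rintegrable_twM wbounded_id ig1.
have i3 := rintegrable_twM (wbounded_cst 1) igcw.
rewrite ERintegralB ?ERintegralD ?ERintegralZ//; [|exact: rintegrableZ|]; last first.
  by apply: rintegrableD => //; exact: rintegrableZ.
rewrite (Rintegral_twM wbounded_id ig1) (Rintegral_twM (wbounded_cst 1) igcw).
by rewrite E_id E_cw -/(e cu) e_cu !mulr0 addr0 subr0.
Qed.

(** The three parts of [row_term] are uncorrelated: every cross term contains an odd Gaussian moment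
    or a centred factor. *)
Lemma row_variance : \int[P]_x (trunc_weight (u x) * row_term x ^+ 2) =
  trunc_var + 4 * h ^+ 2 * trunc_mean + (E (fun t => t ^+ 4) - 1).
Proof.
have b_cu2 := wboundedX 2 b_cu.
have b_u2 := wboundedX 2 wbounded_id.
have b_cuu := wboundedM b_cu wbounded_id.
have b1 := wbounded_cst 1.
have igcw2 : rintegrable (@gauss R) (fun t => (t ^+ 2 - 1) ^+ 2).
  have : rintegrable (@gauss R) (fun t => t ^+ 4 - (2 * t ^+ 2 - 1)).
    apply: rintegrableB; first exact: ig.
    by apply: rintegrableB; [apply: rintegrableZ; exact: ig|exact: rintegrable_cst].
  by congr rintegrable; apply/funext => t; ring.
have igw3 : rintegrable (@gauss R) (fun t => t * (t ^+ 2 - 1)).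
  have : rintegrable (@gauss R) (fun t => t ^+ 3 - t).
    by apply: rintegrableB => //; exact: ig.
  by congr rintegrable; apply/funext => t; ring.
have E_cw2 : E (fun t => (t ^+ 2 - 1) ^+ 2) = E (fun t => t ^+ 4) - 1.
  have -> : E (fun t => (t ^+ 2 - 1) ^+ 2) = E (fun t => t ^+ 4 - (2 * t ^+ 2 - 1)).
    by apply: eq_Rintegral => t _; ring.
  have i2 : rintegrable (@gauss R) (fun t => 2 * t ^+ 2) by apply: rintegrableZ; exact: ig.
  rewrite /E ERintegralB; [|exact: ig|]; last by apply: rintegrableB => //; exact: rintegrable_cst.
  rewrite ERintegralB//; last exact: rintegrable_cst.
  rewrite ERintegralZ; last exact: ig.
  by rewrite Rintegral_gauss_sqr ERintegral_cst; ring.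
have E_w3 : E (fun t => t * (t ^+ 2 - 1)) = 0.
  by apply: Rintegral_gauss_odd => // t; rewrite sqrrN mulNr.
have i1 := rintegrable_tw b_cu2.
have i2 := rintegrable_twM b_u2 (ig (isT : (2 <= 8)%N)).
have i3 := rintegrable_twM b1 igcw2.
have i4 := rintegrable_twM b_cuu ig1.
have i5 := rintegrable_twM b_cu igcw.
have i6 := rintegrable_twM wbounded_id igw3.
have -> : \int[P]_x (trunc_weight (u x) * row_term x ^+ 2) = \int[P]_x (
    tw x * (fun t => cu t ^+ 2) (u x) + (4 * h ^+ 2 * (tw x * (fun t => t ^+ 2) (u x) * w x ^+ 2) +
    (tw x * (fun=> 1) (u x) * (w x ^+ 2 - 1) ^+ 2 +
    (4 * h * (tw x * (fun t => cu t * t) (u x) * w x) +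
    (- 2 * (tw x * cu (u x) * (w x ^+ 2 - 1)) +
    - (4 * h) * (tw x * id (u x) * (w x * (w x ^+ 2 - 1)))))))).
  by apply: eq_Rintegral => x _; rewrite /row_term /cu /tw -/m /=; ring.
have j6 := rintegrableZ (- (4 * h)) i6.
have j5 := rintegrableD (rintegrableZ (- 2) i5) j6.
have j4 := rintegrableD (rintegrableZ (4 * h) i4) j5.
have j3 := rintegrableD i3 j4.
have j2 := rintegrableD (rintegrableZ (4 * h ^+ 2) i2) j3.
rewrite (ERintegralD i1 j2) (ERintegralD (rintegrableZ (4 * h ^+ 2) i2) j3).
rewrite (ERintegralD i3 j4) (ERintegralD (rintegrableZ (4 * h) i4) j5).
rewrite (ERintegralD (rintegrableZ (- 2) i5) j6) !ERintegralZ//.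
rewrite (Rintegral_twM b_u2 (ig (isT : (2 <= 8)%N))) (Rintegral_twM b1 igcw2).
rewrite (Rintegral_twM b_cuu ig1) (Rintegral_twM b_cu igcw).
rewrite (Rintegral_twM wbounded_id igw3) E_w3 E_cw2 E_cw E_id e1.
have -> : E (fun t => t ^+ 2) = 1 by exact: Rintegral_gauss_sqr.
have -> : e (fun t => t ^+ 2) = trunc_mean by [].
have -> : \int[P]_x (tw x * cu (u x) ^+ 2) = trunc_var by [].
by ring.
Qed.

(** The factor 27 comes from [(a + b + c)^4 <= 27 (a^4 + b^4 + c^4)]. Truncation enters through
    [(u^2 - m)^4 <= L^2 (u^2 - m)^2], and [3 * 10^4] exceeds eight times the eighth Gaussian moment
    plus one. *)
Lemma row_fourth_moment : \int[P]_x (trunc_weight (u x) * row_term x ^+ 4) <=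
  27 * (L ^+ 2 * trunc_var + 16 * h ^+ 4 * E (fun t => t ^+ 4) * (trunc_var + 1) + 3 * 10 ^+ 4).
Proof.
have b_cu4 := wboundedX 4 b_cu.
have b_u4 := wboundedX 4 wbounded_id.
have b1 := wbounded_cst 1.
have i8 : rintegrable (@gauss R) (fun t => 8 * (t ^+ 8 + 1)).
  by apply: rintegrableZ; apply: rintegrableD; [exact: ig|exact: rintegrable_cst].
have cw4 t : (t ^+ 2 - 1) ^+ 4 <= 8 * (t ^+ 8 + 1) :> R.
  rewrite -[8%N]/(2 * 4)%N exprM; set y := t ^+ 2; rewrite -subr_ge0.
  have -> : 8 * (y ^+ 4 + 1) - (y - 1) ^+ 4 = (y + 1) ^+ 2 * (7 * (y - 5 / 7) ^+ 2 + 24 / 7).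
    by field.
  by apply: mulr_ge0; [exact: sqr_ge0|have := sqr_ge0 (y - 5 / 7); lra].
have igcw4 : rintegrable (@gauss R) (fun t => (t ^+ 2 - 1) ^+ 4).
  refine (rintegrable_le _ _ i8).
    by apply: measurable_funX; apply: measurable_funB => //; exact: measurable_funX.
  by move=> t; rewrite ger0_norm ?exprn_even_ge0.
have E_cw4 : E (fun t => (t ^+ 2 - 1) ^+ 4) <= 3 * 10 ^+ 4.
  apply: (@le_trans _ _ (E (fun t => 8 * (t ^+ 8 + 1)))); first exact: ERintegral_le.
  rewrite /E ERintegralZ; last by apply: rintegrableD; [exact: ig|exact: rintegrable_cst].
  rewrite ERintegralD; [|exact: ig|exact: rintegrable_cst].
  by rewrite ERintegral_cst; have := Rintegral_gauss_pow8 (R := R); lra.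
have i1 := rintegrable_tw b_cu4.
have i2 := rintegrable_twM b_u4 (ig (isT : (4 <= 8)%N)).
have i3 := rintegrable_twM b1 igcw4.
have j2 := rintegrableZ (16 * h ^+ 4) i2.
have j3 := rintegrableD j2 i3.
have j1 := rintegrableD i1 j3.
apply: (@le_trans _ _ (\int[P]_x (27 * (tw x * (fun t => cu t ^+ 4) (u x) +
    (16 * h ^+ 4 * (tw x * (fun t => t ^+ 4) (u x) * w x ^+ 4) +
    tw x * (fun=> 1) (u x) * (w x ^+ 2 - 1) ^+ 4))))).
  apply: ERintegral_le; [exact: rintegrable_row|exact: rintegrableZ|].
  move=> x; rewrite /row_term -/m /= -/(cu (u x)) /tw.
  set t := trunc_weight _; have t0 : 0 <= t by exact: trunc_weight_ge0.
  set a := cu (u x); set b := 2 * h * (u x * w x); set c := w x ^+ 2 - 1.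
  have -> : 27 * (t * a ^+ 4 + (16 * h ^+ 4 * (t * u x ^+ 4 * w x ^+ 4) + t * 1 * c ^+ 4)) =
    t * (27 * (a ^+ 4 + b ^+ 4 + c ^+ 4)) by rewrite /b; ring.
  apply: ler_wpM2l => //.
  have sq3 (x1 x2 x3 : R) : (x1 + x2 + x3) ^+ 2 <= 3 * (x1 ^+ 2 + x2 ^+ 2 + x3 ^+ 2).
    by have := sqr_ge0 (x1 - x2); have := sqr_ge0 (x1 - x3); have := sqr_ge0 (x2 - x3); nra.
  have s1 := sq3 a b (- c); rewrite sqrrN in s1.
  have s2 := sq3 (a ^+ 2) (b ^+ 2) (c ^+ 2).
  rewrite -[4%N]/(2 * 2)%N !exprM.
  have s3 : ((a + b - c) ^+ 2) ^+ 2 <= (3 * (a ^+ 2 + b ^+ 2 + c ^+ 2)) ^+ 2.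
    by apply: lerXn2r; rewrite ?nnegrE ?sqr_ge0// mulr_ge0// !addr_ge0 ?sqr_ge0.
  apply: (le_trans s3); rewrite exprMn.
  have -> : (3 : R) ^+ 2 = 9 by ring.
  by move: s2; set A2 := (_ + _ + _) ^+ 2; lra.
rewrite (ERintegralZ 27 j1) (ERintegralD i1 j3) (ERintegralD j2 i3) (ERintegralZ _ i2).
rewrite (Rintegral_twM b_u4 (ig (isT : (4 <= 8)%N))) (Rintegral_twM b1 igcw4) e1 mul1r.
have E40 : 0 <= E (fun t => t ^+ 4) by apply: ERintegral_ge0 => t; rewrite exprn_even_ge0.
have h4 : 0 <= 16 * h ^+ 4 by rewrite mulr_ge0// exprn_even_ge0.
have m2 : m ^+ 2 <= 1 by have := trunc_mean_le1; have := trunc_mean_ge0; rewrite -/m; nra.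
have k1 : \int[P]_x (tw x * cu (u x) ^+ 4) <= L ^+ 2 * trunc_var.
  rewrite -ERintegralZ; last exact: (rintegrable_tw (wboundedX 2 b_cu)).
  apply: ERintegral_le => //.
    by apply: rintegrableZ; exact: (rintegrable_tw (wboundedX 2 b_cu)).
  move=> x; have [t0|/trunc_weight_below uL] := eqVneq (tw x) 0.
    by rewrite /tw in t0; rewrite /tw t0 !mul0r mulr0.
  rewrite [leRHS]mulrCA ler_wpM2l ?trunc_weight_ge0//.
  rewrite -[4%N]/(2 + 2)%N exprD ler_wpM2r ?sqr_ge0//.
  rewrite -(real_normK (num_real (cu (u x)))); apply: lerXn2r; rewrite ?nnegrE//.
    by have := L1; lra.
  exact: cu_le.
have k2 : 16 * h ^+ 4 * (e (fun t => t ^+ 4) * E (fun t => t ^+ 4)) <=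
    16 * h ^+ 4 * E (fun t => t ^+ 4) * (trunc_var + 1).
  rewrite e_pow4 -[leRHS]mulrA; apply: ler_wpM2l => //.
  by rewrite mulrC; apply: ler_wpM2l => //; rewrite lerD2l.
by lra.
Qed.

End truncated_row.

(** * Lower tail of the log-likelihood ratio *)

(** [Dl] is the total loss of mean due to truncation, [Vv] the share of the truncated squares in the
    variance [V], and [C n] the noise part of the fourth moment. The dangerous term is [L^2 Vv]. If
    [V] is at most a multiple of [Dl^2], the loss of mean decides and no fourth moment is needed.
    Otherwise the last hypothesis bounds [L] by the order of [Dl] or of the root of [Vv], hence
    [L^2] by the order of [V]. *)
Lemma tail_dichotomy (R : realType) (n h L K Dl Vv V tau T C kap : R) :
  1 <= K -> 0 <= h -> 1 <= n -> 1 <= kap -> 11 / 10 <= tau -> tau <= T ->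
  0 <= C -> 3 + 27 * (112 + 20 * T + 100 * C) <= kap ->
  0 <= Dl -> Dl <= n -> 0 <= Vv -> Vv <= L * n ->
  V = Vv + 4 * h ^+ 2 * (n - Dl) + (tau - 1) * n ->
  10 * (16 * kap * K) ^+ 2 * (1 + h ^+ 2) <= n ->
  L = 1 \/ [/\ 2 <= L, L <= 4 * n & (L - 1) / 4 <= Dl \/ (L / 2 - 1) ^+ 2 / 4 <= Vv] ->
  (2 * (K * (1 + h ^+ 2)) <= Dl /\ V <= 4 * (8 + T) * Dl ^+ 2) \/
  (3 * V ^+ 2 + 27 * (L ^+ 2 * Vv + 16 * h ^+ 4 * tau * (Vv + n) + C * n)
     <= kap * V ^+ 2 /\ (16 * kap * (K * (1 + h ^+ 2))) ^+ 2 <= V).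
Proof.
move=> K1 h0 n1 kap1 tau1 tau2 C0 HT D0 Dn V0 VL VE nbig HL; move: HT.
pose g := 1 + h ^+ 2; have g1 : 1 <= g by rewrite /g lerDl sqr_ge0.
rewrite -/g in nbig *.
pose M := (16 * kap * K) ^+ 2; rewrite -/M in nbig.
have K2g0 : 0 <= K ^+ 2 * g by apply: mulr_ge0; [exact: sqr_ge0|lra].
have K2g : K ^+ 2 * g * 40 <= n.
  apply: le_trans nbig.
  have -> : K ^+ 2 * g * 40 = 10 * (2 * K) ^+ 2 * g by ring.
  apply: ler_wpM2r; first lra.
  apply: ler_wpM2l => //; apply: lerXn2r; rewrite ?nnegrE; [lra| |].
    by apply: mulr_ge0; lra.
  by apply: ler_wpM2r; lra.
have Kg : K * g <= K ^+ 2 * g by rewrite ler_wpM2r; [|lra|nra].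
have gKg : g <= K * g by rewrite ler_peMl//; lra.
have hn : h ^+ 2 <= n by rewrite /g in gKg K2g Kg g1; lra.
have L4n : L <= 4 * n by case: HL => [->|[]//]; lra.
have n0 : 0 < n by lra.
have LL1 : 1 <= L by case: HL => [->|[]]; lra.
(* When more than half of the mean is lost, [4 h^2 (n - Dl)] gives no useful lower bound on [V].
   Instead [V] is at most a multiple of [n^2], hence of [Dl^2]. *)
have [Dn2|Dn2] := ltP (n / 2) Dl.
  move=> _; left; split; first by lra.
  have V1 : V <= (8 + T) * n ^+ 2.
    have : Vv <= 4 * n ^+ 2 by apply: (le_trans VL); rewrite expr2 mulrA ler_wpM2r// ltW.
    have : 4 * h ^+ 2 * (n - Dl) <= 4 * n ^+ 2.
      by rewrite -mulrA ler_wpM2l// expr2; apply: ler_pM; rewrite ?sqr_ge0//; lra.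
    have : (tau - 1) * n <= T * n ^+ 2.
      rewrite expr2 mulrA; apply: ler_pM; [lra|lra| |by []].
      have : T <= T * n by rewrite ler_peMr//; lra.
      by lra.
    by rewrite VE; lra.
  have : n ^+ 2 <= (2 * Dl) ^+ 2 by apply: lerXn2r; rewrite ?nnegrE; lra.
  rewrite exprMn => nD; apply: (le_trans V1).
  have -> : 4 * (8 + T) * Dl ^+ 2 = (8 + T) * (2 ^+ 2 * Dl ^+ 2) by ring.
  by apply: ler_wpM2l => //; lra.
have hD : 4 * h ^+ 2 * (n - Dl) >= 2 * h ^+ 2 * n.
  have -> : 2 * h ^+ 2 * n = 4 * h ^+ 2 * (n / 2) by field.
  by rewrite ler_wpM2l// ?mulr_ge0 ?sqr_ge0//; lra.
have tn : (tau - 1) * n >= n / 10 by rewrite mulrC ler_wpM2r//; lra.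
have Vng : n * g / 10 <= V.
  have : 0 <= h ^+ 2 * n by rewrite mulr_ge0 ?sqr_ge0// ltW.
  by rewrite /g; lra.
have Vn : n / 10 <= V.
  by apply: le_trans Vng; rewrite ler_wpM2r// ler_peMr// ltW.
have V2n : 2 * h ^+ 2 * n <= V by lra.
have Vv_V : Vv <= V.
  have : 0 <= h ^+ 2 * n by rewrite mulr_ge0 ?sqr_ge0// ltW.
  by lra.
have Kg2V : (2 * (K * g)) ^+ 2 <= V.
  apply: le_trans Vng.
  have -> : (2 * (K * g)) ^+ 2 = (4 * (K ^+ 2 * g)) * g by ring.
  by rewrite [leRHS]mulrAC; apply: ler_wpM2r; lra.
(* By now [V] is at least [n (1 + h^2) / 10], which beats all required constants. It remains to
   compare it with [Dl^2]. *)
clear VE K2g Kg gKg hD tn; have [DV|DV] := leP V (Dl ^+ 2).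
  move=> _; left; split; last first.
    apply: (le_trans DV); rewrite ler_peMl ?sqr_ge0//; lra.
  rewrite -(@ler_pXn2r _ 2)// ?nnegrE//; first exact: le_trans DV.
  by rewrite mulr_ge0// mulr_ge0//; lra.
move=> HT; right; split; last first.
  apply: le_trans Vng.
  have -> : (16 * kap * (K * g)) ^+ 2 = (10 * M * g) * g / 10 by rewrite /M; field.
  by rewrite ler_wpM2r// ler_wpM2r//; lra.
clear nbig Kg2V K2g0 Vng M; have V10 : 10^-1 <= V by lra.
have VV : V <= 10 * V ^+ 2 by rewrite expr2; nra.
have nV : n <= 100 * V ^+ 2 by lra.
(* As [Dl^2 < V] and [Vv <= V], each alternative on [L] gives [L^2 <= 8 + 32 V]; the constant 8 is
   absorbed by [V >= 1/10]. *)
have L2 : L ^+ 2 * Vv <= 112 * V ^+ 2.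
  case: HL => [->|[L2 _ [LD|LV]]].
  - by rewrite expr1n mul1r; have := sqr_ge0 V; lra.
  - have : L ^+ 2 <= 2 + 32 * V.
      have : L ^+ 2 <= (1 + 4 * Dl) ^+ 2 by apply: lerXn2r; rewrite ?nnegrE; lra.
      by have := sqr_ge0 (1 - 4 * Dl); lra.
    move=> LV; have : L ^+ 2 * Vv <= (2 + 32 * V) * V.
      by apply: ler_pM => //; exact: sqr_ge0.
    by have := sqr_ge0 V; lra.
  - have : L ^+ 2 <= 8 + 32 * V by have := sqr_ge0 (L / 2 - 2); lra.
    move=> LV'; have : L ^+ 2 * Vv <= (8 + 32 * V) * V.
      by apply: ler_pM => //; exact: sqr_ge0.
    by have := sqr_ge0 V; lra.
have h4 : h ^+ 4 * (Vv + n) <= 5 / 4 * V ^+ 2.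
  have : Vv + n <= 5 * n ^+ 2.
    have : Vv <= 4 * n ^+ 2 by apply: (le_trans VL); rewrite expr2 mulrA ler_wpM2r// ltW.
    have nn : n <= n ^+ 2 by rewrite expr2 ler_peMr// ltW.
    by lra.
  move=> Vn5; have h4_0 : 0 <= h ^+ 4 by rewrite exprn_ge0.
  apply: (le_trans (ler_wpM2l h4_0 Vn5)).
  have : (2 * h ^+ 2 * n) ^+ 2 <= V ^+ 2.
    apply: lerXn2r => //; rewrite nnegrE; last lra.
    by rewrite mulr_ge0// ?mulr_ge0 ?sqr_ge0// ltW.
  have -> : (2 * h ^+ 2 * n) ^+ 2 = 4 * (h ^+ 4 * n ^+ 2) by ring.
  by lra.
have h4' : 16 * h ^+ 4 * tau * (Vv + n) <= 20 * T * V ^+ 2.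
  have -> : 16 * h ^+ 4 * tau * (Vv + n) = 16 * tau * (h ^+ 4 * (Vv + n)) by ring.
  have -> : 20 * T * V ^+ 2 = 16 * T * (5 / 4 * V ^+ 2) by field.
  apply: ler_pM => //; [lra| |lra].
  by apply: mulr_ge0; [exact: exprn_ge0|lra].
have Cn : C * n <= C * (100 * V ^+ 2) by apply: ler_wpM2l.
have V2 := sqr_ge0 V.
have := ler_wpM2r V2 HT.
have -> : 27 * (L ^+ 2 * Vv + 16 * h ^+ 4 * tau * (Vv + n) + C * n) =
  27 * (L ^+ 2 * Vv) + 27 * (16 * h ^+ 4 * tau * (Vv + n)) + 27 * (C * n) by ring.
move: L2 h4' Cn; move: (L ^+ 2 * Vv) (16 * h ^+ 4 * tau * (Vv + n)) (C * n) => a b r.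
clear; lra.
Qed.

Lemma weierstrass_prod (R : realType) (m : nat) (q : nat -> R) : (forall i, (i < m)%N -> 0 <= q i <= 1) ->
  1 - \sum_(i < m) (1 - q i) <= \prod_(i < m) q i <= 1.
Proof.
elim: m => [|m IH] q01; first by rewrite !big_ord0 subr0 lexx.
have /andP[IH1 IH2] : 1 - \sum_(i < m) (1 - q i) <= \prod_(i < m) q i <= 1.
  by apply: IH => i im; apply: q01; rewrite ltnS ltnW.
have /andP[q0 q1] := q01 m (ltnSn m).
have p0 : 0 <= \prod_(i < m) q i.
  by apply: prodr_ge0 => i _; have /andP[] := q01 i (leqW (ltn_ord i)).
rewrite !big_ord_recr/=; move: IH1 IH2 p0.
set a := \prod_(i < m) _; set b := \sum_(i < m) _ => H1 H2 H3.
by apply/andP; split; nra.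
Qed.

Section row_sums.
Context (R : realType) (d : measure_display) (Omega : measurableType d)
  (P : probability Omega R) (I : finType).
Variable Z : I -> Omega -> R.
Hypothesis mZ : forall i, measurable_fun setT (Z i).
Hypothesis indZ : mutually_independent P Z.
Variable rk : I -> nat.
Variables (n : nat) (J1 J2 : nat -> {set I}) (u w : nat -> Omega -> R).
Hypothesis dJ : forall i j, (i < n)%N -> j \in J1 i -> j \notin J2 i.
Hypothesis sJ1 : forall i j, (i < n)%N -> j \in J1 i -> rk j = i.
Hypothesis sJ2 : forall i j, (i < n)%N -> j \in J2 i -> rk j = i.
Hypothesis mu_ : forall i, (i < n)%N -> measurable_fun setT (u i : sub_sigma Z (J1 i) -> R).
Hypothesis mw_ : forall i, (i < n)%N -> measurable_fun setT (w i : sub_sigma Z (J2 i) -> R).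
Hypothesis laww : forall i, (i < n)%N ->
  forall A, measurable A -> P (w i @^-1` A) = gauss A.
Hypothesis int_u : forall i, (i < n)%N -> rintegrable P (fun x => u i x ^+ 2).
Hypothesis E_u : forall i, (i < n)%N -> \int[P]_x (u i x ^+ 2) = 1.

Let mu0 i : (i < n)%N -> measurable_fun setT (u i).
Proof. by move=> i_n; exact (measurable_sub_sigma mZ (mu_ i_n)). Qed.

Let measurable_sqr_le i c : (i < n)%N -> measurable [set x | u i x ^+ 2 <= c].
Proof.
move=> i_n; rewrite -[X in measurable X]setTI; apply: measurable_fun_le => //.
by apply: measurable_funX; exact: mu0.
Qed.

Let below_indic i c x : below c (u i x) = \1_[set x | u i x ^+ 2 <= c] x.
Proof.
by rewrite /below indicE; congr (nat_of_bool _)%:R; apply/idP/idP; rewrite inE.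
Qed.

Let below_probE i c : (i < n)%N -> below_prob P (u i) c = fine (P [set x | u i x ^+ 2 <= c]).
Proof.
move=> i_n; rewrite -ERintegral_indic; last exact: measurable_sqr_le.
by apply: eq_Rintegral => x _; exact: below_indic.
Qed.

Let below_prob_le1 i c : (i < n)%N -> below_prob P (u i) c <= 1.
Proof. by move=> i_n; rewrite below_probE// fine_prob_le1//; exact: measurable_sqr_le. Qed.

Let below_prob_markov i c : (i < n)%N -> 0 < c -> 1 - below_prob P (u i) c <= c^-1.
Proof.
move=> i_n c0; rewrite below_probE// -fine_probC; last exact: measurable_sqr_le.
have mA := measurable_sqr_le c i_n.
apply: (@le_trans _ _ (fine (P [set x | c <= u i x ^+ 2]))).
  apply: fine_prob_le; first exact: measurableC.
    rewrite -[X in measurable X]setTI; apply: measurable_fun_le => //.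
    by apply: measurable_funX; exact: mu0.
  by move=> x /=; move=> /negP; rewrite -ltNge => /ltW.
rewrite -[leRHS]mul1r -(E_u i_n); apply: markov_prob => //; first exact: int_u.
by move=> x; exact: sqr_ge0.
Qed.

Let tail_sum c := \sum_(i < n) (1 - below_prob P (u i) c).

(** The tails are summed over all rows so that the product of the weights stays bounded. Minimality
    of the exponent gives the tail above [L / 2], and Markov's inequality for second moment 1 gives
    [L <= 4 n]. *)
Let truncation_level : exists L : R, [/\ 1 <= L, tail_sum L <= 2^-1 &
  L = 1 \/ [/\ 2 <= L, L <= 4 * n%:R & 2^-1 < tail_sum (L / 2)]].
Proof.
pose ok j := tail_sum (2 ^+ j) <= 2^-1.
have tsum c : 0 < c -> tail_sum c <= n%:R / c.
  move=> c0; apply: (@le_trans _ _ (\sum_(i < n) c^-1)).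
    by apply: ler_sum => i _; exact: below_prob_markov.
  by rewrite sumr_const card_ord -[leLHS]mulr_natl.
have ex_ok : exists j, ok j.
  exists n.+1; apply: (le_trans (tsum _ _)); first exact: exprn_gt0.
  rewrite ler_pdivrMr ?exprn_gt0// exprS mulrA mulVf// mul1r.
  by rewrite -natrX ler_nat ltnW// ltn_expl.
case: (ex_minnP ex_ok) => -[|j] okj minj.
  by exists 1; split => //; left.
have j2 : 2 ^+ j.+1 / 2 = 2 ^+ j :> R by rewrite exprS mulrC mulrA mulVf// mul1r.
have big : 2^-1 < tail_sum (2 ^+ j).
  by rewrite ltNge; apply/negP => /minj; rewrite ltnn.
have p1 : 1 <= 2 ^+ j :> R by rewrite exprn_ege1// ler1n.
exists (2 ^+ j.+1); split => //; first by rewrite exprn_ege1// ler1n.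
right; split; last by rewrite j2.
  by rewrite exprS ler_peMr.
have : 2^-1 < n%:R / 2 ^+ j :> R.
  by apply: (lt_le_trans big); apply: tsum; rewrite exprn_gt0.
rewrite ltr_pdivlMr ?exprn_gt0// exprS; lra.
Qed.

Variables (K h : R).
Hypotheses (K1 : 1 <= K) (h0 : 0 <= h).

(* Only its size matters: it absorbs the constants of the fourth moment bound. *)
Definition tail_const : R := 10 ^+ 8.
Local Notation kap := tail_const.
Hypothesis n_large : 10 * (16 * kap * K) ^+ 2 * (1 + h ^+ 2) <= n%:R.

Local Notation tau := (\int[@gauss R]_t (t ^+ 4)).

Lemma gauss_pow4_le : tau <= 1251.
Proof.
have : tau <= \int[@gauss R]_t (2^-1 * (1 + t ^+ 8)).
  apply: ERintegral_le; first exact: rintegrable_gauss_pow.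
    apply: rintegrableZ; apply: rintegrableD; first exact: rintegrable_cst.
    exact: rintegrable_gauss_pow8.
  move=> t; rewrite -[8%N]/(4 * 2)%N exprM; have := sqr_ge0 (t ^+ 4 - 1).
  by set y := t ^+ 4; lra.
rewrite ERintegralZ; last first.
  by apply: rintegrableD; [exact: rintegrable_cst|exact: rintegrable_gauss_pow8].
rewrite ERintegralD; [|exact: rintegrable_cst|exact: rintegrable_gauss_pow8].
by rewrite ERintegral_cst; have := @Rintegral_gauss_pow8 R; lra.
Qed.

Definition quad_sum x := \sum_(i < n) (u i x ^+ 2 + 2 * h * (u i x * w i x) - w i x ^+ 2).

Let mw0 i : (i < n)%N -> measurable_fun setT (w i).
Proof. by move=> i_n; exact (measurable_sub_sigma mZ (mw_ i_n)). Qed.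

Lemma measurable_quad_sum : measurable_fun setT quad_sum.
Proof.
apply: measurable_sum => i; have := mu0 (ltn_ord i); have := mw0 (ltn_ord i) => mwi mui.
apply: measurable_funB; last exact: measurable_funX.
apply: measurable_funD; first exact: measurable_funX.
by apply: measurable_funM => //; exact: measurable_funM.
Qed.

Section with_level.
Variable L : R.
Hypotheses (L1 : 1 <= L) (L_tail : tail_sum L <= 2^-1).
Hypothesis L_min : L = 1 \/ [/\ 2 <= L, L <= 4 * n%:R & 2^-1 < tail_sum (L / 2)].

Let q i := below_prob P (u i) L.
Let m i := trunc_mean P (u i) L.
Let v i := trunc_var P (u i) L.

Let q_ge i : (i < n)%N -> 2^-1 <= q i.
Proof.
move=> i_n; have : 1 - q i <= tail_sum L.
  rewrite /tail_sum (bigD1 (Ordinal i_n))//= lerDl; apply: sumr_ge0 => j _.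
  by rewrite subr_ge0; exact: below_prob_le1.
by have := L_tail; lra.
Qed.

(** Rows from [n] on get weight 1 and term 0, so that the moment hypotheses hold at every index. *)
Let phi i x := if (i < n)%N then trunc_weight P (u i) L (u i x) else 1.
Let z i x := if (i < n)%N then row_term P (u i) (w i) L h x else 0.

Let J1block i : (i < n)%N -> forall j, j \in J1 i -> j \in block rk i.
Proof. by move=> i_n j /(sJ1 i_n) rj; rewrite inE rj. Qed.
Let J2block i : (i < n)%N -> forall j, j \in J2 i -> j \in block rk i.
Proof. by move=> i_n j /(sJ2 i_n) rj; rewrite inE rj. Qed.

Let mphi i : measurable_fun setT (phi i : sub_sigma Z (block rk i) -> R).
Proof.
rewrite /phi; case: (boolP (i < n)%N) => // i_n.
apply: (measurable_sub_sigmaS (J1block i_n)).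
exact: (measurableT_comp (measurable_trunc_weight _ _ _) (mu_ i_n)).
Qed.

Let mz i : measurable_fun setT (z i : sub_sigma Z (block rk i) -> R).
Proof.
rewrite /z; case: (boolP (i < n)%N) => // i_n.
have mui := measurable_sub_sigmaS (J1block i_n) (mu_ i_n).
have mwi := measurable_sub_sigmaS (J2block i_n) (mw_ i_n).
apply: measurable_funB; last by apply: measurable_funB => //; exact: measurable_funX.
apply: measurable_funD; first by apply: measurable_funB => //; exact: measurable_funX.
by apply: measurable_funM => //; exact: measurable_funM.
Qed.

Let int_phiz i l : (l <= 4)%N -> rintegrable P (fun x => phi i x * z i x ^+ l).
Proof.
move=> l4; rewrite /phi /z; case: (boolP (i < n)%N) => [i_n|_]; last exact: rintegrable_cst.
exact: (rintegrable_row mZ (mu_ i_n) (mw_ i_n) (laww i_n) (int_u i_n) (E_u i_n) L1 h0 (q_ge i_n) l4).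
Qed.

Let phi_mean i : step_moment P phi z i 0 = 1.
Proof.
rewrite /step_moment /phi /z; case: (boolP (i < n)%N) => [i_n|_]; last first.
  by rewrite expr0 mulr1 ERintegral_cst.
under eq_Rintegral do rewrite expr0 mulr1.
exact: (Rintegral_trunc_weight mZ (mu_ i_n) (q_ge i_n)).
Qed.

Let z_mean i : step_moment P phi z i 1 = 0.
Proof.
rewrite /step_moment /phi /z; case: (boolP (i < n)%N) => [i_n|_]; last first.
  by rewrite expr1 mulr0 ERintegral_cst.
under eq_Rintegral do rewrite expr1.
exact: (row_mean mZ indZ (fun j => @dJ i j i_n) (mu_ i_n) (mw_ i_n) (laww i_n) h L1 (q_ge i_n)).
Qed.

Let phi_ge0 i x : 0 <= phi i x.
Proof. by rewrite /phi; case: (boolP (i < n)%N) => // i_n; exact: (trunc_weight_ge0 (q_ge i_n)). Qed.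

Let V := \sum_(i < n) step_moment P phi z i 2.
Let Dl := \sum_(i < n) (1 - m i).
Let Vv := \sum_(i < n) v i.

Let sm2 (i : 'I_n) : step_moment P phi z i 2 = v i + 4 * h ^+ 2 * m i + (tau - 1).
Proof.
rewrite /step_moment /phi /z ltn_ord.
exact: (row_variance mZ indZ (fun j => @dJ i j (ltn_ord i)) (mu_ (ltn_ord i)) (mw_ (ltn_ord i))
  (laww (ltn_ord i)) h L1 (q_ge (ltn_ord i))).
Qed.

Let sm4 (i : 'I_n) : step_moment P phi z i 4 <=
  27 * (L ^+ 2 * v i + 16 * h ^+ 4 * tau * (v i + 1) + 3 * 10 ^+ 4).
Proof.
rewrite /step_moment /phi /z ltn_ord.
exact: (row_fourth_moment mZ indZ (fun j => @dJ i j (ltn_ord i)) (mu_ (ltn_ord i))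
  (mw_ (ltn_ord i)) (laww (ltn_ord i)) (int_u (ltn_ord i)) (E_u (ltn_ord i)) L1 h0
  (q_ge (ltn_ord i))).
Qed.

Let m_le1 (i : 'I_n) : m i <= 1.
Proof.
exact: (trunc_mean_le1 mZ (mu_ (ltn_ord i)) (int_u (ltn_ord i)) (E_u (ltn_ord i)) L1
  (q_ge (ltn_ord i))).
Qed.

Let m_ge0 (i : 'I_n) : 0 <= m i.
Proof.
apply: ERintegral_ge0 => x; apply: mulr_ge0; last exact: sqr_ge0.
exact: (trunc_weight_ge0 (q_ge (ltn_ord i))).
Qed.

Let v_ge0 (i : 'I_n) : 0 <= v i.
Proof.
apply: ERintegral_ge0 => x; apply: mulr_ge0; last exact: sqr_ge0.
exact: (trunc_weight_ge0 (q_ge (ltn_ord i))).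
Qed.

Let v_le (i : 'I_n) : v i <= L.
Proof.
exact: (trunc_var_le mZ (mu_ (ltn_ord i)) (int_u (ltn_ord i)) (E_u (ltn_ord i)) L1
  (q_ge (ltn_ord i))).
Qed.

Let VE : V = Vv + 4 * h ^+ 2 * (n%:R - Dl) + (tau - 1) * n%:R.
Proof.
rewrite /V (eq_bigr (fun i : 'I_n => v i + 4 * h ^+ 2 * m i + (tau - 1))); last first.
  by move=> i _; exact: sm2.
have DlE : Dl = n%:R - \sum_(i < n) m i by rewrite /Dl sumrB sumr_const card_ord.
rewrite big_split/= big_split/= -mulr_sumr [X in _ + X]sumr_const card_ord.
by rewrite -[X in _ + X]mulr_natr DlE /Vv; ring.
Qed.

(** [tail_sum (L / 2)] is [tail_sum L] plus the mass between the two levels. It exceeds 1/2, so one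
    of the parts is at least 1/4: mass above [L] lowers the mean, mass in between raises the
    variance. *)
Let L_alternative : L = 1 \/ [/\ 2 <= L, L <= 4 * n%:R &
  (L - 1) / 4 <= Dl \/ (L / 2 - 1) ^+ 2 / 4 <= Vv].
Proof.
case: L_min => [->|[L2 L4n L_half]]; [by left|right; split => //].
pose b i := q i - below_prob P (u i) (L / 2).
have bE (i : 'I_n) : b i = fine (P [set x | L / 2 < u i x ^+ 2 <= L]).
  have i_n := ltn_ord i; rewrite /b /q !below_probE//.
  set A := [set x | u i x ^+ 2 <= L / 2]; set C := [set x | L / 2 < u i x ^+ 2 <= L].
  have mA : measurable A by exact: measurable_sqr_le.
  have CE : C = [set x | u i x ^+ 2 <= L] `\` A.
    apply/seteqP; split => x /=.
      by rewrite /C/= => /andP[x1 x2]; split => //; apply/negP; rewrite -ltNge.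
    by move=> [x1 /negP x2]; rewrite /C/= x1 andbT ltNge.
  have mC : measurable C by rewrite CE; apply: measurableD => //; exact: measurable_sqr_le.
  have -> : [set x | u i x ^+ 2 <= L] = A `|` C.
    apply/seteqP; split => x /=.
      by move=> x1; case: (leP (u i x ^+ 2) (L / 2)) => x2; [left|right; apply/andP].
    by move=> [|/andP[]//]; rewrite /A/=; have := L1; lra.
  rewrite measureU ?fineD ?fin_num_measure//; first lra.
  by apply/seteqP; split => x /=; [rewrite /A /C/= => -[x1 /andP[x2 _]]; lra|].
have tsum : tail_sum (L / 2) = tail_sum L + \sum_(i < n) b i.
  by rewrite /tail_sum -big_split/=; apply: eq_bigr => i _; rewrite /b /q; lra.
have [big|small] := leP 4^-1 (tail_sum L).
  left; apply: (@le_trans _ _ (tail_sum L * (L - 1))).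
    by rewrite mulrC ler_wpM2r//; have := L1; lra.
  rewrite mulr_suml; apply: ler_sum => i _.
  exact: (trunc_mean_deficit mZ (mu_ (ltn_ord i)) (int_u (ltn_ord i)) (E_u (ltn_ord i)) L1
    (q_ge (ltn_ord i))).
right; apply: (@le_trans _ _ ((\sum_(i < n) b i) * (L / 2 - 1) ^+ 2)).
  rewrite mulrC ler_wpM2r ?sqr_ge0//; move: L_half; rewrite tsum; lra.
rewrite mulr_suml; apply: ler_sum => i _; rewrite bE.
exact: (trunc_var_ge mZ (mu_ (ltn_ord i)) (int_u (ltn_ord i)) (E_u (ltn_ord i)) L1
    (q_ge (ltn_ord i)) L2).
Qed.

Let Phi := wprod phi n.
Let S := wsum z n.

(** Centring at the truncated means instead of 1 is a shift by [Dl], so a loss of mean pushes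
    [quad_sum] down. *)
Let SE x : S x = quad_sum x + Dl.
Proof.
rewrite /S /wsum /quad_sum /Dl -big_split/=; apply: eq_bigr => i _.
by rewrite /z ltn_ord /row_term /m; lra.
Qed.

Let Phi_ge0 x : 0 <= Phi x.
Proof. by apply: prodr_ge0 => i _; exact: phi_ge0. Qed.

(** By Weierstrass' product inequality the [q i] multiply to at least 1/2. A lower bound under the
    truncated law therefore holds under [P] with half its value. *)
Let Phi_le2 x : Phi x <= 2.
Proof.
have /andP[pq _] : 1 - \sum_(i < n) (1 - q i) <= \prod_(i < n) q i <= 1.
  apply: weierstrass_prod => i i_n; rewrite below_prob_le1// andbT.
  by have := q_ge i_n; rewrite /q; lra.
have p2 : 2^-1 <= \prod_(i < n) q i by have := L_tail; rewrite /tail_sum; move: pq; rewrite /q; lra.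
apply: (@le_trans _ _ (\prod_(i < n) (q i)^-1)).
  apply: ler_prod => i _; rewrite phi_ge0/= /phi ltn_ord /trunc_weight.
  rewrite -[leRHS]mul1r ler_wpM2r ?invr_ge0//; first by have := q_ge (ltn_ord i); rewrite /q; lra.
  by rewrite /below; case: (_ ^+ 2 <= L).
by rewrite -[leRHS]invrK prodfV lef_pV2 ?posrE//; lra.
Qed.

Let measurable_S_le c : measurable [set x | S x <= c].
Proof.
rewrite -[X in measurable X]setTI; apply: measurable_fun_le => //.
exact (measurable_sub_sigma mZ (@measurable_wsum _ _ _ _ Z rk z mz n)).
Qed.

Let weighted_le c : \int[P]_x (Phi x * \1_[set x | S x <= c] x) <=
  2 * fine (P [set x | S x <= c]).
Proof.
have mS := measurable_S_le c; have I1 := rintegrable_indic P mS.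
rewrite -ERintegral_indic// -ERintegralZ//; apply: ERintegral_le.
- have mPhi : measurable_fun setT Phi.
    exact (measurable_sub_sigma mZ (@measurable_wprod _ _ _ _ Z rk phi mphi n)).
  refine (rintegrable_le _ _ (rintegrableZ 2 I1)).
    by apply: measurable_funM => //; exact: measurable_indic.
  by move=> x; rewrite normrM !ger0_norm// ler_wpM2r.
- exact: rintegrableZ.
- by move=> x; rewrite ler_wpM2r.
Qed.

Lemma lower_tail_at_level :
  (32 * kap ^+ 2)^-1 <= fine (P [set x | quad_sum x <= - (K * (1 + h ^+ 2))]).
Proof.
have int_w k : (k <= 4)%N -> rintegrable P (fun x => Phi x * S x ^+ k).
  exact: (rintegrable_wmoment mZ indZ mphi mz int_phiz n).
have W0 := wmoment0 mZ indZ mphi mz int_phiz phi_mean n.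
have W1 := wmoment1 mZ indZ mphi mz int_phiz z_mean n.
have W2 := wmoment2 mZ indZ mphi mz int_phiz phi_mean z_mean n.
have W4 := wmoment4_le mZ indZ mphi mz int_phiz phi_mean z_mean phi_ge0 n.
have mS : measurable_fun setT S.
  exact (measurable_sub_sigma mZ (@measurable_wsum _ _ _ _ Z rk z mz n)).
rewrite -/V in W2 W4.
have F_le : wmoment P phi z n 4 <= 3 * V ^+ 2 +
    27 * (L ^+ 2 * Vv + 16 * h ^+ 4 * tau * (Vv + n%:R) + 3 * 10 ^+ 4 * n%:R).
  apply: (le_trans W4); rewrite lerD2l.
  have -> : 27 * (L ^+ 2 * Vv + 16 * h ^+ 4 * tau * (Vv + n%:R) + 3 * 10 ^+ 4 * n%:R) =
      \sum_(i < n) (27 * (L ^+ 2 * v i + 16 * h ^+ 4 * tau * (v i + 1) + 3 * 10 ^+ 4)).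
    rewrite -mulr_sumr !big_split/= -!mulr_sumr big_split/= !sumr_const card_ord.
    by rewrite /Vv -(mulr_natr 10 n); ring.
  by apply: ler_sum => i _; exact: sm4.
have g1 : 1 <= 1 + h ^+ 2 by rewrite lerDl sqr_ge0.
have kapE : kap = 10 ^+ 8 by [].
have kap1 : 1 <= kap by rewrite kapE exprn_ege1// ler1n.
have Kg0 : 0 < K * (1 + h ^+ 2) by apply: mulr_gt0; have := K1; lra.
have D0 : 0 <= Dl by apply: sumr_ge0 => i _; rewrite subr_ge0.
have Dn : Dl <= n%:R.
  apply: (@le_trans _ _ (\sum_(i < n) 1)); last by rewrite sumr_const card_ord.
  by apply: ler_sum => i _; rewrite gerBl.
have Vv0 : 0 <= Vv by apply: sumr_ge0 => i _.
have VvL : Vv <= L * n%:R.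
  apply: (@le_trans _ _ (\sum_(i < n) L)); last by rewrite sumr_const card_ord mulr_natr.
  by apply: ler_sum.
have n1 : 1 <= n%:R :> R.
  rewrite ler1n lt0n; apply/eqP => n0; move: n_large; rewrite n0 leNgt => /negP; apply.
  apply: mulr_gt0; last lra; apply: mulr_gt0 => //; apply: exprn_gt0.
  by apply: mulr_gt0; [apply: mulr_gt0 => //; lra|have := K1; lra].
(* The left side is about [8.2 * 10^7], which explains the size of [tail_const]. *)
have HT : 3 + 27 * (112 + 20 * 1251 + 100 * (3 * 10 ^+ 4)) <= kap by rewrite kapE; lra.
have C0 : 0 <= 3 * 10 ^+ 4 :> R by lra.
have tau1 := @Rintegral_gauss_pow4_ge R.
have dich := tail_dichotomy K1 h0 n1 kap1 tau1 gauss_pow4_le C0 HT D0 Dn Vv0 VvL VE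
  n_large L_alternative.
have half_le c : S @^-1` [set y | y <= c] `<=` [set x | quad_sum x <= - (K * (1 + h ^+ 2))] ->
    fine (P [set x | S x <= c]) <= fine (P [set x | quad_sum x <= - (K * (1 + h ^+ 2))]).
  apply: fine_prob_le; first exact: measurable_S_le.
  rewrite -[X in measurable X]setTI; apply: measurable_fun_le => //.
  exact: measurable_quad_sum.
have half (x y : R) : (16 * kap ^+ 2)^-1 <= x -> x <= 2 * y -> (32 * kap ^+ 2)^-1 <= y.
  have -> : (32 * kap ^+ 2)^-1 = (16 * kap ^+ 2)^-1 / 2.
    by rewrite -invfM; congr (_^-1); ring.
  lra.
case: dich => [[Dbig VD]|[F_le2 Vbig]].
(* Loss of mean: the mild bound [S <= Dl / 2] already means [quad_sum <= - Dl / 2]. *)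
- have x0 : 0 < Dl / 2 by lra.
  have V0 : 0 <= V.
    by apply: sumr_ge0 => i _; exact: (step_moment_even_ge0 P z phi_ge0 i 1).
  have := one_sided_chebyshev Phi_ge0 mS int_w W0 W1 W2 x0 V0.
  move=> /le_trans/(_ (weighted_le _)) H.
  have HH := half_le (Dl / 2); apply: (le_trans _ (HH _)); last first.
    by move=> x /=; rewrite SE; lra.
  apply: (half _ _ _ H).
  rewrite ler_pdivlMr; last by apply: ltr_wpDr => //; exact: exprn_gt0.
  apply: (@le_trans _ _ ((16 * kap ^+ 2)^-1 * ((1 + 16 * (8 + 1251)) * (Dl / 2) ^+ 2))).
    apply: ler_wpM2l.
      by rewrite invr_ge0; apply: mulr_ge0 => //; exact: sqr_ge0.
    have -> : (1 + 16 * (8 + 1251)) * (Dl / 2) ^+ 2 = (Dl / 2) ^+ 2 + 4 * (8 + 1251) * Dl ^+ 2.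
      by field.
    by rewrite lerD2l.
  rewrite mulrA; apply: ler_piMl; first exact: sqr_ge0.
  rewrite mulrC ler_pdivrMr; last by apply: mulr_gt0 => //; apply: exprn_gt0; lra.
  rewrite mul1r; have : kap * 1 <= kap * kap by apply: ler_wpM2l; lra.
  by rewrite expr2 mulr1; lra.
(* Large variance: [S] itself falls to a fixed negative multiple of the root of [V]. *)
- have r2 : V = Num.sqrt V ^+ 2 by rewrite sqr_sqrtr//; exact: le_trans (sqr_ge0 _) Vbig.
  have kK0 : 0 < 16 * kap * (K * (1 + h ^+ 2)).
    by apply: mulr_gt0 => //; apply: mulr_gt0 => //; lra.
  have r0 : 0 < Num.sqrt V.
    by rewrite sqrtr_gt0 (lt_le_trans _ Vbig)// exprn_gt0.
  have rbig : 16 * kap * (K * (1 + h ^+ 2)) <= Num.sqrt V.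
    rewrite -[leLHS]ger0_norm; last exact: ltW.
    by rewrite -sqrtr_sqr ler_wsqrtr.
  have := fourth_moment_lower_tail Phi_ge0 mS int_w W0 W1 W2 F_le kap1 r0 r2 F_le2.
  move=> H; have {H} := half _ _ H (weighted_le _) => H.
  apply: (le_trans H); apply: half_le => x /=; rewrite SE => xS.
  have : K * (1 + h ^+ 2) <= Num.sqrt V / (16 * kap).
    rewrite ler_pdivlMr; first by rewrite mulrC.
    by apply: mulr_gt0 => //; lra.
  by lra.
Qed.

End with_level.

Lemma quad_sum_lower_tail :
  (32 * kap ^+ 2)^-1 <= fine (P [set x | quad_sum x <= - (K * (1 + h ^+ 2))]).
Proof.
have [L [L1 Lt Lm]] := truncation_level.
exact: lower_tail_at_level L1 Lt Lm.
Qed.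

End row_sums.

(** * Change of measure and converse bound *)

Section observation_space.
Context (R : realType) (n p : nat).

(** The generators inside [observation_sigma], repeated so that measurability in [obs_space] is by
    conversion the one required of decoders. *)
Definition observation_events : set (set ('cV[R]_n * 'M[R]_(n, p))) :=
  [set A | exists B : set R, measurable B /\
         ((exists i : 'I_n,
             A = [set z : 'cV[R]_n * 'M[R]_(n, p) | B (z.1 i 0)]) \/
          (exists (i : 'I_n) (j : 'I_p),
             A = [set z : 'cV[R]_n * 'M[R]_(n, p) | B (z.2 i j)]))].

Definition obs_space := g_sigma_algebraType observation_events.

Lemma measurable_obs_vec (i : 'I_n) : measurable_fun setT (fun z : obs_space => z.1 i 0).
Proof.
move=> _ B mB; rewrite setTI; apply: sub_sigma_algebra.
by exists B; split => //; left; exists i.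
Qed.

Lemma measurable_obs_mx (i : 'I_n) (j : 'I_p) :
  measurable_fun setT (fun z : obs_space => z.2 i j).
Proof.
move=> _ B mB; rewrite setTI; apply: sub_sigma_algebra.
by exists B; split => //; right; exists i, j.
Qed.

Lemma measurable_to_obs (d : measure_display) (T : measurableType d) (f : T -> obs_space) :
  (forall i, measurable_fun setT (fun t => (f t).1 i 0)) ->
  (forall i j, measurable_fun setT (fun t => (f t).2 i j)) ->
  measurable_fun setT f.
Proof.
move=> m1 m2; refine (@measurability _ _ T obs_space setT f observation_events erefl _).
move=> _ [_ [B [mB [[i ->]|[i [j ->]]]]] <-]; first exact: m1.
exact: m2.
Qed.

End observation_space.

Section model.
Context (R : realType) (mu : probability R R) (d : measure_display)
  (Omega : measurableType d) (P : probability Omega R) (n p : nat).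
Variables (X : 'I_n -> 'I_p -> {RV P >-> R}) (W : 'I_n -> {RV P >-> R}).
Hypothesis model : measurement_model mu X W.

Definition coords (s : ('I_n * 'I_p) + 'I_n) : Omega -> R :=
  match s with inl ij => X ij.1 ij.2 | inr i => W i end.

Lemma measurable_coords s : measurable_fun setT (coords s).
Proof. by case: s => [ij|i] /=; apply: measurable_funPT. Qed.

Lemma coords_indep : mutually_independent P coords.
Proof. by have [_ _] := model. Qed.

Lemma law_noise i A : measurable A -> P (coords (inr i) @^-1` A) = gauss A.
Proof. by move=> mA; have [_ lW _] := model; exact: (lW i A mA). Qed.

Lemma law_entry ij A : measurable A -> P (coords (inl ij) @^-1` A) = mu A.
Proof. by move=> mA; have [lX _ _] := model; exact: (lX ij.1 ij.2 A mA). Qed.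

Local Notation MX := (measurement_matrix X).

Definition signal (b : 'cV[R]_p) w i : R := (MX w *m b) i 0.

Lemma signalE b w i : signal b w i = \sum_j X i j w * b j 0.
Proof. by rewrite /signal mxE; apply: eq_bigr => j _; rewrite mxE. Qed.

Lemma measurable_signal (J : {set ('I_n * 'I_p) + 'I_n}) b i :
  (forall j, inl (i, j) \in J) ->
  measurable_fun setT ((fun w => signal b w i) : sub_sigma coords J -> R).
Proof.
move=> iJ; under eq_fun do rewrite signalE.
apply: measurable_sum => j; apply: measurable_funM => //.
exact: (measurable_sub_sigma_coord (Z := coords) (iJ j)).
Qed.

Section change_of_measure.
Variables (b m : 'cV[R]_p) (s : R).
Hypothesis s0 : 0 < s.

(** One row of the density of [N(X b, I)] relative to that of [N(X m, s^2 I)]. *)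
Definition density_ratio (z : 'cV[R]_n * 'M[R]_(n, p)) (i : 'I_n) : R :=
  s * expR (- (z.1 i 0 - (z.2 *m b) i 0) ^+ 2 / 2 +
            ((z.1 i 0 - (z.2 *m m) i 0) / s) ^+ 2 / 2).

Lemma measurable_obs_mul (c : 'cV[R]_p) (i : 'I_n) : measurable_fun setT (fun z : obs_space R n p => (z.2 *m c) i 0).
Proof.
under eq_fun do rewrite mxE; apply: measurable_sum => j.
by apply: measurable_funM => //; exact: measurable_obs_mx.
Qed.

Lemma measurable_density_ratio i :
  measurable_fun setT (fun z : obs_space R n p => density_ratio z i).
Proof.
have my := @measurable_obs_vec R n p i.
apply: measurable_funM => //; apply: measurableT_comp => //.
apply: measurable_funD; apply: measurable_funM => //.
  apply: measurableT_comp => //; apply: measurable_funX; apply: measurable_funB => //.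
  exact: measurable_obs_mul.
apply: measurable_funX; apply: measurable_funM => //; apply: measurable_funB => //.
exact: measurable_obs_mul.
Qed.

(* The first [j] noise coordinates follow the second model, the others the first. *)
Definition hybrid j w : 'cV[R]_n :=
  \col_i (if (i < j)%N then signal m w i + s * W i w else signal b w i + W i w).

(** Coordinate [j] becomes a free variable; all the rest is measurable for the coordinates other
    than the noise [inr j]. *)
Let hybrid_at (j : 'I_n) w y : 'cV[R]_n :=
  \col_i (if i == j then y else
          if (i < j)%N then signal m w i + s * W i w else signal b w i + W i w).

Let hybrid_atE1 (j : 'I_n) w : hybrid j w = hybrid_at j w (signal b w j + W j w).
Proof.
by apply/colP => i; rewrite !mxE; case: eqVneq => // ->; rewrite ltnn.
Qed.

Let hybrid_atE2 (j : 'I_n) w : hybrid j.+1 w = hybrid_at j w (signal m w j + s * W j w).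
Proof.
apply/colP => i; rewrite !mxE; case: eqVneq => [->|ij]; first by rewrite ltnS leqnn.
by rewrite ltnS leq_eqVlt (negbTE (ij : i != j :> nat)).
Qed.

Let J (j : 'I_n) : {set ('I_n * 'I_p) + 'I_n} := [set~ inr j]%SET.

Let measurable_hybrid_at j d' (T : measurableType d') (g : T -> sub_sigma coords (J j)) (y : T -> R) :
  measurable_fun setT g -> measurable_fun setT y ->
  measurable_fun setT (fun t => (hybrid_at j (g t) (y t), MX (g t)) : obs_space R n p).
Proof.
move=> mg my; have mX i l : measurable_fun setT (X i l : sub_sigma coords (J j) -> R).
  by apply: (measurable_sub_sigma_coord (Z := coords) (i := inl (i, l))); rewrite !inE.
have ms c i : measurable_fun setT ((fun w => signal c w i) : sub_sigma coords (J j) -> R).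
  by apply: measurable_signal => l; rewrite !inE.
apply: measurable_to_obs => i /=.
  have [ij|ij] := eqVneq i j.
    by rewrite (_ : (fun t => _) = y)//; apply/funext => t; rewrite mxE ij eqxx.
  have mW : measurable_fun setT (W i : sub_sigma coords (J j) -> R).
    by apply: (measurable_sub_sigma_coord (Z := coords) (i := inr i)); rewrite !inE.
  case: (boolP (i < j)%N) => lij.
    rewrite (_ : (fun t => _) = (fun w => signal m w i + s * W i w) \o g); last first.
      by apply/funext => t; rewrite mxE (negbTE ij) lij.
    apply: (measurableT_comp (f := (fun w => signal m w i + s * W i w) :
      sub_sigma coords (J j) -> R)) => //.
    by apply: measurable_funD => //; apply: measurable_funM.
  rewrite (_ : (fun t => _) = (fun w => signal b w i + W i w) \o g); last first.
    by apply/funext => t; rewrite mxE (negbTE ij) (negbTE lij).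
  apply: (measurableT_comp (f := (fun w => signal b w i + W i w) :
    sub_sigma coords (J j) -> R)) => //.
  exact: measurable_funD.
move=> l; rewrite (_ : (fun t => _) = X i l \o g); first exact: (measurableT_comp (@mX i l) mg).
by apply/funext => t; rewrite mxE.
Qed.

Variable f : obs_space R n p -> \bar R.
Hypotheses (mf : measurable_fun setT f) (f0 : forall z, (0 <= f z)%E).

Let weight j w := \prod_(i < n | (i < j)%N) density_ratio (hybrid j w, MX w) i.

Let density_ratio_gt0 z i : 0 < density_ratio z i.
Proof. by rewrite mulr_gt0 ?expR_gt0. Qed.

Let wt (j : 'I_n) w y := \prod_(i < n | (i < j)%N) density_ratio (hybrid_at j w y, MX w) i.

Let wt_cst j w y : wt j w y = wt j w 0.
Proof.
apply: eq_bigr => i ij; rewrite /density_ratio/= !mxE.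
by rewrite (_ : i == j = false)//; apply/negP => /eqP ij'; move: ij; rewrite ij' ltnn.
Qed.

Let weightE1 (j : 'I_n) w : weight j w = wt j w (signal b w j + W j w).
Proof. by rewrite /weight /wt hybrid_atE1. Qed.

Let weightE2 (j : 'I_n) w : weight j.+1 w =
  wt j w (signal m w j + s * W j w) * density_ratio (hybrid j.+1 w, MX w) j.
Proof.
rewrite /weight /wt (bigD1 j)//= mulrC; congr (_ * _); rewrite hybrid_atE2.
apply: eq_bigl => i; rewrite ltnS [in RHS]ltn_neqAle andbC.
by [].
Qed.

Let wt_ge0 j w y : 0 <= wt j w y.
Proof. by apply: prodr_ge0 => i _; exact: ltW. Qed.

(** Given everything but the noise of row [j], the two sides differ by a one-dimensional Gaussian
    change of measure. The weights of the rows before [j] do not involve this noise and factor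
    out. *)
Let hybrid_step (j : 'I_n) :
  (\int[P]_w (f (hybrid j w, MX w) * (weight j w)%:E) =
   \int[P]_w (f (hybrid j.+1 w, MX w) * (weight j.+1 w)%:E))%E.
Proof.
pose T := (sub_sigma coords (J j) * R)%type.
pose F1 (x : T) := (f (hybrid_at j x.1 (signal b x.1 j + x.2)%R, MX x.1) *
  (wt j x.1 (signal b x.1 j + x.2)%R)%:E)%E.
pose y2 (x : T) := signal m x.1 j + s * x.2.
pose F2 (x : T) := (f (hybrid_at j x.1 (y2 x), MX x.1) *
  (wt j x.1 (y2 x) * density_ratio (hybrid_at j x.1 (y2 x), MX x.1) j)%R%:E)%E.
have ms c : measurable_fun setT (fun x : T => signal c x.1 j).
  apply: (measurableT_comp (f := (fun w => signal c w j) : sub_sigma coords (J j) -> R)) => //.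
  by apply: measurable_signal => l; rewrite !inE.
have my1 : measurable_fun setT (fun x : T => signal b x.1 j + x.2).
  by apply: measurable_funD.
have my2 : measurable_fun setT y2.
  by apply: measurable_funD => //; apply: measurable_funM.
have mh (y : T -> R) : measurable_fun setT y ->
    measurable_fun setT (fun x : T => (hybrid_at j x.1 (y x), MX x.1) : obs_space R n p).
  by move=> my; apply: measurable_hybrid_at.
have mwt (y : T -> R) : measurable_fun setT y -> measurable_fun setT (fun x : T => wt j x.1 (y x)).
  move=> my; rewrite /wt; under eq_fun do rewrite big_mkcond.
  apply: measurable_prod => i _; case: (boolP (i < j)%N) => _; last by [].
  exact: (measurableT_comp (measurable_density_ratio i) (@mh _ my)).
have E1 := resample_coord measurable_coords coords_indep (@law_noise j) (f := F1).
have E2 := resample_coord measurable_coords coords_indep (@law_noise j) (f := F2).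
transitivity (\int[P]_w F1 (w, W j w))%E.
  by apply: eq_integral => w _; rewrite /F1/= hybrid_atE1 weightE1.
transitivity (\int[P]_w F2 (w, W j w))%E; last first.
  by apply: eq_integral => w _; rewrite /F2/= weightE2 hybrid_atE2.
rewrite E1; last 2 first.
- apply: emeasurable_funM; first exact: (measurableT_comp mf (@mh _ my1)).
  by apply/measurable_EFinP; exact: mwt.
- by move=> x; rewrite mule_ge0// lee_fin.
rewrite E2; last 2 first.
- apply: emeasurable_funM; first exact: (measurableT_comp mf (@mh _ my2)).
  apply/measurable_EFinP; apply: measurable_funM; first exact: mwt.
  exact: (measurableT_comp (measurable_density_ratio j) (@mh _ my2)).
- by move=> x; rewrite mule_ge0// lee_fin mulr_ge0// ltW.
apply: eq_integral => w _.
pose g y := (f (hybrid_at j w y, MX w) * (wt j w y)%:E)%E.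
have mg : measurable_fun setT g.
  have mhw : measurable_fun setT (fun y : R => (hybrid_at j w y, MX w) : obs_space R n p).
    by apply: (measurable_hybrid_at (g := fun=> w)).
  apply: emeasurable_funM; first exact: (measurableT_comp mf mhw).
  apply/measurable_EFinP; rewrite (_ : wt j w = fun=> wt j w 0) //.
  by apply/funext => y; exact: wt_cst.
have g0 y : (0 <= g y)%E by rewrite mule_ge0// lee_fin.
rewrite [LHS](gauss_change_of_measure (signal b w j) (signal m w j) s0 mg g0).
apply: eq_integral => t _; rewrite /F2 /g /y2/= -muleA -EFinM; congr (_ * (_ * _)%:E)%E.
by rewrite /density_ratio/= mxE eqxx.
Qed.

Lemma gaussian_change_of_measure :
  (\int[P]_w f ((MX w *m b + \col_i W i w)%R, MX w) =
   \int[P]_w (f ((MX w *m m + s *: \col_i W i w)%R, MX w) *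
     (\prod_(i < n) density_ratio (MX w *m m + s *: \col_i W i w, MX w) i)%R%:E))%E.
Proof.
have step j : (j <= n)%N -> (\int[P]_w (f (hybrid 0 w, MX w) * (weight 0 w)%:E) =
   \int[P]_w (f (hybrid j w, MX w) * (weight j w)%:E))%E.
  elim: j => [_|j IH jn]; first by [].
  exact (etrans (IH (ltnW jn)) (hybrid_step (Ordinal jn))).
have h0 w : hybrid 0 w = MX w *m b + \col_i W i w by apply/colP => i; rewrite [LHS]mxE /= /signal [RHS]mxE; congr (_ + _); rewrite !mxE.
have hn w : hybrid n w = MX w *m m + s *: \col_i W i w.
  by apply/colP => i; rewrite [LHS]mxE ltn_ord /signal [RHS]mxE; congr (_ + _); rewrite !mxE.
transitivity (\int[P]_w (f (hybrid 0 w, MX w) * (weight 0 w)%:E))%E.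
  by apply: eq_integral => w _; rewrite h0 /weight big_pred0// mule1.
rewrite (step n (leqnn n)); apply: eq_integral => w _; rewrite hn /weight.
congr (_ * _%:E)%E; rewrite hn; apply: eq_bigl => i; exact: ltn_ord.
Qed.

End change_of_measure.
End model.

Section entry_moments.
Context (R : realType) (mu : probability R R).
Hypotheses (mu_mean : ('E_mu[idfun] = 0)%E) (mu_variance : ('V_mu[idfun] = 1)%E).

Let sqr_int : (\int[mu]_x (x ^+ 2)%:E = 1)%E.
Proof.
move: mu_variance; rewrite /variance covariance.unlock mu_mean/= expectation.unlock => <-.
apply: eq_integral => x _; congr EFin.
by rewrite -[RHS]/((x - 0) * (x - 0)) subr0 expr2.
Qed.

Lemma rintegrable_entry_sqr : rintegrable mu (fun x => x ^+ 2).
Proof.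
apply: rintegrable_ge0; first exact: measurable_funX.
  by move=> x; exact: sqr_ge0.
by rewrite sqr_int ltry.
Qed.

Lemma entry_second_moment : \int[mu]_x (x ^+ 2) = 1.
Proof. by rewrite /Rintegral sqr_int. Qed.

Lemma rintegrable_entry : rintegrable mu (fun x => x).
Proof.
have I2 := rintegrableD (rintegrable_cst mu 1) rintegrable_entry_sqr.
refine (rintegrable_le _ _ I2) => // x.
have := sqr_ge0 (`|x| - 1); rewrite sqrrB1 real_normK ?num_real// => H.
by have := normr_ge0 x; rewrite mulr2n in H; lra.
Qed.

Lemma entry_mean : \int[mu]_x x = 0.
Proof. by move: mu_mean; rewrite expectation.unlock /Rintegral => ->. Qed.

End entry_moments.

(** * Likelihood bounds for decoders *)

Section model.
Context (R : realType) (mu : probability R R) (d : measure_display)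
  (Omega : measurableType d) (P : probability Omega R) (n p : nat).
Variables (X : 'I_n -> 'I_p -> {RV P >-> R}) (W : 'I_n -> {RV P >-> R}).
Hypothesis model : measurement_model mu X W.

Local Notation MX := (measurement_matrix X).
Local Notation Z := (coords X W).
Let mZ := measurable_coords X W.
Let indZ := coords_indep model.

Let measurable_sig (b : 'cV[R]_p) i : measurable_fun setT (fun w => signal X b w i).
Proof.
have mb : measurable_fun setT ((fun w => signal X b w i) : sub_sigma Z [set: _]%SET -> R).
  by apply: measurable_signal => j; rewrite inE.
exact (measurable_sub_sigma mZ mb).
Qed.

Let mW i : measurable_fun setT (W i). Proof. exact: measurable_funPT. Qed.

Lemma measurable_observed (y : Omega -> 'cV[R]_n) :
  (forall i, measurable_fun setT (fun w => y w i 0)) ->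
  measurable_fun setT (fun w => (y w, MX w) : obs_space R n p).
Proof.
move=> my; apply: measurable_to_obs => // i j.
rewrite (_ : (fun t => _) = X i j); first exact: measurable_funPT.
by apply/funext => w; rewrite mxE.
Qed.

(** The logarithm of the product of [density_ratio] at the observation produced by [b]: there
    [Y - X b] is the noise and [Y - X m] is [X (b - m)] plus the noise. *)
Definition loglik (b m : 'cV[R]_p) (s : R) w : R :=
  \sum_i (ln s - W i w ^+ 2 / 2 + ((signal X (b - m) w i + W i w) / s) ^+ 2 / 2).

Lemma measurable_loglik b m s : measurable_fun setT (loglik b m s).
Proof.
apply: measurable_sum => i; apply: measurable_funD.
  apply: measurable_funB => //; apply: measurable_funM => //; exact: measurable_funX.
apply: measurable_funM => //; apply: measurable_funX; apply: measurable_funM => //.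
exact: measurable_funD.
Qed.

Lemma measurable_loglik_le b m s c : measurable [set w | loglik b m s w <= c].
Proof.
rewrite -[X in measurable X]setTI; apply: measurable_fun_le => //.
exact: measurable_loglik.
Qed.

Let obs_loglik (b m : 'cV[R]_p) s (z : obs_space R n p) : R :=
  \sum_i (ln s - (z.1 i 0 - (z.2 *m b) i 0) ^+ 2 / 2 + ((z.1 i 0 - (z.2 *m m) i 0) / s) ^+ 2 / 2).

Let measurable_obs_loglik b m s : measurable_fun setT (obs_loglik b m s).
Proof.
have my := @measurable_obs_vec R n p; have mM := @measurable_obs_mul R n p.
apply: measurable_sum => i; apply: measurable_funD.
  apply: measurable_funB => //; apply: measurable_funM => //; apply: measurable_funX.
  exact: measurable_funB.
apply: measurable_funM => //; apply: measurable_funX; apply: measurable_funM => //.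
exact: measurable_funB.
Qed.

Let measurable_y (b : 'cV[R]_p) (s : R) i :
  measurable_fun setT (fun w => (MX w *m b + s *: \col_i W i w) i 0).
Proof.
rewrite (_ : (fun w => _) = fun w => signal X b w i + s * W i w).
  by apply: measurable_funD => //; apply: measurable_funM.
by apply/funext => w; rewrite mxE /signal; congr (_ + _); rewrite !mxE.
Qed.

Let noisy (b : 'cV[R]_p) s w : obs_space R n p := (MX w *m b + s *: \col_i W i w, MX w).

Let measurable_noisy b s : measurable_fun setT (noisy b s).
Proof. by apply: measurable_observed => i; exact: measurable_y. Qed.

Let noisy1 b w : noisy b 1 w = (MX w *m b + \col_i W i w, MX w).
Proof. by rewrite /noisy scale1r. Qed.

Lemma measurable_noisy_event (A : set (obs_space R n p)) b s : measurable A ->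
  measurable [set w | A (noisy b s w)].
Proof. by move=> mA; rewrite -[X in measurable X]setTI; exact: measurable_noisy. Qed.

Let noisy_loglik b m s w : obs_loglik b m s (noisy b 1 w) = loglik b m s w.
Proof.
apply: eq_bigr => i _; rewrite noisy1 /= /signal mulmxBr.
have -> : (MX w *m b + \col_i W i w) i 0 = (MX w *m b) i 0 + W i w by rewrite !mxE.
have -> : (MX w *m b - MX w *m m) i 0 = (MX w *m b) i 0 - (MX w *m m) i 0 by rewrite !mxE.
by congr (_ - _ ^+ 2 / 2 + (_ / s) ^+ 2 / 2); ring.
Qed.

Lemma loglik_threshold (A : set (obs_space R n p)) (b m : 'cV[R]_p) (s c : R) :
  0 < s -> measurable A ->
  fine (P [set w | A (noisy b 1 w) /\ loglik b m s w <= c]) <=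
  expR c * fine (P [set w | A (noisy m s w)]).
Proof.
move=> s0 mA.
pose C : set (obs_space R n p) := A `&` [set z | obs_loglik b m s z <= c].
have mC : measurable C.
  by apply: measurableI => //; rewrite -[X in measurable X]setTI; exact: measurable_fun_le.
have -> : [set w | A (noisy b 1 w) /\ loglik b m s w <= c] = [set w | C (noisy b 1 w)].
  by apply/seteqP; split => w; rewrite /C/= noisy_loglik.
have mCb := measurable_noisy_event b 1 mC.
have mAm := measurable_noisy_event m s mA.
pose f z : \bar R := (\1_C z)%:E.
have mf : measurable_fun setT f by apply/measurable_EFinP; exact: measurable_indic.
have f0 z : (0 <= f z)%E by rewrite lee_fin.
have := gaussian_change_of_measure model b m s0 mf f0.
have -> : (\int[P]_w f ((MX w *m b + \col_i W i w)%R, MX w) = P [set w | C (noisy b 1 w)])%E.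
  transitivity (\int[P]_w (\1_[set w | C (noisy b 1 w)] w)%:E)%E; last first.
    by rewrite integral_indic// setIT.
  apply: eq_integral => w _.
  by rewrite -noisy1 /f !indicE; congr (nat_of_bool _)%:R%:E; apply/idP/idP; rewrite !inE.
move=> ->.
have prodE z : \prod_(i < n) density_ratio b m s z i = expR (obs_loglik b m s z).
  rewrite /obs_loglik expR_sum; apply: eq_bigr => i _.
  rewrite /density_ratio -{1}(@lnK _ s) ?posrE// -expRD; congr expR; ring.
pose h w : \bar R := ((expR c)%:E * (\1_[set w | A (noisy m s w)] w)%:E)%E.
have mh : measurable_fun setT h.
  by apply: emeasurable_funM => //; apply/measurable_EFinP; exact: measurable_indic.
have H : (\int[P]_w (f (noisy m s w) *
    (\prod_(i < n) density_ratio b m s (noisy m s w) i)%:E) <= \int[P]_w h w)%E.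
  apply: ge0_le_integral => //.
  - by move=> w _; rewrite mule_ge0// lee_fin prodE expR_ge0.
  - apply: emeasurable_funM; first exact: (measurableT_comp mf (measurable_noisy m s)).
    apply/measurable_EFinP; under eq_fun do rewrite prodE; apply: measurableT_comp => //.
    exact: (measurableT_comp (measurable_obs_loglik b m s) (measurable_noisy m s)).
  - move=> w _; rewrite prodE /f /h -!EFinM lee_fin.
    have [zC|zC] := pselect (C (noisy m s w)); last first.
      by rewrite indicE memNset// mul0r mulr_ge0 ?expR_ge0.
    have [zA zl] := zC; rewrite indicE mem_set// mul1r indicE mem_set// mulr1.
    by rewrite ler_expR.
have hE : (\int[P]_w h w = (expR c)%:E * P [set w | A (noisy m s w)])%E.
  have mi : measurable_fun setT (fun w => (\1_[set w | A (noisy m s w)] w : R)%:E).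
    by apply/measurable_EFinP; exact: measurable_indic.
  have e0 : (0 <= (expR c)%:E)%E by rewrite lee_fin expR_ge0.
  have i0 w : setT w -> (0 <= (\1_[set w | A (noisy m s w)] w : R)%:E)%E by rewrite lee_fin.
  rewrite (ge0_integralZl _ measurableT mi i0 e0).
  by rewrite integral_indic// setIT.
move: H; rewrite hE => H.
rewrite -[leRHS]/(fine (expR c)%:E * _) -fineM ?fin_num_measure//.
apply: fine_le => //; last by rewrite fin_numM ?fin_num_measure.
rewrite ge0_fin_numE.
  by apply: (le_lt_trans H); rewrite -ge0_fin_numE ?fin_numM ?fin_num_measure// mule_ge0// lee_fin expR_ge0.
by apply: integral_ge0 => w _; rewrite mule_ge0// lee_fin [X in 0 <= X]prodE expR_ge0.
Qed.

Variable g : decoder R n p.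
Hypothesis mg : measurable_decoder g.

Definition error (S : {set 'I_p}) (b : 'cV[R]_p) : R :=
  fine (P [set w | g (observation X W b w) (MX w) <> S]).

Definition decides S : set (obs_space R n p) := [set z | g z.1 z.2 = S].

Lemma measurable_decides S : measurable (decides S).
Proof. exact: mg. Qed.

Lemma successE S b : fine (P [set w | decides S (noisy b 1 w)]) = 1 - error S b.
Proof.
have mS := measurable_noisy_event b 1 (measurable_decides S).
rewrite /error (_ : [set w | _ <> S] = ~` [set w | decides S (noisy b 1 w)]).
  by rewrite fine_probC// opprB addrCA subrr addr0.
apply/funext => w; rewrite /setC/=.
by have -> : decides S (noisy b 1 w) = (g (observation X W b w) (MX w) = S) by rewrite noisy1.
Qed.

Lemma error_ge0 S b : 0 <= error S b.
Proof. by rewrite /error fine_ge0. Qed.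

Lemma error_le1 S b : error S b <= 1.
Proof. by rewrite -subr_ge0 -successE fine_ge0. Qed.

Lemma sum_decides_le1 (D : pred {set 'I_p}) m s :
  \sum_(S | D S) fine (P [set w | decides S (noisy m s w)]) <= 1.
Proof.
have mS S := measurable_noisy_event m s (measurable_decides S).
under eq_bigr do rewrite -ERintegral_indic//.
rewrite -big_filter -ERintegral_sum; last by move=> S; exact: rintegrable_indic.
rewrite -[leRHS](ERintegral_cst P 1); apply: ERintegral_le.
- by apply: rintegrable_sum => S; exact: rintegrable_indic.
- exact: rintegrable_cst.
move=> w; rewrite big_filter.
set S0 := g (noisy m s w).1 (noisy m s w).2.
have zero S : S != S0 -> \1_[set w | decides S (noisy m s w)] w = 0 :> R.
  by move=> SS0; rewrite indicE memNset// => /eqP; rewrite eq_sym (negbTE SS0).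
have [DS0|DS0] := boolP (D S0).
  rewrite (bigD1 S0)//= big1 ?addr0; last by move=> S /andP[_ /zero].
  by rewrite indicE; case: (_ \in _).
rewrite big1// => S DS; apply: zero; apply/negP => /eqP SS0.
by rewrite -SS0 DS in DS0.
Qed.

Lemma success_le S b m s c : 0 < s ->
  1 - error S b <= expR c * fine (P [set w | decides S (noisy m s w)]) +
    (1 - fine (P [set w | loglik b m s w <= c])).
Proof.
move=> s0; have mD := measurable_decides S.
have mb := measurable_noisy_event b 1 mD; have ml := measurable_loglik_le b m s c.
rewrite -successE -fine_probC//.
apply: le_trans (lerD (loglik_threshold b m c s0 mD) (lexx _)).
have mbl : measurable [set w | decides S (noisy b 1 w) /\ loglik b m s w <= c].
  exact: measurableI.
have mlC := measurableC ml.
apply: (le_trans _ (fine_probD P mbl mlC)).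
apply: fine_prob_le => //; first exact: measurableU.
by move=> w Dw; have [lw|lw] := pselect (loglik b m s w <= c); [left|right].
Qed.

(** A strong converse in the style of Wolfowitz and of Verdu and Han. The comparison law depends on
    [m] and [s] but not on [S], so the factor [expR c] is paid once for the whole family. *)
Lemma meta_converse (D : pred {set 'I_p}) (b : {set 'I_p} -> 'cV[R]_p) m s c : 0 < s ->
  \sum_(S | D S) (1 - error S (b S)) <= expR c +
  \sum_(S | D S) (1 - fine (P [set w | loglik (b S) m s w <= c])).
Proof.
move=> s0; apply: (@le_trans _ _ (\sum_(S | D S) (
    expR c * fine (P [set w | decides S (noisy m s w)]) +
    (1 - fine (P [set w | loglik (b S) m s w <= c]))))).
  by apply: ler_sum => S _; exact: success_le.
rewrite big_split/= lerD2r -mulr_sumr ler_piMr ?expR_ge0//.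
exact: sum_decides_le1.
Qed.

Section second_moments.
Hypotheses (mu_mean : ('E_mu[idfun] = 0)%E) (mu_variance : ('V_mu[idfun] = 1)%E).

Let entry_int i j : rintegrable P (X i j).
Proof.
exact: (rintegrable_law (mZ (inl (i, j))) (law_entry model (i, j)) (rintegrable_entry mu_mean mu_variance)).
Qed.

Let entry_sqr_int i j : rintegrable P (fun w => X i j w ^+ 2).
Proof.
exact: (rintegrable_law (mZ (inl (i, j))) (law_entry model (i, j)) (rintegrable_entry_sqr mu_mean mu_variance)).
Qed.

Let entry_prod i j l : rintegrable P (fun w => X i j w * X i l w) /\
  \int[P]_w (X i j w * X i l w) = (j == l)%:R.
Proof.
have [<-|jl] := eqVneq j l.
  split; first by have := entry_sqr_int i j; congr rintegrable; apply/funext => w; rewrite expr2.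
  under eq_Rintegral do rewrite -expr2.
  rewrite -(entry_second_moment mu_mean mu_variance).
  exact: (Rintegral_law (mZ (inl (i, j))) (law_entry model (i, j)) (rintegrable_entry_sqr mu_mean mu_variance)).
have dj s : s \in [set inl (i, j) : ('I_n * 'I_p) + 'I_n]%SET -> s \notin [set inl (i, l) : ('I_n * 'I_p) + 'I_n]%SET.
  rewrite !inE => /eqP ->; apply/negP => /eqP [] jl'; by rewrite jl' eqxx in jl.
have m1 j' : measurable_fun setT (X i j' : sub_sigma Z [set inl (i, j') : ('I_n * 'I_p) + 'I_n]%SET -> R).
  by apply: (measurable_sub_sigma_coord (Z := Z) (i := inl (i, j'))); rewrite inE.
split; first exact: (sub_sigma_integrableM mZ indZ dj (@m1 j) (@m1 l) (@entry_int i j) (@entry_int i l)).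
rewrite (sub_sigma_RintegralM mZ indZ dj (@m1 j) (@m1 l) (@entry_int i j) (@entry_int i l)).
rewrite [X in X * _](_ : _ = 0) ?mul0r// -(entry_mean mu_mean).
exact: (Rintegral_law (mZ (inl (i, j))) (law_entry model (i, j)) (rintegrable_entry mu_mean mu_variance)).
Qed.

Lemma signal_second_moment (v : 'cV[R]_p) i :
  rintegrable P (fun w => signal X v w i ^+ 2) /\
  \int[P]_w (signal X v w i ^+ 2) = \sum_j v j 0 ^+ 2.
Proof.
have E : (fun w => signal X v w i ^+ 2) = (fun w =>
    \sum_j \sum_l v j 0 * v l 0 * (X i j w * X i l w)).
  apply/funext => w; rewrite signalE expr2 mulr_suml; apply: eq_bigr => j _.
  by rewrite mulr_sumr; apply: eq_bigr => l _; ring.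
have I2 j l : rintegrable P (fun w => v j 0 * v l 0 * (X i j w * X i l w)).
  by apply: rintegrableZ; have [] := entry_prod i j l.
have I1 j : rintegrable P (fun w => \sum_l v j 0 * v l 0 * (X i j w * X i l w)).
  by apply: rintegrable_sum => l; exact: I2.
split; first by rewrite E; apply: rintegrable_sum => j; exact: I1.
have -> : \int[P]_w (signal X v w i ^+ 2) =
    \int[P]_w (\sum_j \sum_l v j 0 * v l 0 * (X i j w * X i l w)).
  by apply: eq_Rintegral => w _; exact: (congr1 (@^~ w) E).
rewrite ERintegral_sum//; apply: eq_bigr => j _.
rewrite ERintegral_sum; last by move=> l; exact: I2.
rewrite (bigD1 j)//= big1 ?addr0 => [|l lj].
  by rewrite ERintegralZ; [|by have [] := entry_prod i j j]; have [_ ->] := entry_prod i j j; rewrite eqxx mulr1 expr2.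
by rewrite ERintegralZ; [|by have [] := entry_prod i j l]; have [_ ->] := entry_prod i j l; rewrite eq_sym (negbTE lj) mulr0.
Qed.

End second_moments.
End model.

(** * Converse for families and for pairs of signals *)

Section converse.
Context (R : realType) (mu : probability R R) (d : measure_display)
  (Omega : measurableType d) (P : probability Omega R) (n p : nat).
Variables (X : 'I_n -> 'I_p -> {RV P >-> R}) (W : 'I_n -> {RV P >-> R}).
Hypothesis model : measurement_model mu X W.
Hypotheses (mu_mean : ('E_mu[idfun] = 0)%E) (mu_variance : ('V_mu[idfun] = 1)%E).
Variable g : decoder R n p.
Hypothesis mg : measurable_decoder g.

Local Notation Z := (coords X W).
Local Notation sq v := (\sum_j v j 0 ^+ 2).
Let mZ := measurable_coords X W.
Let indZ := coords_indep model.

Definition tail_prob : R := (32 * tail_const R ^+ 2)^-1.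

Lemma tail_prob_gt0 : 0 < tail_prob.
Proof. by rewrite invr_gt0; apply: mulr_gt0 => //; rewrite !exprn_gt0. Qed.

Lemma tail_prob_le1 : tail_prob <= 1.
Proof.
rewrite invf_le1; last by apply: mulr_gt0 => //; rewrite !exprn_gt0.
by rewrite -[leLHS]mulr1; apply: ler_pM => //; rewrite ?ler1n// !exprn_ege1// ler1n.
Qed.

(** Dividing [X (b - m)] by [sigma] gives rows of second moment 1, with [h = 1 / sigma]. The ratio
    is its typical value plus [sigma^2 / (2 (1 + sigma^2))] times [quad_sum]. This factor cancels
    [1 + h^2], so the drop is [K / 2] at every signal strength. *)
Lemma loglik_lower_tail (b m : 'cV[R]_p) (sigma K : R) :
  0 < sigma -> sq (b - m) = sigma ^+ 2 -> 1 <= K ->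
  10 * (16 * tail_const R * K) ^+ 2 * (1 + sigma^-1 ^+ 2) <= n%:R ->
  tail_prob <= fine (P [set w | loglik X W b m (Num.sqrt (1 + sigma ^+ 2)) w <=
    n%:R / 2 * ln (1 + sigma ^+ 2) - K / 2]).
Proof.
move=> s0 vs K1 nK; set v := b - m in vs *.
pose rk (s : ('I_n * 'I_p) + 'I_n) : nat := match s with inl ij => ij.1 | inr i => i end.
pose J1 (i : nat) : {set ('I_n * 'I_p) + 'I_n} :=
  [set s : ('I_n * 'I_p) + 'I_n | if s is inl ij then nat_of_ord ij.1 == i else false]%SET.
pose J2 (i : nat) : {set ('I_n * 'I_p) + 'I_n} :=
  [set s : ('I_n * 'I_p) + 'I_n | if s is inr j then nat_of_ord j == i else false]%SET.
(* The tail bound takes rows indexed by [nat]; [insub] extends them by 0 from [n] on. *)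
pose u (i : nat) w := if insub i is Some j then signal X v w j / sigma else 0.
pose W' (i : nat) w := if (insub i : option 'I_n) is Some j then W j w else 0.
have uE i (i_n : (i < n)%N) : u i = fun w => signal X v w (Ordinal i_n) / sigma.
  by apply/funext => w; rewrite /u insubT.
have WE i (i_n : (i < n)%N) : W' i = W (Ordinal i_n).
  by apply/funext => w; rewrite /W' insubT.
have h0 : 0 <= sigma^-1 by rewrite invr_ge0 ltW.
have := @quad_sum_lower_tail R d Omega P _ Z mZ indZ rk n J1 J2 u W' _ _ _ _ _ _ _ _ K sigma^-1 K1 h0 nK.
move=> /(_ _ _ _ _ _ _ _ _)/le_trans; apply.
- by move=> i [ij|j] _; rewrite !inE.
- by move=> i [ij|j] _; rewrite inE// => /eqP.
- by move=> i [ij|j] _; rewrite inE// => /eqP.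
- move=> i i_n; rewrite uE; apply: measurable_funM => //.
  by apply: measurable_signal => j; rewrite inE.
- move=> i i_n; rewrite WE.
  by apply: (measurable_sub_sigma_coord (Z := Z) (i := inr (Ordinal i_n))); rewrite inE.
- by move=> i i_n A mA; rewrite WE; exact: (law_noise model (Ordinal i_n) mA).
- move=> i i_n; rewrite uE.
  have [I1 _] := signal_second_moment model mu_mean mu_variance v (Ordinal i_n).
  have := rintegrableZ (sigma ^- 2) I1; congr rintegrable; apply/funext => w.
  by rewrite exprMn mulrC exprVn.
- move=> i i_n; rewrite uE.
  have [I1 E1] := signal_second_moment model mu_mean mu_variance v (Ordinal i_n).
  transitivity (\int[P]_w (sigma ^- 2 * signal X v w (Ordinal i_n) ^+ 2)).
    by apply: eq_Rintegral => w _; rewrite exprMn mulrC exprVn.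
  by rewrite ERintegralZ// E1 vs mulVf// expf_neq0// gt_eqF.
have g0 : 0 < 1 + sigma ^+ 2 by rewrite ltr_pwDl// sqr_ge0.
have ml := @measurable_loglik_le R d Omega P n p X W.
have mu' i : (i < n)%N -> measurable_fun setT (u i).
  move=> i_n; rewrite uE; apply: measurable_funM => //.
  have I1 := (signal_second_moment model mu_mean mu_variance v (Ordinal i_n)).
  have mb : measurable_fun setT ((fun w => signal X v w (Ordinal i_n)) : sub_sigma Z [set: _]%SET -> R).
    by apply: measurable_signal => j; rewrite inE.
  exact (measurable_sub_sigma mZ mb).
have mW' i : (i < n)%N -> measurable_fun setT (W' i).
  by move=> i_n; rewrite WE; apply: measurable_funPT.
have mq : measurable [set w | quad_sum n u W' sigma^-1 w <= - (K * (1 + sigma^-1 ^+ 2))].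
  rewrite -[X in measurable X]setTI; apply: measurable_fun_le => //.
  apply: measurable_sum => i; have mui := mu' i (ltn_ord i); have mwi := mW' i (ltn_ord i).
  apply: measurable_funB; last exact: measurable_funX.
  apply: measurable_funD; first exact: measurable_funX.
  by apply: measurable_funM => //; exact: measurable_funM.
apply: fine_prob_le => // w /= qw.
have -> : loglik X W b m (Num.sqrt (1 + sigma ^+ 2)) w = n%:R / 2 * ln (1 + sigma ^+ 2) +
    sigma ^+ 2 / (1 + sigma ^+ 2) / 2 * quad_sum n u W' sigma^-1 w.
  rewrite /loglik /quad_sum mulr_sumr.
  have -> : n%:R / 2 * ln (1 + sigma ^+ 2) = \sum_(i < n) ln (1 + sigma ^+ 2) / 2.
    by rewrite sumr_const card_ord -[RHS]mulr_natl; ring.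
  rewrite -big_split/=; apply: eq_bigr => i _; rewrite /u /W' valK/=.
  have -> : ln (Num.sqrt (1 + sigma ^+ 2)) = ln (1 + sigma ^+ 2) / 2.
    have {2}-> : 1 + sigma ^+ 2 = Num.sqrt (1 + sigma ^+ 2) ^+ 2 by rewrite sqr_sqrtr// ltW.
    rewrite lnXn ?sqrtr_gt0// -mulr_natl; by field.
  rewrite [X in _ + X / 2 = _]exprMn exprVn sqr_sqrtr; last exact: ltW.
  by rewrite -/v; field; rewrite !gt_eqF.
have c0 : 0 <= sigma ^+ 2 / (1 + sigma ^+ 2) / 2 by rewrite !divr_ge0// ?sqr_ge0// ltW.
rewrite lerD2l; apply: (le_trans (ler_wpM2l c0 qw)).
rewrite le_eqVlt; apply/orP; left; apply/eqP; field.
by rewrite !gt_eqF.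
Qed.

(** With [K = 4 / eta], where [eta] is [tail_prob], the threshold drops by [2 / eta], and
    [expR (- 2 / eta) <= eta / 2]. The low event has probability at least [eta], so the successes
    sum to at most [#|D| (1 - eta / 2)]. *)
Lemma strong_converse (D : pred {set 'I_p}) (b : {set 'I_p} -> 'cV[R]_p) m (sigma : R) :
  0 < sigma -> (forall S, D S -> sq (b S - m) = sigma ^+ 2) ->
  10 * (16 * tail_const R * (4 / tail_prob)) ^+ 2 * (1 + sigma^-1 ^+ 2) <= n%:R ->
  (0 < #|D|)%N ->
  n%:R / 2 * ln (1 + sigma ^+ 2) <= ln #|D|%:R ->
  #|D|%:R * (tail_prob / 2) <= \sum_(S | D S) error X W g S (b S).
Proof.
move=> s0 bs nK D0 nlnM; have e0 := tail_prob_gt0; have e1 := tail_prob_le1.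
set eta := tail_prob in e0 e1 nK *.
have K1 : 1 <= 4 / eta by rewrite ler_pdivlMr//; lra.
set s := Num.sqrt (1 + sigma ^+ 2).
have s_gt0 : 0 < s by rewrite sqrtr_gt0 ltr_pwDl// sqr_ge0.
have := meta_converse model mg D b m (n%:R / 2 * ln (1 + sigma ^+ 2) - 4 / eta / 2) s_gt0.
have card : \sum_(S | D S) (1 : R) = #|D|%:R by rewrite sumr_const.
rewrite sumrB card => H.
have : \sum_(S | D S) (1 - fine (P [set w | loglik X W (b S) m s w <=
    n%:R / 2 * ln (1 + sigma ^+ 2) - 4 / eta / 2])) <= \sum_(S | D S) (1 - eta).
  apply: ler_sum => S DS; rewrite lerD2l lerN2.
  exact: (loglik_lower_tail s0 (bs S DS) K1 nK).
rewrite sumr_const -[X in _ <= X -> _]mulr_natl => H2.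
have : expR (n%:R / 2 * ln (1 + sigma ^+ 2) - 4 / eta / 2) <= #|D|%:R * (eta / 2).
  rewrite expRD; apply: ler_pM; rewrite ?expR_ge0//.
    by rewrite -[leRHS]lnK ?posrE ?ltr0n// ler_expR.
  have -> : 4 / eta / 2 = 2 / eta by field; rewrite gt_eqF.
  rewrite expRN -[leRHS]invrK lef_pV2 ?posrE ?expR_gt0//; last by rewrite invr_gt0 divr_gt0.
  have := expR_ge1Dx (2 / eta).
  have -> : (eta / 2)^-1 = 2 / eta by rewrite invf_div.
  lra.
move=> H3; move: H H2 H3; set A := \sum_(S | D S) error _ _ _ _ _.
set B := \sum_(S | D S) _; set M := #|D|%:R.
by lra.
Qed.

(** Off the diagonal, the noise of one row is independent of the other factors and has mean 0.
    Integrability of the cross terms comes from the diagonal by [|a b| <= a^2 + b^2], so two moments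
    of the entries suffice. *)
Lemma noise_correlation (v : 'cV[R]_p) :
  rintegrable P (fun w => (\sum_i signal X v w i * W i w) ^+ 2) /\
  \int[P]_w ((\sum_i signal X v w i * W i w) ^+ 2) = n%:R * sq v.
Proof.
have sm i := signal_second_moment model mu_mean mu_variance v i.
have gsq : rintegrable (@gauss R) (fun t => t ^+ 2) by exact: rintegrable_gauss_pow.
have gid : rintegrable (@gauss R) (fun t => t).
  exact: (@rintegrable_gauss_pow R 1 isT).
pose Jx : {set ('I_n * 'I_p) + 'I_n} := [set s : ('I_n * 'I_p) + 'I_n | if s is inl _ then true else false]%SET.
have msx i : measurable_fun setT ((fun w => signal X v w i) : sub_sigma Z Jx -> R).
  by apply: measurable_signal => j; rewrite inE.
have mw (i : 'I_n) : measurable_fun setT (W i : sub_sigma Z [set inr i]%SET -> R).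
  by apply: (measurable_sub_sigma_coord (Z := Z) (i := inr i)); rewrite inE.
have dxw (i : 'I_n) s : s \in Jx -> s \notin [set inr i]%SET.
  by rewrite !inE; case: s.
have ms0 i : measurable_fun setT (fun w => signal X v w i).
  exact (measurable_sub_sigma mZ (msx i)).
have mw0 i : measurable_fun setT (W i) by apply: measurable_funPT.
have msq : measurable_fun setT (fun t : R => t ^+ 2) by exact: measurable_funX.
have diag0 i := conj
  (rintegrable_prod_law mZ indZ (dxw i) (msx i) (mw i) (law_noise model i) msq (sm i).1 gsq)
  (Rintegral_prod_law mZ indZ (dxw i) (msx i) (mw i) (law_noise model i) msq (sm i).1 gsq).
have diag i : rintegrable P (fun w => signal X v w i ^+ 2 * W i w ^+ 2).
  exact: (diag0 i).1.
have diagE i : \int[P]_w (signal X v w i ^+ 2 * W i w ^+ 2) = sq v.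
  by rewrite (diag0 i).2 Rintegral_gauss_sqr mulr1 (sm i).2.
have amgm (a b' : R) : `|a * b'| <= a ^+ 2 + b' ^+ 2.
  rewrite normrM -(real_normK (num_real a)) -(real_normK (num_real b')).
  have := normr_ge0 a; have := normr_ge0 b'; have := sqr_ge0 (`|a| - `|b'|).
  by rewrite sqrrB mulr2n; set x := `|a|; set y := `|b'|; nra.
pose term i l w := (signal X v w i * W i w) * (signal X v w l * W l w).
have mterm i l : measurable_fun setT (term i l).
  by apply: measurable_funM; exact: measurable_funM.
have iterm i l : rintegrable P (term i l).
  refine (rintegrable_le (mterm i l) _ (rintegrableD (diag i) (diag l))) => w.
  by apply: (le_trans (amgm _ _)); rewrite !exprMn.
have Eterm i l : i != l -> \int[P]_w term i l w = 0.
  move=> il; pose Jl : {set ('I_n * 'I_p) + 'I_n} := [set~ inr i]%SET.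
  pose V w := signal X v w i * (signal X v w l * W l w).
  have mV : measurable_fun setT (V : sub_sigma Z Jl -> R).
    have sub c : measurable_fun setT ((fun w => signal X v w c) : sub_sigma Z Jl -> R).
      by apply: measurable_signal => j; rewrite !inE.
    have mWl : measurable_fun setT (W l : sub_sigma Z Jl -> R).
      apply: (measurable_sub_sigma_coord (Z := Z) (i := inr l)); rewrite !inE.
      by apply/negP => /eqP [] li; rewrite li eqxx in il.
    by apply: measurable_funM => //; apply: measurable_funM.
  have iV : rintegrable P V.
    have mV0 : measurable_fun setT V by apply: measurable_funM => //; exact: measurable_funM.
    refine (rintegrable_le mV0 _ (rintegrableD (sm i).1 (diag l))) => w.
    by apply: (le_trans (amgm _ _)); rewrite exprMn.
  have dj s : s \in Jl -> s \notin [set inr i]%SET by rewrite !inE.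
  have mid : measurable_fun setT (fun t : R => t) by exact: measurable_id.
  transitivity (\int[P]_w (V w * W i w)).
    by apply: eq_Rintegral => w _; rewrite /term /V /=; ring.
  rewrite (Rintegral_prod_law mZ indZ dj mV (mw i) (law_noise model i) mid iV gid).
  by rewrite (Rintegral_gauss_odd gid)// mulr0.
have E : (fun w => (\sum_i signal X v w i * W i w) ^+ 2) = (fun w => \sum_i \sum_l term i l w).
  apply/funext => w; rewrite expr2 mulr_suml; apply: eq_bigr => i _.
  by rewrite mulr_sumr.
have irow i : rintegrable P (fun w => \sum_l term i l w) by exact: rintegrable_sum.
split; first by rewrite E; exact: rintegrable_sum.
transitivity (\int[P]_w (\sum_i \sum_l term i l w)).
  by apply: eq_Rintegral => w _; exact: (congr1 (@^~ w) E).
rewrite ERintegral_sum// -[in RHS](card_ord n) -sum1_card natr_sum mulr_suml.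
apply: eq_bigr => i _; rewrite mul1r ERintegral_sum// (bigD1 i)//= big1 ?addr0.
  by rewrite -(diagE i); apply: eq_Rintegral => w _; rewrite /term; ring.
by move=> l li; apply: Eterm; rewrite eq_sym.
Qed.

(** With equal variances the ratio is [Cw + Qw / 2]; Markov's inequality for [Qw] and for the square
    of [Cw] keeps it below [4 (1 + q)] with probability at least 1/2. The answer [S] has probability
    at least 3/4 under [b], so 1/4 remains on this event, and the change of measure carries it to
    [b'], where [S] is an error. *)
Lemma two_point (S S' : {set 'I_p}) (b b' : 'cV[R]_p) (q : R) : S != S' ->
  n%:R * sq (b - b') <= q -> error X W g S b <= 4^-1 ->
  expR (- (4 * (1 + q))) / 4 <= error X W g S' b'.
Proof.
move=> SS' nq errb; set v := b - b' in nq.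
have q0 : 0 <= q by apply: le_trans nq; rewrite mulr_ge0// sumr_ge0// => j _; exact: sqr_ge0.
have sm i := signal_second_moment model mu_mean mu_variance v i.
have [ic Ec] := noise_correlation v.
pose Cw w := \sum_i signal X v w i * W i w.
pose Qw w := \sum_i signal X v w i ^+ 2.
have iQ : rintegrable P Qw by apply: rintegrable_sum => i; have [] := sm i.
have EQ : \int[P]_w Qw w = n%:R * sq v.
  rewrite ERintegral_sum => [|i]; last by have [] := sm i.
  rewrite (eq_bigr (fun=> sq v)) => [|i _]; last by have [] := sm i.
  by rewrite sumr_const card_ord mulr_natl.
have Q0 w : 0 <= Qw w by apply: sumr_ge0 => i _; exact: sqr_ge0.
have p0 : 0 < 4 * (1 + q) by rewrite mulr_gt0//; lra.
have PQ : fine (P [set w | 4 * (1 + q) <= Qw w]) <= 4^-1.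
  apply: (le_trans (markov_prob iQ Q0 p0)); rewrite EQ ler_pdivrMr//; lra.
have c0 : 0 < (2 * (1 + q)) ^+ 2 by rewrite exprn_gt0// mulr_gt0//; lra.
have PC : fine (P [set w | (2 * (1 + q)) ^+ 2 <= Cw w ^+ 2]) <= 4^-1.
  apply: (le_trans (markov_prob ic (fun w => sqr_ge0 _) c0)); rewrite Ec ler_pdivrMr//; nra.
have llE w : loglik X W b b' 1 w = Cw w + Qw w / 2.
  rewrite /loglik /Cw /Qw mulr_suml -big_split/=; apply: eq_bigr => i _.
  by rewrite ln1 divr1 -/v; field.
have mQ : measurable [set w | 4 * (1 + q) <= Qw w].
  rewrite -[X in measurable X]setTI; apply: measurable_fun_le => //.
  exact: rintegrable_measurable iQ.
have mC : measurable [set w | (2 * (1 + q)) ^+ 2 <= Cw w ^+ 2].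
  rewrite -[X in measurable X]setTI; apply: measurable_fun_le => //.
  exact: rintegrable_measurable ic.
have ml := @measurable_loglik_le R d Omega P n p X W b b' 1 (4 * (1 + q)).
have Pl : 1 - fine (P [set w | loglik X W b b' 1 w <= 4 * (1 + q)]) <= 2^-1.
  rewrite -fine_probC//; apply: (@le_trans _ _ (fine (P [set w | 4 * (1 + q) <= Qw w]) +
      fine (P [set w | (2 * (1 + q)) ^+ 2 <= Cw w ^+ 2]))); last by lra.
  apply: (le_trans _ (fine_probD P mQ mC)).
  apply: fine_prob_le; [exact: measurableC|exact: measurableU|].
  move=> w /=; rewrite llE => /negP; rewrite -ltNge => lw.
  have [Qs|Qb] := leP (4 * (1 + q)) (Qw w); [by left|right].
  have : 2 * (1 + q) <= Cw w by lra.
  by move=> Cb; apply: lerXn2r => //; rewrite nnegrE; lra.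
have := success_le model mg S b b' (4 * (1 + q)) ltr01.
have mS U := measurable_noisy_event X W b' 1 (measurable_decides mg U).
have disj : fine (P [set w | decides g S ((measurement_matrix X w *m b' + 1 *: \col_i W i w,
    measurement_matrix X w))]) <= error X W g S' b'.
  have -> : error X W g S' b' = 1 - (1 - error X W g S' b') by lra.
  rewrite -(successE X W mg) -fine_probC//.
  apply: fine_prob_le => //; first exact: measurableC.
  by move=> w; rewrite /decides/= => gS gS'; move: SS'; rewrite -gS -gS' eqxx.
move=> H; have := lerD H Pl; have := ler_wpM2l (expR_ge0 (4 * (1 + q))) disj.
move=> H2 H1.
have E0 := expR_gt0 (4 * (1 + q)).
rewrite expRN ler_pdivrMr// -(ler_pM2l E0) mulfV ?gt_eqF// mulrA.
by lra.
Qed.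

End converse.

(** * Non-singularity of random matrices *)

(** If an atom [c0] had mass 1, [(x - c0)^2] would have mean 0, whereas it is [1 + c0^2]. At most
    one atom exceeds 1/2, so [rho] is its mass, or 1/2 when there is none. *)
Lemma atoms_bounded (R : realType) (mu : probability R R) :
  ('E_mu[idfun] = 0)%E -> ('V_mu[idfun] = 1)%E ->
  exists rho : R, [/\ 0 < rho, rho < 1 & forall c, fine (mu [set c]) <= rho].
Proof.
move=> mean0 var1.
have [H|/existsNP [c0 /negP]] := pselect (forall c, fine (mu [set c]) <= 2^-1).
  by exists 2^-1; split => //; rewrite invf_lt1// ltr1n.
rewrite -ltNge => c0_gt; exists (fine (mu [set c0])).
have m1 (c : R) : measurable [set c] by exact: measurable_set1.
split; first by apply: lt_trans c0_gt; rewrite invr_gt0.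
  rewrite lt_neqAle fine_prob_le1// andbT; apply/negP => /eqP c0_1.
  have I1 := rintegrable_entry mean0 var1; have I2 := rintegrable_entry_sqr mean0 var1.
  pose f x := x ^+ 2 + ((- (2 * c0)) * x + c0 ^+ 2).
  have : \int[mu]_x f x = 0.
    rewrite -(ERintegral_cst mu 0); congr fine; apply: ae_eq_integral => //.
    - apply/measurable_EFinP; apply: measurable_funD; first exact: measurable_funX.
      by apply: measurable_funD => //; apply: measurable_funM.
    - exists (~` [set c0]); split; first exact: measurableC.
        have mc := measurableC (m1 c0).
        have := fine_probC mu (m1 c0); rewrite c0_1 subrr => H.
        by have := fineK (fin_num_measure mu _ mc); rewrite H => /esym.
      move=> x nx xc; apply: nx => _; rewrite (_ : x = c0) //; congr EFin; rewrite /f; ring.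
  have Ic := rintegrable_cst mu (c0 ^+ 2); have IZ := rintegrableZ (- (2 * c0)) I1.
  rewrite /f ERintegralD//; last exact: rintegrableD.
  rewrite ERintegralD// ERintegralZ// entry_second_moment// entry_mean// mulr0 add0r.
  rewrite ERintegral_cst => H; have := sqr_ge0 c0; lra.
move=> c; have [->//|cc0] := eqVneq c c0.
have m2 : measurable ([set c] `|` [set c0]) by exact: measurableU.
have : fine (mu [set c]) + fine (mu [set c0]) <= 1.
  apply: le_trans (fine_prob_le1 mu m2).
  rewrite measureU// ?fineD ?fin_num_measure//.
  by apply/seteqP; split => // x [/= -> /eqP]; rewrite (negbTE cc0).
by move: c0_gt; lra.
Qed.

Section pin.
Context (R : realType) (d : measure_display) (Omega : measurableType d)
  (P : probability Omega R) (I : finType).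
Variable Z : I -> Omega -> R.
Hypothesis mZ : forall i, measurable_fun setT (Z i).
Hypothesis indZ : mutually_independent P Z.
Variables (mu : probability R R) (rho : R).
Hypothesis rho_atoms : forall c, fine (mu [set c]) <= rho.

(** With the other coordinates fixed, the equation has the single solution [- b / a], an atom of
    mass at most [rho]. *)
Lemma affine_zero_prob i (K : set Omega) (a b : Omega -> R) :
  (forall A, measurable A -> P (Z i @^-1` A) = mu A) ->
  measurable (K : set (sub_sigma Z [set~ i])) ->
  measurable_fun setT (a : sub_sigma Z [set~ i] -> R) ->
  measurable_fun setT (b : sub_sigma Z [set~ i] -> R) ->
  (forall w, K w -> a w != 0) ->
  fine (P (K `&` [set w | a w * Z i w + b w = 0])) <= rho * fine (P K).
Proof.
move=> lawZ mK ma mb a0.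
have sub (A : set Omega) : measurable (A : set (sub_sigma Z [set~ i]%SET)) -> measurable A.
  by move=> mA; exact: (coord_events_measurable mZ mA).
have mK' := sub _ mK.
have ma' := measurable_sub_sigma mZ ma; have mb' := measurable_sub_sigma mZ mb.
pose f (x : sub_sigma Z [set~ i] * R) : \bar R :=
  (\1_K x.1 * \1_[set 0] (a x.1 * x.2 + b x.1))%:E.
have m0 : measurable [set (0 : R)] by exact: measurable_set1.
have mf : measurable_fun setT f.
  apply/measurable_EFinP; apply: measurable_funM.
    by apply: (measurableT_comp (measurable_indic mK)).
  apply: (measurableT_comp (measurable_indic m0)).
  apply: measurable_funD; last exact: (measurableT_comp mb).
  by apply: measurable_funM => //; exact: (measurableT_comp ma).
have f0 x : (0 <= f x)%E by rewrite lee_fin mulr_ge0.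
have := resample_coord mZ indZ lawZ mf f0.
have mE : measurable [set w | a w * Z i w + b w = 0].
  rewrite -[X in measurable X]setTI.
  have : measurable_fun setT (fun w => a w * Z i w + b w).
    by apply: measurable_funD => //; exact: measurable_funM.
  by move=> /(_ measurableT _ m0); congr measurable.
have -> : (\int[P]_w f (w, Z i w) = P (K `&` [set w | (a w * Z i w + b w)%R = 0%R]))%E.
  have mKE : measurable (K `&` [set w | a w * Z i w + b w = 0]) by exact: measurableI.
  transitivity (\int[P]_w (\1_(K `&` [set w | (a w * Z i w + b w)%R = 0%R]) w)%:E)%E; last first.
    by rewrite integral_indic// setIT.
  apply: eq_integral => w _; rewrite /f indicI /=; congr (_ * _)%:E.
move=> ->; have -> : rho * fine (P K) = \int[P]_w (rho * \1_K w).
  by rewrite ERintegralZ ?ERintegral_indic//; exact: rintegrable_indic.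
have rho0 : 0 <= rho by apply: le_trans (rho_atoms 0); rewrite fine_ge0.
have inner (w : Omega) : (\int[mu]_t f (w, t) <= (rho * \1_K w)%:E)%E.
  rewrite /f/= [\1_K w]indicE; have [Kw|Kw] := boolP (w \in K); last first.
    by under eq_integral do rewrite mul0r; rewrite integral0 mulr0.
  rewrite mulr1; under eq_integral do rewrite mul1r.
  have aw := a0 w (set_mem Kw).
  rewrite (_ : (fun t => _) = fun t => (\1_[set - b w / a w] t)%:E); last first.
    apply/funext => t; congr EFin; rewrite !indicE; congr (nat_of_bool _)%:R.
    apply/idP/idP; rewrite !inE/=.
      by move=> H; rewrite -[b w](addKr (a w * t)) H addr0 opprK mulrC mulKf.
    by move=> ->; rewrite mulrCA divff// mulr1 addNr.
  rewrite integral_indic ?setIT//.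
  have m1 : measurable [set - b w / a w] by exact: measurable_set1.
  have F := fin_num_measure mu _ m1.
  by apply: (@le_trans _ _ (fine (mu [set - b w / a w]))%:E); [rewrite fineK|rewrite lee_fin].
have ir : rintegrable P (fun w => rho * \1_K w) by apply: rintegrableZ; exact: rintegrable_indic.
have L0 : (0 <= \int[P]_w \int[mu]_t f (w, t))%E.
  by apply: integral_ge0 => w _; exact: integral_ge0.
have LE : (\int[P]_w \int[mu]_t f (w, t) <= \int[P]_w (rho * \1_K w)%:E)%E.
  apply: ge0_le_integral => //.
  - by move=> w _; exact: integral_ge0.
  - have mF := @measurable_fun_fubini_tonelli_F _ _ (sub_sigma Z [set~ i]%SET) _ _ mu f mf f0.
    exact: (measurable_sub_sigma mZ mF).
  - by apply/measurable_EFinP; exact: (rintegrable_measurable ir).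
apply: fine_le; last exact: LE.
  by rewrite ge0_fin_numE//; apply: (le_lt_trans LE); rewrite ERintegralE// ltry.
exact: integrable_fin_num.
Qed.
End pin.

Lemma measurable_det (R : realType) (d : measure_display) (T : measurableType d) m
    (F : T -> 'M[R]_m) :
  (forall a b, measurable_fun setT (fun t => F t a b)) ->
  measurable_fun setT (fun t => \det (F t)).
Proof.
move=> mF; rewrite /determinant; apply: measurable_sum => s.
by apply: measurable_funM => //; apply: measurable_prod => a _; exact: mF.
Qed.

(** The determinant is affine in its corner entry, with the minor one size smaller as slope; zeroing
    the corner leaves the cofactors of the last row unchanged. *)
Lemma det_last_entry (F : comNzRingType) m (M : 'M[F]_m.+1) :
  \det M = M ord_max ord_max * \det (row' ord_max (col' ord_max M)) +
    \det (\matrix_(a, b) if (a == ord_max) && (b == ord_max) then 0 else M a b).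
Proof.
rewrite (expand_det_row M ord_max) (expand_det_row (\matrix_(a, b) _) ord_max).
rewrite (bigD1 ord_max)//= [X in _ = _ + X](bigD1 ord_max)//= !mxE !eqxx/= mul0r add0r.
have cof b : cofactor (\matrix_(a, b) if (a == ord_max) && (b == ord_max) then 0 else M a b)
    ord_max b = cofactor M ord_max b.
  rewrite /cofactor; congr (_ * \det _); apply/matrixP => a c; rewrite !mxE.
  by rewrite eq_sym (negbTE (neq_lift _ _)).
congr (_ + _).
  by rewrite /cofactor -signr_odd oddD addbb mul1r.
by apply: eq_bigr => b b_max; rewrite cof !mxE (negbTE b_max) andbF.
Qed.

Section singularity.
Context (R : realType) (mu : probability R R) (d : measure_display)
  (Omega : measurableType d) (P : probability Omega R) (n p : nat).
Variables (X : 'I_n -> 'I_p -> {RV P >-> R}) (W : 'I_n -> {RV P >-> R}).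
Hypothesis model : measurement_model mu X W.
Variable rho : R.
Hypotheses (rho_gt0 : 0 < rho) (rho_lt1 : rho < 1)
  (rho_atoms : forall c, fine (mu [set c]) <= rho).
Variable c : nat -> 'I_p.
Hypothesis c_inj : forall a b, (a < n)%N -> (b < n)%N -> c a = c b -> a = b.

Local Notation Z := (coords X W).
Let mZ := measurable_coords X W.
Let indZ := coords_indep model.

(** The rows are picked by an arbitrary map rather than by a subset: a repeated row makes the minor
    vanish, so no injectivity has to be carried along. The columns are the first [m] of the list
    [c]. *)
Definition xminor m (I : {ffun 'I_m -> 'I_n}) w : R :=
  \det (\matrix_(a, b < m) X (I a) (c b) w).

Let ext m (I : {ffun 'I_m -> 'I_n}) (l : 'I_n) : {ffun 'I_m.+1 -> 'I_n} :=
  [ffun a => if unlift ord_max a is Some a' then I a' else l].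

Let rest m (I : {ffun 'I_m -> 'I_n}) l w : R :=
  \det (\matrix_(a, b < m.+1) if (a == ord_max) && (b == ord_max) then 0
                              else X (ext I l a) (c b) w).

Let xminor_ext m (I : {ffun 'I_m -> 'I_n}) l w :
  xminor (ext I l) w = xminor I w * Z (inl (l, c m)) w + rest I l w.
Proof.
rewrite /xminor det_last_entry mulrC; congr (_ * _ + _).
- congr (\det _); apply/matrixP => a b; rewrite !mxE /ext ffunE liftK.
  by congr (X _ (c _) w); rewrite lift_max.
- by rewrite mxE /ext ffunE unlift_none.
- by congr (\det _); apply/matrixP => a b; rewrite !mxE; case: ifP.
Qed.

Let measurable_entry (J : {set ('I_n * 'I_p) + 'I_n}) i j : inl (i, j) \in J ->
  measurable_fun setT (X i j : sub_sigma Z J -> R).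
Proof. by move=> ij; exact: (measurable_sub_sigma_coord (Z := Z) (i := inl (i, j))). Qed.

Let measurable_xminor m (I : {ffun 'I_m -> 'I_n}) (J : {set ('I_n * 'I_p) + 'I_n}) :
  (forall a (b : 'I_m), inl (I a, c b) \in J) ->
  measurable_fun setT (xminor I : sub_sigma Z J -> R).
Proof.
move=> IJ; apply: measurable_det => a b; under eq_fun do rewrite mxE.
exact: measurable_entry.
Qed.

Let mxminor m (I : {ffun 'I_m -> 'I_n}) : measurable_fun setT (xminor I).
Proof.
have H : measurable_fun setT (xminor I : sub_sigma Z [set: _]%SET -> R).
  by apply: measurable_xminor => a b; rewrite inE.
exact: (measurable_sub_sigma mZ H).
Qed.

Lemma measurable_zero d' (T : measurableType d') (f : T -> R) :
  measurable_fun setT f -> measurable [set w | f w = 0].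
Proof.
move=> mf; rewrite -[X in measurable X]setTI.
by have := mf measurableT _ (measurable_set1 0); congr measurable.
Qed.

Lemma measurable_nonzero d' (T : measurableType d') (f : T -> R) :
  measurable_fun setT f -> measurable [set w | f w != 0].
Proof.
move=> mf; rewrite (_ : [set w | _] = ~` [set w | f w = 0]).
  by apply: measurableC; exact: measurable_zero.
by apply/seteqP; split => w /=; move/eqP.
Qed.

(** The event that the columns [c 0] to [c (m - 1)] are linearly independent. *)
Definition nonsingular m : set Omega := [set w | exists I : {ffun 'I_m -> 'I_n}, xminor I w != 0].

(* On this event [xminor I w] is the coefficient of the entry [X l (c m)] in the
   minor [ext I l], for each row [l] outside [I]. Pinning these [n - m] entries
   one after the other costs a factor [rho] each time. *)
Let first_minor m (I : {ffun 'I_m -> 'I_n}) : set Omega :=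
  [set w | xminor I w != 0] `&`
  \big[setI/setT]_(I' : {ffun 'I_m -> 'I_n} | (enum_rank I' < enum_rank I)%N) [set w | xminor I' w = 0].

Let measurable_first m (I : {ffun 'I_m -> 'I_n}) (J : {set ('I_n * 'I_p) + 'I_n}) :
  (forall a (b : 'I_m), inl (a, c b) \in J) ->
  measurable (first_minor I : set (sub_sigma Z J)).
Proof.
move=> IJ; apply: measurableI.
  by apply: measurable_nonzero; apply: measurable_xminor.
apply: bigsetI_measurable => I' _; apply: measurable_zero.
exact: measurable_xminor.
Qed.

Let mfirst m (I : {ffun 'I_m -> 'I_n}) : measurable (first_minor I).
Proof.
have H : measurable (first_minor I : set (sub_sigma Z [set: _]%SET)).
  by apply: measurable_first => a b; rewrite inE.
exact: (coord_events_measurable mZ H).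
Qed.

Let pinned m (I : {ffun 'I_m -> 'I_n}) (s : seq 'I_n) : set Omega :=
  first_minor I `&` \big[setI/setT]_(l <- s) [set w | xminor (ext I l) w = 0].

Let measurable_pinned m (I : {ffun 'I_m -> 'I_n}) s : measurable (pinned I s).
Proof. by apply: measurableI => //; apply: bigsetI_measurable => l _; exact: measurable_zero. Qed.

(** The entry [X l (c m)] occurs neither in [first_minor I], which reads earlier columns, nor in the
    minors extended by other rows, so each row of [s] brings its own factor. *)
Let pinned_prob m (I : {ffun 'I_m -> 'I_n}) (s : seq 'I_n) : (m < n)%N -> uniq s ->
  (forall l a, l \in s -> I a != l) ->
  fine (P (pinned I s)) <= rho ^+ size s * fine (P (first_minor I)).
Proof.
move=> m_n; elim: s => [|l s IH] /=.
  by move=> _ _; rewrite expr0 mul1r /pinned big_nil setIT.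
move=> /andP[ls us] Is.
have := IH us _; rewrite exprS -mulrA => /(_ _)/(ler_wpM2l (ltW rho_gt0)) H.
apply: le_trans (H _); last by move=> l' a l's; apply: Is; rewrite inE l's orbT.
pose J : {set ('I_n * 'I_p) + 'I_n} := [set~ inl (l, c m)]%SET.
have cJ a (b : 'I_m) : inl (a, c b) \in J.
  rewrite !inE; apply/negP => /eqP [] _ /c_inj.
  move=> /(_ (ltn_trans (ltn_ord b) m_n) m_n) bm.
  by have := ltn_ord b; rewrite bm ltnn.
have lJ a j : a != l -> inl (a, j) \in J.
  by move=> al; rewrite !inE; apply/negP => /eqP [] al'; rewrite al' eqxx in al.
have cmp (b : 'I_m.+1) : b != ord_max -> exists b' : 'I_m, b = b' :> nat.
  move=> bm; have bm' : (b < m)%N.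
    by rewrite ltn_neqAle -ltnS ltn_ord andbT.
  by exists (Ordinal bm').
have mK : measurable (pinned I s : set (sub_sigma Z J)).
  apply: measurableI; first exact: measurable_first.
  rewrite big_seq_cond; apply: bigsetI_measurable => l' /andP[l's _].
  apply: measurable_zero; apply: measurable_xminor => a b; rewrite /ext ffunE.
  case: unliftP => [a' _|_].
    by apply: lJ; apply: Is; rewrite inE eqxx.
  by apply: lJ; apply/negP => /eqP ll'; rewrite -ll' l's in ls.
have ma : measurable_fun setT (xminor I : sub_sigma Z J -> R).
  by apply: measurable_xminor.
have mb : measurable_fun setT (rest I l : sub_sigma Z J -> R).
  rewrite /rest; apply: measurable_det => a b; under eq_fun do rewrite mxE.
  case: (boolP ((a == ord_max) && (b == ord_max))) => [_|nab]; first exact: measurable_cst.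
  apply: measurable_entry; rewrite /ext ffunE.
  case: unliftP nab => [a' _ _|->].
    by apply: lJ; apply: Is; rewrite inE eqxx.
  by rewrite eqxx/= => /cmp[b' ->]; exact: cJ.
have a0 w : pinned I s w -> xminor I w != 0 by case=> -[].
have := affine_zero_prob mZ indZ rho_atoms (law_entry model (l, c m)) mK ma mb a0.
congr (_ <= _); congr (fine (P _)).
rewrite /pinned big_cons -setIA; congr (_ `&` _); rewrite setIC; congr (_ `&` _).
by apply/funext => w /=; rewrite xminor_ext.
Qed.

Let uncovered m (I : {ffun 'I_m -> 'I_n}) : exists s : seq 'I_n,
  [/\ uniq s, forall l a, l \in s -> I a != l & (n - m <= size s)%N].
Proof.
exists (enum [predC codom I]); split; first exact: enum_uniq.
  move=> l a; rewrite mem_enum inE; apply: contra => /eqP <-; exact: codom_f.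
rewrite -cardE leq_subLR -{1}(card_ord n) -(cardC (mem (codom I))) leq_add2r.
by apply: leq_trans (card_size _) _; rewrite size_codom card_ord.
Qed.

Let mnonsing m : measurable (nonsingular m).
Proof.
rewrite (_ : nonsingular m = [set w | \sum_(I : {ffun 'I_m -> 'I_n}) xminor I w ^+ 2 != 0]).
  by apply: measurable_nonzero; apply: measurable_sum => I; exact: measurable_funX.
apply/seteqP; split => w /=.
  move=> [I I0]; rewrite psumr_neq0 => [|? _]; last exact: sqr_ge0.
  by apply/hasP; exists I; rewrite ?mem_index_enum// lt_neqAle sqr_ge0 andbT eq_sym expf_neq0.
rewrite psumr_neq0 => [|? _]; last exact: sqr_ge0.
by move=> /hasP[I _ I0]; exists I; apply: contraTneq I0 => ->; rewrite expr0n ltxx.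
Qed.

Let first_minorP m (I : {ffun 'I_m -> 'I_n}) w : first_minor I w <->
  xminor I w != 0 /\ forall I' : {ffun 'I_m -> 'I_n}, (enum_rank I' < enum_rank I)%N -> xminor I' w = 0.
Proof.
rewrite /first_minor -bigcap_seq_cond; split => -[I0 II']; split => //.
  by move=> I' II; apply: (II' I'); rewrite /= mem_index_enum.
by move=> I' /= /andP[_]; exact: II'.
Qed.

Let sum_prob (J : finType) (A : J -> set Omega) : (forall j, measurable (A j)) ->
  \sum_j fine (P (A j)) = \int[P]_w (\sum_j \1_(A j) w).
Proof.
move=> mA; rewrite ERintegral_sum; last by move=> j; exact: rintegrable_indic.
by apply: eq_bigr => j _; rewrite ERintegral_indic.
Qed.

Let sum_first m : \sum_(I : {ffun 'I_m -> 'I_n}) fine (P (first_minor I)) <= fine (P (nonsingular m)).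
Proof.
rewrite sum_prob// -ERintegral_indic//; apply: ERintegral_le.
- by apply: rintegrable_sum => I; exact: rintegrable_indic.
- exact: rintegrable_indic.
move=> w; have [[I KI]|noK] := pselect (exists I : {ffun 'I_m -> 'I_n}, first_minor I w); last first.
  by rewrite big1// => I _; rewrite indicE memNset// => KI; apply: noK; exists I.
rewrite (bigD1 I)//= big1 ?addr0 => [|I' I'I].
  have /first_minorP[I0 _] := KI.
  by rewrite [leRHS]indicE mem_set ?indicE ?lern1 ?leq_b1//; exists I.
rewrite indicE memNset// => KI'.
have /first_minorP[I0 IL] := KI; have /first_minorP[I'0 I'L] := KI'.
case: (ltngtP (enum_rank I) (enum_rank I')) => II'.
- by rewrite I'L ?eqxx in I0.
- by rewrite IL ?eqxx in I'0.
- by move: I'I; rewrite (enum_rank_inj (ord_inj II')) eqxx.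
Qed.

(** The events [first_minor I] are disjoint and cover [nonsingular m]. Failure at the next size
    makes every extension of [I] vanish, and at least [n - m] rows lie outside [I]. *)
Let step_fail m : (m < n)%N ->
  fine (P (nonsingular m `\` nonsingular m.+1)) <= rho ^+ (n - m) * fine (P (nonsingular m)).
Proof.
move=> m_n; have mD := measurableD (@mnonsing m) (@mnonsing m.+1).
have mI (I : {ffun 'I_m -> 'I_n}) : measurable (first_minor I `\` nonsingular m.+1).
  exact: measurableD.
apply: (@le_trans _ _ (\sum_(I : {ffun 'I_m -> 'I_n}) fine (P (first_minor I `\` nonsingular m.+1)))).
  rewrite sum_prob// -ERintegral_indic//; apply: ERintegral_le.
  - exact: rintegrable_indic.
  - by apply: rintegrable_sum => I; exact: rintegrable_indic.
  move=> w; have s0 : 0 <= \sum_(I : {ffun 'I_m -> 'I_n}) \1_(first_minor I `\` nonsingular m.+1) w :> R.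
    exact: sumr_ge0.
  rewrite [leLHS]indicE; case: (boolP (w \in _)) => // /set_mem [[I1 I10] nG].
  have [I I0 Imin] := @arg_minnP _ I1 (fun I => xminor I w != 0) (fun I => nat_of_ord (enum_rank I)) I10.
  rewrite (bigD1 I)//= indicE mem_set ?lerDl ?sumr_ge0//; split => //.
  apply/first_minorP; split => // I' II'; apply/eqP; apply: contraTT II' => I'0.
  by rewrite -leqNgt; exact: Imin.
apply: le_trans (ler_wpM2l (exprn_ge0 _ (ltW rho_gt0)) (@sum_first m)).
rewrite mulr_sumr; apply: ler_sum => I _.
have [s [us Is ns]] := uncovered I.
apply: (@le_trans _ _ (fine (P (pinned I s)))).
  apply: fine_prob_le => // w [Kw nG]; split => //.
  rewrite -bigcap_seq => l _ /=; apply/eqP; apply: contra_notT nG => l0.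
  by exists (ext I l).
apply: (le_trans (pinned_prob m_n us Is)); apply: ler_wpM2r; first exact: fine_ge0.
by apply: ler_wiXn2l => //; exact: ltW.
Qed.

Let nonsing_step m : (m < n)%N ->
  (1 - rho ^+ (n - m)) * fine (P (nonsingular m)) <= fine (P (nonsingular m.+1)).
Proof.
move=> m_n; have := step_fail m_n.
have mD := measurableD (@mnonsing m) (@mnonsing m.+1).
have : fine (P (nonsingular m)) <= fine (P (nonsingular m `\` nonsingular m.+1)) +
    fine (P (nonsingular m.+1)).
  apply: (le_trans _ (fine_probD P mD (@mnonsing m.+1))).
  apply: fine_prob_le => //; first exact: measurableU.
  by move=> w Gw; have [G1|G1] := pselect (nonsingular m.+1 w); [right|left].
lra.
Qed.

Let one_sub_ge x : 0 <= x -> x <= rho -> expR (- (x / (1 - rho))) <= 1 - x.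
Proof.
move=> x0 xr; have r0 : 0 < 1 - rho by have := rho_lt1; lra.
have x1 : 0 < 1 - x by lra.
rewrite expRN -[leRHS]invrK lef_pV2 ?posrE ?expR_gt0 ?invr_gt0//.
have -> : (1 - x)^-1 = 1 + x / (1 - x) by field; rewrite gt_eqF.
apply: le_trans (expR_ge1Dx _) _; rewrite ler_expR; apply: ler_wpM2l => //.
by rewrite lef_pV2 ?posrE//; lra.
Qed.

Definition nonsing_prob : R := expR (- (1 - rho) ^- 2).

(** The failure rates [rho^(n - m)] form a geometric series read from its end, so the bound at
    [m = n] does not depend on [n]. The exponent is such that the induction step reduces to
    [rho (2 - rho) <= 1]. *)
Let nonsingular_lower m : (m <= n)%N ->
  expR (- (rho ^+ (n - m) / (1 - rho) ^+ 2)) <= fine (P (nonsingular m)).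
Proof.
have r0 : 0 < 1 - rho by have := rho_lt1; lra.
have r2 : 0 < (1 - rho) ^+ 2 by exact: exprn_gt0.
elim: m => [|m IH] m_n.
  apply: (@le_trans _ _ 1).
    by rewrite -[leRHS]expR0 ler_expR oppr_le0 divr_ge0// ?exprn_ge0// ltW.
  rewrite (_ : nonsingular 0 = setT); first by rewrite [X in fine X]probability_setT.
  apply/seteqP; split => // w _.
  by exists [ffun a : 'I_0 => let: Ordinal _ lt := a in match notF lt with end]; rewrite /xminor det_mx00 oner_eq0.
apply: le_trans (nonsing_step m_n).
have e : (n - m = (n - m.+1).+1)%N by rewrite subnSK.
have x0 : 0 <= rho ^+ (n - m) by rewrite exprn_ge0// ltW.
have x1 : rho ^+ (n - m) <= rho.
  by rewrite e exprS ler_piMr ?exprn_ile1// ltW.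
apply: le_trans (ler_pM (expR_ge0 _) (expR_ge0 _) (one_sub_ge x0 x1) (IH (ltnW m_n))).
rewrite -expRD ler_expR -opprD lerN2 ler_pdivlMr//.
have -> : (rho ^+ (n - m) / (1 - rho) + rho ^+ (n - m) / (1 - rho) ^+ 2) * (1 - rho) ^+ 2 =
    rho ^+ (n - m) * (2 - rho) by field; rewrite gt_eqF.
rewrite e exprS; have y0 : 0 <= rho ^+ (n - m.+1) by rewrite exprn_ge0// ltW.
set y := rho ^+ _ in y0 *; have := rho_gt0; have := mulr_ge0 y0 (sqr_ge0 (1 - rho)).
by rewrite expr2; nra.
Qed.

Lemma det_nonzero_prob :
  nonsing_prob <= fine (P [set w | \det (\matrix_(i, b < n) X i (c b) w) != 0]).
Proof.
have := nonsingular_lower (leqnn n); rewrite subnn expr0 div1r => /le_trans; apply.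
apply: fine_prob_le => //.
  apply: measurable_nonzero; apply: measurable_det => a b; under eq_fun do rewrite mxE.
  exact: measurable_funPT.
move=> w [I]; rewrite /xminor /=.
(* The chosen rows are a selection matrix times the full square matrix, so a non-zero minor makes
   the latter invertible. *)
have -> : \matrix_(a, b) X (I a) (c b) w = rowsub I 1%:M *m \matrix_(i, b < n) X i (c b) w.
  by rewrite -rowsubE; apply/matrixP => a b; rewrite !mxE.
by rewrite det_mulmx mulf_eq0 negb_or => /andP[].
Qed.

End singularity.

(** * Uniform average over a box *)

Section box_average.
Context (R : realType) (L : R) (L0 : 0 < L).
Local Notation leb := (@lebesgue_measure R).

Definition unif : probability R R := distribution (uniform_prob L0) (@borel_id R).

Lemma ge0_integral_unif (f : R -> \bar R) :
  measurable_fun setT f -> (forall x, 0 <= f x)%E ->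
  (\int[unif]_x f x = \int[leb]_x (f x * (uniform_pdf 0 L x)%:E))%E.
Proof.
move=> mf f0; rewrite /unif ge0_integral_distribution//.
rewrite (@integral_uniform _ _ _ L0 (f \o @borel_id R))//.
rewrite subr0 -ge0_integralZl//; last 2 first.
- exact: measurable_funTS.
- by rewrite lee_fin invr_ge0 ltW.
rewrite integral_mkcond/=; apply: eq_integral => x _; rewrite patchE /uniform_pdf.
by rewrite mem_setE/= in_itv/= subr0; case: ifP => _; rewrite ?mule0// muleC.
Qed.

Lemma unif_le (f g : R -> \bar R) : measurable_fun setT f -> measurable_fun setT g ->
  (forall x, 0 <= f x)%E -> (forall x, 0 <= g x)%E ->
  (forall x, 0 <= x <= L -> (f x <= g x)%E) ->
  (\int[unif]_x f x <= \int[unif]_x g x)%E.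
Proof.
move=> mf mg f0 g0 fg; have mpdf : measurable_fun setT (fun x => (uniform_pdf 0 L x)%:E).
  by apply/measurable_EFinP; exact: measurable_uniform_pdf.
have p0 x : (0 <= (uniform_pdf 0 L x)%:E)%E by rewrite lee_fin uniform_pdf_ge0.
rewrite !ge0_integral_unif//; apply: ge0_le_integral => //.
- by move=> x _; rewrite mule_ge0.
- exact: emeasurable_funM.
- exact: emeasurable_funM.
move=> x _; have [xL|xL] := boolP (0 <= x <= L).
  by apply: lee_wpmul2r => //; exact: fg.
by rewrite /uniform_pdf (negbTE xL) !mule0.
Qed.

(** The shifted uniform density exceeds the original one only on [D], an interval of length [|k|],
    and by at most [1 / L]; the bound [f <= 1] does the rest. *)
Lemma unif_shift (f : R -> \bar R) (k : R) : measurable_fun setT f ->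
  (forall x, 0 <= f x)%E -> (forall x, f x <= 1)%E ->
  (\int[unif]_x f (x + k)%R <= \int[unif]_x f x + (`|k| / L)%:E)%E.
Proof.
move=> mf f0 f1.
have mpdf : measurable_fun setT (fun x => (uniform_pdf 0 L x)%:E).
  by apply/measurable_EFinP; exact: measurable_uniform_pdf.
have p0 x : (0 <= (uniform_pdf 0 L x)%:E)%E by rewrite lee_fin uniform_pdf_ge0.
have mshift : measurable_fun setT (fun x : R => x - k) by exact: measurable_funB.
have mfk : measurable_fun setT (fun x : R => f (x + k)).
  by apply: measurableT_comp => //; exact: measurable_funD.
pose D : set R := if 0 <= k then `[L, L + k]%classic else `[k, 0]%classic.
have mD : measurable D by rewrite /D; case: ifP.
rewrite (ge0_integral_unif mfk (fun=> f0 _)) (ge0_integral_unif mf f0).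
have -> : (\int[leb]_x (f (x + k)%R * (uniform_pdf 0 L x)%:E) =
    \int[leb]_y (f y * (uniform_pdf 0 L (y - k)%R)%:E))%E.
  rewrite [RHS](ge0_integral_affine k ltr01); last 2 first.
  - by apply: emeasurable_funM => //; exact: (measurableT_comp mpdf mshift).
  - by move=> x; rewrite mule_ge0.
  rewrite mul1e; apply: eq_integral => x _; rewrite mul1r addrC.
  by rewrite addrAC subrr add0r.
have LD : (\int[leb]_x (L^-1 * \1_D x)%:E = (`|k| / L)%:E)%E.
  under eq_integral do rewrite EFinM.
  rewrite ge0_integralZl//; last 2 first.
  - by apply/measurable_EFinP; exact: measurable_indic.
  - by rewrite lee_fin invr_ge0 ltW.
  rewrite integral_indic// setIT /D mulrC EFinM; congr (_ * _)%E.
  case: ifPn => [k0|].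
    rewrite [LHS](lebesgue_measure_itv `[L, L + k])/= lte_fin.
    rewrite ltrDl; have [k1|k1] := ltP 0 k; first by rewrite -EFinB addrAC subrr add0r ger0_norm.
    by rewrite (_ : k = 0) ?normr0//; apply/eqP; rewrite eq_le k1.
  rewrite [LHS](lebesgue_measure_itv `[k, 0])/= lte_fin.
  by rewrite -ltNge => k0; rewrite k0 -EFinB sub0r ltr0_norm.
rewrite -LD -ge0_integralD//; last 4 first.
- by move=> x _; rewrite mule_ge0.
- exact: emeasurable_funM.
- by move=> x _; rewrite lee_fin mulr_ge0// invr_ge0 ltW.
- apply/measurable_EFinP; apply: measurable_funM => //; exact: measurable_indic.
apply: ge0_le_integral => //.
- by move=> x _; rewrite mule_ge0.
- by apply: emeasurable_funM => //; exact: (measurableT_comp mpdf mshift).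
- apply: emeasurable_funD; first exact: emeasurable_funM.
  by apply/measurable_EFinP; apply: measurable_funM => //; exact: measurable_indic.
move=> x _; have Li : 0 <= L^-1 by rewrite invr_ge0 ltW.
rewrite /uniform_pdf subr0; case: (boolP (0 <= x - k <= L)) => xk; last first.
  by rewrite mule0 adde_ge0// ?mule_ge0// lee_fin ?mulr_ge0//; case: ifP.
case: (boolP (0 <= x <= L)) => xL; first by rewrite leeDl// lee_fin mulr_ge0.
rewrite mule0 add0e indicE mem_set ?mulr1; last first.
  move: xk xL; rewrite /D negb_and -!ltNge => /andP[xk1 xk2] xL.
  by have [k0|k0] := leP 0 k; rewrite /= in_itv/=; case/orP: xL => xL; apply/andP; split; lra.
rewrite -[leRHS]mul1e; apply: lee_wpmul2r => //.
Qed.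

(** An iterated integral instead of a product measure on tuples: comparison, shift and Fubini are
    then inductions on the number of coordinates. *)
Fixpoint box_avg n : (n.-tuple R -> \bar R) -> \bar R :=
  match n return (n.-tuple R -> \bar R) -> \bar R with
  | 0 => fun f => f [tuple]
  | n'.+1 => fun f => (\int[unif]_t box_avg (fun s : n'.-tuple R => f [tuple of t :: s]))%E
  end.

Lemma box_avg_ge0 n (f : n.-tuple R -> \bar R) : (forall s, 0 <= f s)%E -> (0 <= box_avg f)%E.
Proof.
elim: n f => [|n IH] f f0 /=; first exact: f0.
by apply: integral_ge0 => t _; apply: IH.
Qed.

Let measurable_cons_pair d (T : measurableType d) n :
  measurable_fun setT (fun z : (T * R) * n.-tuple R => (z.1.1, [tuple of z.1.2 :: z.2])).
Proof.
apply/measurable_fun_pairP; split => /=; first exact: (measurableT_comp measurable_fst measurable_fst).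
by apply: measurable_cons => //; exact: (measurableT_comp measurable_snd measurable_fst).
Qed.

Lemma measurable_box_avg n d (T : measurableType d) (f : T * n.-tuple R -> \bar R) :
  measurable_fun setT f -> (forall z, 0 <= f z)%E ->
  measurable_fun setT (fun x => box_avg (fun s => f (x, s))).
Proof.
elim: n d T f => [|n IH] d T f mf f0 /=.
  exact: (measurableT_comp mf (measurable_pair2 _)).
have mF := IH _ (T * R)%type _ (measurableT_comp mf (@measurable_cons_pair _ T n)) (fun=> f0 _).
by have := @measurable_fun_fubini_tonelli_F _ _ T R R unif _ mF (fun=> box_avg_ge0 (fun=> f0 _)).
Qed.

Let measurable_box_cons n (f : n.+1.-tuple R -> \bar R) : measurable_fun setT f ->
  (forall s, 0 <= f s)%E ->
  measurable_fun setT (fun t => box_avg (fun s : n.-tuple R => f [tuple of t :: s])).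
Proof.
move=> mf f0; have mc : measurable_fun setT (fun z : R * n.-tuple R => f [tuple of z.1 :: z.2]).
  by apply: (measurableT_comp mf); exact: measurable_cons.
exact: (measurable_box_avg mc (fun=> f0 _)).
Qed.

Let measurable_slice n (f : n.+1.-tuple R -> \bar R) (t : R) : measurable_fun setT f ->
  measurable_fun setT (fun s : n.-tuple R => f [tuple of t :: s]).
Proof. by move=> mf; apply: (measurableT_comp mf); exact: measurable_cons. Qed.

Lemma box_avg_le n (f g : n.-tuple R -> \bar R) :
  measurable_fun setT f -> measurable_fun setT g ->
  (forall s, 0 <= f s)%E -> (forall s, 0 <= g s)%E ->
  (forall s, (forall i, 0 <= tnth s i) -> (f s <= g s)%E) -> (box_avg f <= box_avg g)%E.
Proof.
elim: n f g => [|n IH] f g mf mg f0 g0 fg /=; first by apply: fg => -[].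
apply: unif_le; [exact: measurable_box_cons|exact: measurable_box_cons|..].
- by move=> t; apply: box_avg_ge0.
- by move=> t; apply: box_avg_ge0.
move=> t /andP[t0 _]; apply: IH => //; [exact: measurable_slice|exact: measurable_slice|].
move=> s s0; apply: fg => i; case: (unliftP ord0 i) => [j ->|->].
  by rewrite tnthS.
by rewrite tnth0.
Qed.

Lemma box_avg_cst n (c : R) : 0 <= c -> box_avg (fun _ : n.-tuple R => c%:E) = c%:E.
Proof.
move=> c0; elim: n => [//|n IH] /=; under eq_integral do rewrite IH.
by rewrite integral_cst// [X in (_ * X)%E]probability_setT mule1.
Qed.

Lemma box_avgD n (f g : n.-tuple R -> \bar R) :
  measurable_fun setT f -> measurable_fun setT g ->
  (forall s, 0 <= f s)%E -> (forall s, 0 <= g s)%E ->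
  (box_avg (fun s => f s + g s) = box_avg f + box_avg g)%E.
Proof.
elim: n f g => [//|n IH] f g mf mg f0 g0 /=.
rewrite -ge0_integralD//; [|by move=> *; apply: box_avg_ge0|exact: measurable_box_cons
  |by move=> *; apply: box_avg_ge0|exact: measurable_box_cons].
by apply: eq_integral => t _; rewrite IH//; exact: measurable_slice.
Qed.

Definition tuple_shift n (k : 'I_n -> R) (s : n.-tuple R) : n.-tuple R :=
  [tuple tnth s i + k i | i < n].

Lemma measurable_tuple_shift n d (T : measurableType d) (k : T -> 'I_n -> R) (s : T -> n.-tuple R) :
  (forall i, measurable_fun setT (fun x => k x i)) -> measurable_fun setT s ->
  measurable_fun setT (fun x => tuple_shift (k x) (s x)).
Proof.
move=> mk ms; apply/measurable_fun_tnthP => i.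
rewrite (_ : _ \o _ = fun x => tnth (s x) i + k x i); last first.
  by apply/funext => x /=; rewrite tnth_mktuple.
by apply: measurable_funD => //; exact: (measurableT_comp (measurable_tnth i)).
Qed.

Lemma box_avg_shift n (f : n.-tuple R -> \bar R) (k : 'I_n -> R) : measurable_fun setT f ->
  (forall s, 0 <= f s)%E -> (forall s, f s <= 1)%E ->
  (box_avg (fun s => f (tuple_shift k s)) <= box_avg f + (\sum_i `|k i| / L)%:E)%E.
Proof.
elim: n f k => [|n IH] f k mf f0 f1 /=.
  rewrite big_ord0 adde0 (_ : tuple_shift _ _ = [tuple])//.
  by apply: eq_from_tnth => -[].
have shiftE (t : R) (s : n.-tuple R) : tuple_shift k [tuple of t :: s] =
    [tuple of t + k ord0 :: tuple_shift (k \o lift ord0) s].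
  apply: eq_from_tnth => i; rewrite tnth_mktuple.
  by case: (unliftP ord0 i) => [j ->|->]; rewrite ?tnthS ?tnth0// tnth_mktuple.
pose h t := box_avg (fun s : n.-tuple R => f [tuple of t :: s]).
have mh : measurable_fun setT h by exact: measurable_box_cons.
have h0 t : (0 <= h t)%E by apply: box_avg_ge0.
have h1 t : (h t <= 1)%E.
  rewrite -(box_avg_cst n ler01); apply: box_avg_le => //.
  exact: measurable_slice.
have s0 : (0 <= (\sum_i `|k (lift ord0 i)| / L)%:E)%E.
  by rewrite lee_fin sumr_ge0// => i _; rewrite divr_ge0// ltW.
have mhk : measurable_fun setT (fun t : R => h (t + k ord0)).
  by apply: measurableT_comp => //; exact: measurable_funD.
rewrite big_ord_recl EFinD addeA.
apply: (@le_trans _ _ (\int[unif]_t (h (t + k ord0)%R + (\sum_i `|k (lift ord0 i)| / L)%:E)))%E.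
  apply: ge0_le_integral => //.
  - by move=> t _; apply: box_avg_ge0.
  - apply: (measurable_box_cons (f := fun s => f (tuple_shift k s))) => //.
    by apply: (measurableT_comp mf); exact: measurable_tuple_shift.
  - exact: emeasurable_funD.
  move=> t _; have := IH _ (k \o lift ord0) (measurable_slice (t + k ord0) mf) (fun=> f0 _) (fun=> f1 _).
  apply: le_trans; rewrite le_eqVlt; apply/orP; left; apply/eqP.
  by congr box_avg; apply/funext => s; rewrite shiftE.
rewrite ge0_integralD// integral_cst// [X in (_ * X)%E]probability_setT mule1.
by apply: leeD2r; exact: unif_shift.
Qed.

Lemma box_avg_fubini n d (T : measurableType d) (m : probability T R)
    (f : T * n.-tuple R -> \bar R) : measurable_fun setT f -> (forall z, 0 <= f z)%E ->
  (\int[m]_x box_avg (fun s => f (x, s)) = box_avg (fun s => \int[m]_x f (x, s)))%E.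
Proof.
elim: n f => [//|n IH] f mf f0 /=.
have mc := measurableT_comp mf (@measurable_cons_pair _ T n).
have mF := measurable_box_avg mc (fun=> f0 _).
have := @fubini_tonelli _ _ T R R m unif _ mF (fun=> box_avg_ge0 (fun=> f0 _)).
move=> /= ->; apply: eq_integral => t _.
rewrite -(IH (fun z => f (z.1, [tuple of t :: z.2])))//.
apply: (measurableT_comp mf); apply/measurable_fun_pairP; split => //.
  exact: measurable_fst.
exact: (measurable_cons (measurable_cst t) measurable_snd).
Qed.

End box_average.

(** * Fewer measurements than non-zero coefficients *)

Lemma measurable_invr (R : realType) : measurable_fun setT (fun x : R => x^-1).
Proof.
have o0 : open [set x : R | x != 0] by exact: open_neq.
rewrite (_ : setT = [set x : R | x != 0] `|` [set 0]); last first.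
  by apply/seteqP; split => // x _; have [->|] := eqVneq x 0; [right|left].
apply/measurable_funU => //; first exact: open_measurable.
split; last exact: measurable_fun_set1.
by apply: open_continuous_measurable_fun => // x /set_mem x0; exact: inv_continuous.
Qed.

Section shifted_signals.
Context (R : realType) (mu : probability R R) (d : measure_display)
  (Omega : measurableType d) (P : probability Omega R) (n p : nat).
Variables (X : 'I_n -> 'I_p -> {RV P >-> R}) (W : 'I_n -> {RV P >-> R}).
Variable g : decoder R n p.
Hypothesis mg : measurable_decoder g.
Variables (bmin : R) (B : {set 'I_p}) (c : nat -> 'I_p).
Hypothesis bmin_gt0 : 0 < bmin.
Hypothesis c_B : forall a, (a < n)%N -> c a \in B.

Local Notation MX := (measurement_matrix X).

(** The amounts [t] are added on top of [bmin], at indices of [B] only. Once an index is adjoined,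
    every nonnegative [t] therefore gives an admissible signal, however large the box. *)
Definition base_signal (t : n.-tuple R) : 'cV[R]_p :=
  \col_j ((if j \in B then bmin else 0) + \sum_(a < n) (if j == c a then tnth t a else 0)).

Definition ext_signal (i : 'I_p) (t : n.-tuple R) : 'cV[R]_p :=
  base_signal t + bmin *: delta_mx i 0.

Lemma ext_signal_valid i (t : n.-tuple R) : i \notin B -> (forall a, 0 <= tnth t a) ->
  supp (ext_signal i t) = (i |: B)%SET /\
  forall j, j \in (i |: B)%SET -> bmin <= `|ext_signal i t j 0|.
Proof.
move=> iB t0.
have sB j : j \notin B -> \sum_(a < n) (if j == c a then tnth t a else 0) = 0.
  by move=> jB; rewrite big1// => a _; case: eqP => // jc; rewrite jc c_B in jB.
have s0 j : 0 <= \sum_(a < n) (if j == c a then tnth t a else 0).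
  by apply: sumr_ge0 => a _; case: ifP.
have E j : ext_signal i t j 0 = (if j \in B then bmin else 0) +
    \sum_(a < n) (if j == c a then tnth t a else 0) + (if j == i then bmin else 0).
  by rewrite !mxE eqxx andbT; case: (j == i); rewrite ?mulr1 ?mulr0.
have ge j : j \in (i |: B)%SET -> bmin <= ext_signal i t j 0.
  rewrite !inE E => /orP[/eqP ->|jB].
    by rewrite eqxx (negbTE iB) sB// !add0r.
  rewrite jB -addrA lerDl addr_ge0//; case: ifP => // _; exact: ltW.
split; last by move=> j jiB; apply: (le_trans (ge j jiB)); exact: ler_norm.
apply/setP => j; rewrite [in LHS]inE; have [jiB|] := boolP (j \in (i |: B)%SET).
  by rewrite gt_eqF// (lt_le_trans bmin_gt0)// ge.
by rewrite !inE negb_or => /andP[ji jB]; rewrite E (negbTE jB) (negbTE ji) sB// !addr0 eqxx.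
Qed.

Let A w : 'M[R]_n := \matrix_(a, b < n) X a (c b) w.

(** Cramer's rule for the coefficients of [bmin] times column [i] in the columns [c a]. At a
    singular matrix the inverse of 0 is 0; such points are kept outside the event [G] below. *)
Definition offset i w (a : 'I_n) : R :=
  bmin * (\det (A w))^-1 * \sum_b \adj (A w) a b * X b i w.

Let mX a b : measurable_fun setT (X a b). Proof. exact: measurable_funPT. Qed.

Let mA a b : measurable_fun setT (fun w => A w a b).
Proof. by under eq_fun do rewrite mxE; exact: mX. Qed.

Let measurable_offset i a : measurable_fun setT (fun w => offset i w a).
Proof.
apply: measurable_funM.
  apply: measurable_funM => //; apply: (measurableT_comp (@measurable_invr R)).
  exact: measurable_det.
apply: measurable_sum => b; apply: measurable_funM => //.
under eq_fun do rewrite mxE; apply: measurable_funM => //; apply: measurable_det => a' b'.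
by under eq_fun do rewrite !mxE; exact: mX.
Qed.

Let mul_base w t l :
  (MX w *m base_signal t) l 0 = \sum_(j in B) X l j w * bmin + \sum_(a < n) X l (c a) w * tnth t a.
Proof.
rewrite mxE (eq_bigr (fun j => X l j w * (if j \in B then bmin else 0) +
    \sum_(a < n) (if j == c a then X l j w * tnth t a else 0))) => [|j _]; last first.
  rewrite !mxE mulrDr mulr_sumr; congr (_ + _); apply: eq_bigr => a _.
  by case: eqP => // _; rewrite mulr0.
rewrite big_split/= [in RHS]big_mkcond/= exchange_big/=; congr (_ + _).
  by apply: eq_bigr => j _; case: ifP => // _; rewrite mulr0.
apply: eq_bigr => a _; rewrite (bigD1 (c a))//= eqxx big1 ?addr0// => j jc.
by rewrite (negbTE jc).
Qed.

Lemma observation_offset i w t : \det (A w) != 0 ->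
  MX w *m ext_signal i t = MX w *m base_signal (tuple_shift (offset i w) t).
Proof.
move=> dA; apply/colP => l.
have -> : (MX w *m ext_signal i t) l 0 = (MX w *m base_signal t) l 0 + bmin * X l i w.
  rewrite /ext_signal mulmxDr -scalemxAr -colE.
  by rewrite mxE; congr (_ + _); rewrite !mxE.
rewrite !mul_base -addrA; congr (_ + _).
under [RHS]eq_bigr do rewrite tnth_mktuple mulrDr; rewrite big_split/=; congr (_ + _).
have : (A w *m \adj (A w) *m col i (MX w)) l 0 = \det (A w) * X l i w.
  by rewrite mul_mx_adj mul_scalar_mx !mxE.
rewrite -mulmxA mxE => H.
rewrite /offset; under eq_bigr do rewrite mulrCA.
have -> : bmin * X l i w = bmin / \det (A w) * (\det (A w) * X l i w).
  by rewrite -[RHS]mulrA mulKf.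
rewrite -H mulr_sumr; apply: eq_bigr => a _; congr (_ * _).
rewrite !mxE; congr (_ * _); apply: eq_bigr => b _; rewrite !mxE//.
Qed.

Let noisy_base (z : Omega * n.-tuple R) : obs_space R n p :=
  (MX z.1 *m base_signal z.2 + \col_l W l z.1, MX z.1).

Let measurable_noisy_base : measurable_fun setT noisy_base.
Proof.
have mX1 l j : measurable_fun setT (fun z : Omega * n.-tuple R => X l j z.1).
  exact: (measurableT_comp (mX l j) measurable_fst).
apply: measurable_to_obs => l /=.
  rewrite (_ : (fun z => _) = fun z : Omega * n.-tuple R => \sum_(j in B) X l j z.1 * bmin +
      \sum_(a < n) X l (c a) z.1 * tnth z.2 a + W l z.1); last first.
    by apply/funext => z; rewrite mxE mul_base !mxE.
  apply: measurable_funD; last by apply: (measurableT_comp _ measurable_fst); exact: measurable_funPT.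
  apply: measurable_funD.
    under eq_fun do rewrite big_mkcond/=; apply: measurable_sum => j.
    by case: (boolP (j \in B)) => _; [exact: measurable_funM|exact: measurable_cst].
  apply: measurable_sum => a; apply: measurable_funM => //.
  exact: (measurableT_comp (measurable_tnth a) measurable_snd).
by move=> j; under eq_fun do rewrite mxE; exact: mX1.
Qed.

Section common_event.
Variables (G : set Omega) (rad L : R) (L0 : 0 < L).
Hypotheses (mG : measurable G) (rad0 : 0 <= rad).

Let avg := @box_avg R L L0 n.

(** Success measured on the observation of [base_signal], in which no index has been adjoined: under
    this common law the different supports compete. *)
Let hit S (z : Omega * n.-tuple R) : \bar R := (\1_G z.1 * \1_(decides g S) (noisy_base z))%:E.

Let hit_ge0 S z : (0 <= hit S z)%E. Proof. by rewrite lee_fin mulr_ge0. Qed.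

Let measurable_hit S : measurable_fun setT (hit S).
Proof.
have mD := measurable_decides mg S.
apply/measurable_EFinP; apply: measurable_funM.
  exact: (measurableT_comp (measurable_indic mG) measurable_fst).
exact: (measurableT_comp (measurable_indic mD) measurable_noisy_base).
Qed.

(** For each signal in the box, the success within [G] is at least [P G - e]. Fubini brings the box
    average inside, for fixed [w], where the adjoined column is a translation by [offset]; undoing
    it costs at most [n rad / L]. *)
Let avg_success i e : (forall w, G w -> \det (A w) != 0 /\ forall a, `|offset i w a| <= rad) ->
  (forall t : n.-tuple R, (forall a, 0 <= tnth t a) -> error X W g (i |: B)%SET (ext_signal i t) <= e) ->
  ((fine (P G) - e)%:E <= \int[P]_w (avg (fun s => hit (i |: B)%SET (w, s)) +
    (\1_G w * (n%:R * (rad / L)))%:E))%E.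
Proof.
move=> HG He; set S := (i |: B)%SET.
pose hs (z : Omega * n.-tuple R) := hit S (z.1, tuple_shift (offset i z.1) z.2).
have mhs : measurable_fun setT hs.
  apply: (measurableT_comp (@measurable_hit S)); apply/measurable_fun_pairP; split => /=.
    exact: measurable_fst.
  apply: measurable_tuple_shift => //.
  by move=> a; exact: (measurableT_comp (@measurable_offset i a) measurable_fst).
have hs0 z : (0 <= hs z)%E by exact: hit_ge0.
have ihs0 s : (0 <= \int[P]_w hs (w, s))%E by apply: integral_ge0.
apply: (@le_trans _ _ (\int[P]_w avg (fun s => hs (w, s)))%E).
  rewrite /avg box_avg_fubini//.
  (* [box_avg_cst] takes a nonnegative constant, so a nonpositive lower bound is treated apart. *)
  have [e1|e1] := leP (fine (P G) - e) 0.
    by apply: (@le_trans _ _ 0%E); [rewrite lee_fin|exact: box_avg_ge0].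
  rewrite -(box_avg_cst L0 n (ltW e1)); apply: box_avg_le => //.
  - by apply: (@measurable_fun_fubini_tonelli_G _ _ Omega (n.-tuple R) R P hs).
  - by move=> s; exact: ltW.
  move=> s s0; have := He s s0; rewrite -/S => Hs.
  have mE : measurable [set w | decides g S (MX w *m ext_signal i s + 1 *: \col_l W l w, MX w)].
    exact: (measurable_noisy_event X W (ext_signal i s) 1 (measurable_decides mg S)).
  have -> : (\int[P]_w hs (w, s) = \int[P]_w (\1_(G `&`
      [set w | decides g S (MX w *m ext_signal i s + 1 *: \col_l W l w, MX w)]) w)%:E)%E.
    apply: eq_integral => w _; rewrite /hs /hit indicI /=; congr EFin.
    have [Gw|Gw] := pselect (G w); last by rewrite indicE memNset// !mul0r.
    have [dA _] := HG w Gw; congr (_ * _).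
    rewrite [LHS]indicE [RHS]indicE; congr (nat_of_bool _)%:R.
    rewrite /noisy_base/= -observation_offset//.
    by apply/idP/idP; rewrite !inE/= scale1r.
  rewrite integral_indic ?setIT//; last exact: measurableI.
  rewrite -[leRHS]fineK ?fin_num_measure//; last exact: measurableI.
  rewrite lee_fin lerBlDr; apply: le_trans (lerD (lexx _) Hs).
  have sE := successE X W mg S (ext_signal i s).
  have -> : error X W g S (ext_signal i s) = 1 - (1 - error X W g S (ext_signal i s)) by ring.
  rewrite -sE -fine_probC//.
  apply: le_trans (fine_probD P (measurableI _ _ mG mE) (measurableC mE)).
  apply: fine_prob_le => //; first by apply: measurableU; [exact: measurableI|exact: measurableC].
  by move=> w Gw; have [Ew|Ew] := pselect ([set w | decides g S (MX w *m ext_signal i s + 1 *: \col_l W l w, MX w)] w); [left|right].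
apply: ge0_le_integral => //.
- by move=> w _; exact: box_avg_ge0.
- exact: measurable_box_avg.
- apply: emeasurable_funD; first exact: measurable_box_avg.
  by apply/measurable_EFinP; apply: measurable_funM => //; exact: measurable_indic.
move=> w _; have [Gw|Gw] := pselect (G w); last first.
  rewrite (_ : (fun s => hs (w, s)) = fun=> 0%:E); last first.
    by apply/funext => s; rewrite /hs /hit/= indicE memNset// mul0r.
  rewrite /avg box_avg_cst// adde_ge0 ?box_avg_ge0// lee_fin.
  by rewrite !mulr_ge0// ?invr_ge0 ltW.
have [_ off] := HG w Gw.
have mh : measurable_fun setT (fun s => hit S (w, s)).
  exact: (measurableT_comp (@measurable_hit S) (measurable_pair1 w)).
have h1 s : (hit S (w, s) <= 1)%E.
  by rewrite lee_fin mulr_ile1// indicE lern1 leq_b1.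
apply: (le_trans (box_avg_shift L0 (offset i w) mh (fun=> hit_ge0 _ _) h1)).
apply: leeD2l; rewrite lee_fin indicE mem_set// mul1r.
rewrite mulr_natl -[X in _ *+ X](card_ord n) -sumr_const; apply: ler_sum => a _.
by apply: ler_wpM2r; [rewrite invr_ge0 ltW|exact: off].
Qed.

(** On a common base observation the two answers exclude each other, so the averaged successes for
    [i] and [j] share the mass of [G]. *)
Lemma confusable_on i j ei ej : i != j -> i \notin B -> j \notin B ->
  (forall w, G w -> [/\ \det (A w) != 0, forall a, `|offset i w a| <= rad &
    forall a, `|offset j w a| <= rad]) ->
  (forall t : n.-tuple R, (forall a, 0 <= tnth t a) -> error X W g (i |: B)%SET (ext_signal i t) <= ei) ->
  (forall t : n.-tuple R, (forall a, 0 <= tnth t a) -> error X W g (j |: B)%SET (ext_signal j t) <= ej) ->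
  fine (P G) * (1 - 2 * (n%:R * (rad / L))) <= ei + ej.
Proof.
move=> ij iB jB HG Hi Hj.
have HGi w : G w -> \det (A w) != 0 /\ forall a, `|offset i w a| <= rad by move=> /HG[].
have HGj w : G w -> \det (A w) != 0 /\ forall a, `|offset j w a| <= rad by move=> /HG[].
have Si := avg_success HGi Hi; have Sj := avg_success HGj Hj.
set k := n%:R * (rad / L) in Si Sj *.
have k0 : 0 <= k by rewrite /k !mulr_ge0// invr_ge0 ltW.
have mi : measurable_fun setT (fun w => (\1_G w * k)%:E).
  by apply/measurable_EFinP; apply: measurable_funM => //; exact: measurable_indic.
have mavg S : measurable_fun setT (fun w => avg (fun s => hit S (w, s)))%E.
  exact: measurable_box_avg.
have i0 w : (0 <= (\1_G w * k)%:E)%E by rewrite lee_fin mulr_ge0.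
have avg0 S w : (0 <= avg (fun s => hit S (w, s)))%E by exact: box_avg_ge0.
have mh S w : measurable_fun setT (fun s => hit S (w, s)).
  exact: (measurableT_comp (@measurable_hit S) (measurable_pair1 w)).
have Sij : (i |: B)%SET != (j |: B)%SET.
  apply/negP => /eqP/setP/(_ i); rewrite !inE eqxx/= (negbTE ij) (negbTE iB).
  by [].
have := leeD Si Sj; rewrite -ge0_integralD//; last 4 first.
- by move=> w _; rewrite adde_ge0.
- exact: emeasurable_funD.
- by move=> w _; rewrite adde_ge0.
- exact: emeasurable_funD.
have L1 : (\int[P]_w ((avg (fun s => hit (i |: B)%SET (w, s)) + (\1_G w * k)%:E) +
    (avg (fun s => hit (j |: B)%SET (w, s)) + (\1_G w * k)%:E)) <=
    \int[P]_w ((1 + 2 * k) * \1_G w)%:E)%E.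
  apply: ge0_le_integral => //.
  - by move=> w _; rewrite !adde_ge0.
  - by apply: emeasurable_funD; exact: emeasurable_funD.
  - by apply/measurable_EFinP; apply: measurable_funM => //; exact: measurable_indic.
  move=> w _; rewrite addeACA -box_avgD//.
  have -> : ((1 + 2 * k) * \1_G w)%:E = ((\1_G w)%:E + ((\1_G w * k)%:E + (\1_G w * k)%:E))%E.
    by rewrite -!EFinD; congr EFin; ring.
  have G0 : 0 <= \1_G w :> R by [].
  apply: leeD2r; rewrite -(box_avg_cst L0 n G0).
  apply: box_avg_le => //; [exact: emeasurable_funD|by move=> s; rewrite adde_ge0|].
  move=> s _; rewrite /hit -EFinD lee_fin -mulrDr ler_piMr//= !indicE.
  case: (boolP (noisy_base (w, s) \in decides g (i |: B)%SET)) => [/set_mem H1|_].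
    rewrite memNset ?addr0// => H2; move: Sij; rewrite -H1 -H2 eqxx.
    by [].
  by rewrite add0r; case: (_ \in _).
move=> /le_trans/(_ L1).
have iG : rintegrable P (\1_G) by exact: rintegrable_indic.
rewrite ERintegralE; last exact: rintegrableZ.
rewrite ERintegralZ// ERintegral_indic// -EFinD lee_fin.
set x := fine _; nra.
Qed.

End common_event.

(** The offsets have no uniform bound, but some level [m] keeps at least [delta / 2] of the event of
    non-zero determinant. The box is chosen afterwards, with side [4 n m + 1], so that the
    translations cost at most half; the signal class puts no upper bound on the coefficients. *)
Lemma confusable (delta ei ej : R) i j : i != j -> i \notin B -> j \notin B ->
  0 < delta -> delta <= fine (P [set w | \det (\matrix_(a, b < n) X a (c b) w) != 0]) ->
  (forall t : n.-tuple R, (forall a, 0 <= tnth t a) -> error X W g (i |: B)%SET (ext_signal i t) <= ei) ->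
  (forall t : n.-tuple R, (forall a, 0 <= tnth t a) -> error X W g (j |: B)%SET (ext_signal j t) <= ej) ->
  delta / 4 <= ei + ej.
Proof.
move=> ij iB jB delta0 Pdet Hi Hj.
pose N w := \sum_a (`|offset i w a| + `|offset j w a|).
have mN : measurable_fun setT N.
  by apply: measurable_sum => a; apply: measurable_funD; apply: measurableT_comp.
pose G (m : nat) := [set w | \det (A w) != 0 /\ N w <= m%:R].
have mdet : measurable [set w | \det (A w) != 0].
  by apply: measurable_nonzero; exact: measurable_det.
have mNle m : measurable [set w | N w <= m%:R].
  by rewrite -[X in measurable X]setTI; apply: measurable_fun_le.
have mG m : measurable (G m) by exact: (measurableI _ _ mdet (mNle m)).
have [m Gm] : exists m, delta / 2 <= fine (P (G m)).
  apply: contrapT => /forallNP H.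
  have Gle m : (P (G m) <= (delta / 2)%:E)%E.
    rewrite -[leLHS]fineK ?fin_num_measure// lee_fin ltW// ltNge.
    by apply/negP; exact: H.
  have ndG : nondecreasing_seq G.
    move=> m1 m2 m12; apply/subsetPset => w [dw Nw]; split => //.
    by apply: (le_trans Nw); rewrite ler_nat.
  have UG : \bigcup_m G m = [set w | \det (A w) != 0].
    apply/seteqP; split => [w [m _ []]//|w dw].
    exists (Num.truncn (N w)).+1 => //; split => //.
    by apply: ltW; exact: truncnS_gt.
  have := nondecreasing_cvg_mu (mu := P) mG _ ndG; rewrite UG => /(_ mdet) cvgG.
  have : (P [set w | \det (A w) != 0%R] <= (delta / 2)%:E)%E.
    rewrite -(cvg_lim _ cvgG)//; apply: lime_le; first by apply/cvg_ex; exists (P [set w | \det (A w) != 0]).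
    by apply: nearW => m; exact: Gle.
  rewrite -[leLHS]fineK ?fin_num_measure// lee_fin; move: Pdet; rewrite -/A.
  by set x := fine _; lra.
have n0 : 0 <= n%:R :> R by [].
have m0 : 0 <= m%:R :> R by [].
pose L : R := 4 * (n%:R * m%:R) + 1.
have nm0 := mulr_ge0 n0 m0.
have L0 : 0 < L by rewrite /L; lra.
have HG w : G m w -> [/\ \det (A w) != 0, forall a, `|offset i w a| <= m%:R &
    forall a, `|offset j w a| <= m%:R].
  move=> [dw Nw].
  have le a : `|offset i w a| + `|offset j w a| <= m%:R.
    apply: le_trans Nw; rewrite /N (bigD1 a)//= lerDl; apply: sumr_ge0 => b _.
    exact: addr_ge0.
  by split => // a; apply: le_trans (le a); rewrite ?lerDl ?lerDr.
have := confusable_on L0 (mG m) m0 ij iB jB HG Hi Hj.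
apply: le_trans.
have x0 : 0 <= 2 * (n%:R * (m%:R / L)) by rewrite !mulr_ge0// invr_ge0 ltW.
have x1 : 2 * (n%:R * (m%:R / L)) <= 2^-1.
  rewrite [n%:R * _]mulrA [2 * _]mulrA ler_pdivrMr// /L; lra.
move: Gm x1; set x := fine _; set y := 2 * _ => Gm y1.
nra.
Qed.

End shifted_signals.

(** * Error floor *)

(** Summing over the partners of each index counts every pair twice; division by [2 (#|D| - 1)]
    leaves [c / 2] per element. *)
Lemma sum_pairs_ge (R : realFieldType) (I : finType) (D : {set I}) (F : I -> R) (c : R) :
  (2 <= #|D|)%N -> {in D &, forall i j, i != j -> c <= F i + F j} ->
  #|D|%:R * (c / 2) <= \sum_(i in D) F i.
Proof.
move=> D2 Fc; set S := \sum_(i in D) F i.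
have row i : i \in D -> (#|D|%:R - 1) * c <= (#|D|%:R - 1) * F i + (S - F i).
  move=> iD; have -> : S - F i = \sum_(j in D | j != i) F j.
    by rewrite /S [in LHS](bigD1 i)//= addrAC subrr add0r.
  have cD : \sum_(j in D | j != i) (1 : R) = #|D|%:R - 1.
    by rewrite -sum1_card [in RHS](bigD1 i)//= natrD addrAC subrr add0r natr_sum.
  rewrite -cD !mulr_suml -big_split/=; apply: ler_sum => j /andP[jD ji].
  by rewrite !mul1r; apply: Fc => //; rewrite eq_sym.
have : \sum_(i in D) ((#|D|%:R - 1) * c) <= \sum_(i in D) ((#|D|%:R - 1) * F i + (S - F i)).
  exact: ler_sum.
have -> : \sum_(i in D) ((#|D|%:R - 1) * c) = #|D|%:R * ((#|D|%:R - 1) * c).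
  by rewrite sumr_const mulr_natl.
have -> : \sum_(i in D) ((#|D|%:R - 1) * F i + (S - F i)) = (#|D|%:R - 1) * S + (#|D|%:R * S - S).
  by rewrite big_split/= sumrB -mulr_sumr sumr_const mulr_natl.
have M2 : 2 <= #|D|%:R :> R by rewrite (ler_nat _ 2).
set M : R := #|D|%:R in M2 * => H.
have : 2 * (M - 1) * (M * (c / 2)) <= 2 * (M - 1) * S by lra.
by rewrite ler_pM2l//; lra.
Qed.

(** Double counting: a support of size [k] arises from [k] sets [B], and
    [k C(p, k) = (p - k + 1) C(p, k - 1)] matches the normalizations. *)
Lemma sum_supersets_ge (R : realFieldType) p k (F : {set 'I_p} -> R) (delta : R) :
  (0 < k)%N ->
  (forall B : {set 'I_p}, #|B| = k.-1 ->
     (p - k.-1)%:R * delta <= \sum_(i in ~: B) F (i |: B)%SET) ->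
  'C(p, k)%:R * delta <= \sum_(S : {set 'I_p} | #|S| == k) F S.
Proof.
case: k => // k _ /= FB.
have E : \sum_(B : {set 'I_p} | #|B| == k) \sum_(i in ~: B) F (i |: B)%SET =
    k.+1%:R * \sum_(S : {set 'I_p} | #|S| == k.+1) F S.
  rewrite (exchange_big_dep xpredT)//= mulr_sumr.
  transitivity (\sum_(i : 'I_p) \sum_(S : {set 'I_p} | (#|S| == k.+1) && (i \in S)) F S).
    apply: eq_bigr => i _; rewrite [RHS](reindex_onto (fun B => i |: B)%SET (fun S => S :\ i)%SET) /=; last first.
      by move=> S /andP[_ iS]; rewrite finset.setD1K.
    apply: eq_bigl => B; rewrite finset.setU11 andbT inE cardsU1.
    have [iB|iB] := boolP (i \in B); rewrite ?andbF ?andbT /=.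
      by apply/esym/negP => /andP[_ /eqP H]; move: iB; rewrite -H !inE eqxx.
    by rewrite finset.setU1K// eqxx andbT add1n eqSS.
  rewrite (exchange_big_dep (fun S : {set 'I_p} => #|S| == k.+1))/=; last by move=> i S _ /andP[].
  apply: eq_bigr => S /eqP Sk; under eq_bigl do rewrite Sk eqxx/=.
  by rewrite sumr_const Sk mulr_natl.
have : \sum_(B : {set 'I_p} | #|B| == k) ((p - k)%:R * delta) <=
    \sum_(B : {set 'I_p} | #|B| == k) \sum_(i in ~: B) F (i |: B)%SET.
  by apply: ler_sum => B /eqP; exact: FB.
have cD : #|[pred B : {set 'I_p} | #|B| == k]| = 'C(p, k).
  by have := card_draws 'I_p k; rewrite card_ord => <-; apply: eq_card => B; rewrite !inE.
rewrite E sumr_const cD -[X in X <= _ -> _]mulr_natl mulrA -natrM mulnC -mul_bin_left natrM -mulrA.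
by rewrite ler_pM2l ?ltr0n.
Qed.

Section worst_case.
Context (R : realType) (mu : probability R R) (d : measure_display)
  (Omega : measurableType d) (P : probability Omega R) (n p k : nat).
Variables (X : 'I_n -> 'I_p -> {RV P >-> R}) (W : 'I_n -> {RV P >-> R}).
Hypothesis model : measurement_model mu X W.
Variable g : decoder R n p.
Hypothesis mg : measurable_decoder g.
Variable bmin : R.
Hypothesis bmin_gt0 : 0 < bmin.

Definition valid_signals (S : {set 'I_p}) : set 'cV[R]_p :=
  [set b | signal_class k bmin b /\ supp b = S].

(** The signal of each support is chosen separately, so the supremum of the average error is the
    average of these suprema. Arguments that vary the signal within a support reduce to one number
    per support. *)
Definition worst_error (S : {set 'I_p}) : R :=
  sup [set error X W g S b | b in valid_signals S].

Lemma error_le_worst S b : valid_signals S b -> error X W g S b <= worst_error S.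
Proof.
move=> vb; apply: ub_le_sup; last by exists b.
by exists 1 => _ [b' _ <-]; exact: error_le1.
Qed.

Definition flat_signal (S : {set 'I_p}) : 'cV[R]_p := \col_j (if j \in S then bmin else 0).

Lemma flat_signal_valid (S : {set 'I_p}) : #|S| = k -> valid_signals S (flat_signal S).
Proof.
move=> Sk; have sS : supp (flat_signal S) = S.
  apply/setP => j; rewrite !inE mxE; case: (j \in S); last by rewrite eqxx.
  by rewrite gt_eqF.
split => //; split; rewrite sS// => j jS.
by rewrite mxE jS ger0_norm// ltW.
Qed.

(** The supremum need not be attained; settling for half of it costs a factor 2 in the end. *)
Lemma worst_error_half (S : {set 'I_p}) : #|S| = k ->
  exists b, valid_signals S b /\ worst_error S / 2 <= error X W g S b.
Proof.
move=> Sk; have vS := flat_signal_valid Sk.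
have [e0|e0] := leP (worst_error S) 0.
  by exists (flat_signal S); split => //; apply: le_trans (error_ge0 X W g S _); lra.
have hs : has_sup [set error X W g S b | b in valid_signals S].
  split; first by exists (error X W g S (flat_signal S)), (flat_signal S).
  by exists 1 => _ [b' _ <-]; exact: error_le1.
have e2 : 0 < worst_error S / 2 by rewrite divr_gt0.
have [_ [b vb <-] lt] := sup_adherent e2 hs; exists b; split => //.
move: lt; rewrite -/(worst_error S); lra.
Qed.

Lemma flat_signal_dist (S : {set 'I_p}) (x y : R) :
  \sum_j ((flat_signal S - \col_j (if j \in S then x else y)) j 0) ^+ 2 =
  #|S|%:R * (bmin - x) ^+ 2 + (p - #|S|)%:R * y ^+ 2.
Proof.
rewrite (bigID (fun j => j \in S))/=; congr (_ + _).
  rewrite (eq_bigr (fun=> (bmin - x) ^+ 2)) => [|j jS]; last by rewrite !mxE jS.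
  by rewrite sumr_const mulr_natl.
rewrite (eq_bigr (fun=> y ^+ 2)) => [|j jS]; last by rewrite !mxE (negbTE jS) sub0r sqrrN.
have -> : (p - #|S|)%N = #|~: S|%SET by rewrite [in RHS]cardsCs finset.setCK card_ord.
rewrite sumr_const mulr_natl; congr (_ *+ _).
by apply: eq_card => j; rewrite !inE.
Qed.

Hypotheses (mu_mean : ('E_mu[idfun] = 0)%E) (mu_variance : ('V_mu[idfun] = 1)%E).
Hypotheses (k_gt0 : (1 <= k)%N) (k_lt_p : (k < p)%N).

Local Notation worst := worst_error.
Local Notation tail := (@tail_prob R).

Definition tail_size : R := 10 * (16 * tail_const R * (4 / tail)) ^+ 2.

Lemma tail_size_gt0 : 0 < tail_size.
Proof.
have t0 := @tail_prob_gt0 R; have k0 : 0 < tail_const R by rewrite exprn_gt0.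
apply: mulr_gt0; first by [].
apply: exprn_gt0; apply: mulr_gt0; last by rewrite divr_gt0.
by apply: mulr_gt0.
Qed.

Lemma sum_worst_single_swap (delta : R) :
  (forall (B : {set 'I_p}) i j, #|B| = k.-1 -> i != j -> i \notin B -> j \notin B ->
    2 * delta <= worst (i |: B)%SET + worst (j |: B)%SET) ->
  'C(p, k)%:R * delta <= \sum_(S : {set 'I_p} | #|S| == k) worst S.
Proof.
move=> H; apply: sum_supersets_ge => // B Bk.
have cB : #|~: B|%SET = (p - k.-1)%N by rewrite cardsCs finset.setCK card_ord Bk.
have c2 : (2 <= #|~: B|%SET)%N by rewrite cB; lia.
rewrite -cB; have := @sum_pairs_ge R _ (~: B)%SET (fun i => worst (i |: B)%SET) (2 * delta) c2.
rewrite (_ : 2 * delta / 2 = delta); last by field.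
by apply => i j; rewrite !inE => iB jB ij; exact: H.
Qed.

Let card_ext (B : {set 'I_p}) i : #|B| = k.-1 -> i \notin B -> #|(i |: B)%SET| = k.
Proof. by move=> Bk iB; rewrite cardsU1 iB Bk add1n prednK. Qed.

(** Flat signals on supports that differ by a swap are at squared distance [2 bmin^2]. Either the
    first error exceeds 1/4, or [two_point] bounds the second from below; each case gives a sum of
    at least a quarter of the exponential, hence the 8 for the average. *)
Lemma weak_signal (q : R) : n%:R * bmin ^+ 2 <= q ->
  'C(p, k)%:R * (expR (- (4 * (1 + 2 * q))) / 8) <=
    \sum_(S : {set 'I_p} | #|S| == k) worst S.
Proof.
move=> nq; have q0 : 0 <= q by apply: le_trans nq; rewrite mulr_ge0 ?sqr_ge0.
apply: sum_worst_single_swap => B i j Bk ij iB jB.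
have [vi vj] := (flat_signal_valid (card_ext Bk iB), flat_signal_valid (card_ext Bk jB)).
have Sij : (i |: B)%SET != (j |: B)%SET.
  apply/negP => /eqP/setP/(_ i); rewrite !inE eqxx/= (negbTE ij) (negbTE iB).
  by [].
have dist : n%:R * \sum_l ((flat_signal (i |: B)%SET - flat_signal (j |: B)%SET) l 0) ^+ 2 <= 2 * q.
  rewrite (bigD1 i)//= (bigD1 j) 1?eq_sym//= big1 ?addr0 => [|l /andP[li lj]]; last first.
    by rewrite !mxE !inE (negbTE li) (negbTE lj) subrr expr0n.
  rewrite !mxE !inE !eqxx (negbTE ij) eq_sym (negbTE ij) (negbTE iB) (negbTE jB)/=.
  by rewrite subr0 sub0r sqrrN; lra.
set c := expR _.
have c1 : c <= 1 by rewrite /c -[leRHS]expR0 ler_expR; lra.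
have [small|big] := leP (error X W g (i |: B)%SET (flat_signal (i |: B)%SET)) 4^-1.
  have := two_point model mu_mean mu_variance mg Sij dist small; rewrite -/c => H.
  have := error_le_worst vj; have := error_le_worst vi.
  by have := error_ge0 X W g (i |: B)%SET (flat_signal (i |: B)%SET); lra.
have := error_le_worst vj; have := error_le_worst vi.
by have := error_ge0 X W g (j |: B)%SET (flat_signal (j |: B)%SET); lra.
Qed.

Section strong_signal.
Hypothesis n_large : 2 * tail_size <= n%:R.
Hypothesis bmin_large : 4 * tail_size <= n%:R * bmin ^+ 2.

(** Since [r >= bmin^2 / 2], the two largeness hypotheses give [tail_size (1 + 1 / r) <= n], with
    half of [n] for each summand. *)
Let strong (D : pred {set 'I_p}) m (r : R) : bmin ^+ 2 / 2 <= r ->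
  (forall S, D S -> #|S| = k) ->
  (forall S, D S -> \sum_j ((flat_signal S - m) j 0) ^+ 2 = r) ->
  (0 < #|D|)%N -> n%:R / 2 * ln (1 + r) <= ln #|D|%:R ->
  #|D|%:R * (tail / 2) <= \sum_(S | D S) worst S.
Proof.
move=> br Dk Dr D0 nr; have b2 : 0 < bmin ^+ 2 by exact: exprn_gt0.
have r0 : 0 < r by lra.
have rE : r = Num.sqrt r ^+ 2 by rewrite sqr_sqrtr// ltW.
apply: (@le_trans _ _ (\sum_(S | D S) error X W g S (flat_signal S))); last first.
  by apply: ler_sum => S DS; apply: error_le_worst; apply: flat_signal_valid; exact: Dk.
apply: (strong_converse model mu_mean mu_variance mg (m := m) (sigma := Num.sqrt r)) => //.
- by rewrite sqrtr_gt0.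
- by move=> S DS; rewrite -rE; exact: Dr.
- rewrite -/tail_size exprVn -rE mulrDr mulr1.
  have t0 := tail_size_gt0.
  have : tail_size / r <= n%:R / 2.
    rewrite ler_pdivrMr//; apply: (@le_trans _ _ (n%:R / 2 * (bmin ^+ 2 / 2))).
      by have := bmin_large; lra.
    by apply: ler_wpM2l => //; rewrite divr_ge0.
  by have := n_large; lra.
- by rewrite -rE.
Qed.

Let log_condition (M r : R) : 0 < r -> 0 < M ->
  n%:R <= (log2 M - 1) / (2^-1 * log2 (1 + r)) -> n%:R / 2 * ln (1 + r) <= ln M.
Proof.
move=> r0 M0; have l2 : 0 < ln (2 : R) by rewrite ln_gt0// ltr1n.
have lr : 0 < ln (1 + r) by rewrite ln_gt0//; lra.
have den : 0 < 2^-1 * log2 (1 + r) by rewrite mulr_gt0 ?invr_gt0// divr_gt0.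
rewrite ler_pdivlMr// /log2 => H.
have : n%:R * (2^-1 * (ln (1 + r) / ln 2)) * ln 2 <= (ln M / ln 2 - 1) * ln 2 by rewrite ler_pM2r.
have -> : n%:R * (2^-1 * (ln (1 + r) / ln 2)) * ln 2 = n%:R / 2 * ln (1 + r) by field; rewrite gt_eqF.
have -> : (ln M / ln 2 - 1) * ln 2 = ln M - ln 2 by field; rewrite gt_eqF.
lra.
Qed.

Let p_gt0 : 0 < p%:R :> R. Proof. by rewrite ltr0n; lia. Qed.

(** The centre is the mean of all flat signals, and each of them is at squared distance
    [k bmin^2 (1 - k / p)]. This is at least [bmin^2 / 2] because [k (p - k) >= p - 1 >= p / 2]. *)
Lemma strong_signal_f1 : n%:R <= f1 p k bmin ->
  'C(p, k)%:R * (tail / 2) <= \sum_(S : {set 'I_p} | #|S| == k) worst S.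
Proof.
move=> nf; set r := k%:R * bmin ^+ 2 * (1 - k%:R / p%:R).
have b2 : 0 < bmin ^+ 2 by exact: exprn_gt0.
have p0 := p_gt0; have kp : k%:R + 1 <= p%:R :> R by rewrite -(natrD _ k 1) ler_nat addn1.
have k1 : 1 <= k%:R :> R by rewrite ler1n.
have br : bmin ^+ 2 / 2 <= r.
  rewrite (_ : r = bmin ^+ 2 * (k%:R * (p%:R - k%:R) / p%:R)); last first.
    by rewrite /r; field; rewrite gt_eqF.
  apply: ler_wpM2l; first exact: ltW.
  rewrite ler_pdivlMr// mulrC ler_pdivrMr//; nra.
pose D : pred {set 'I_p} := fun S => #|S| == k.
have cD : #|D| = 'C(p, k).
  by have := card_draws 'I_p k; rewrite card_ord => <-; apply: eq_card => B; rewrite !inE.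
have := strong (D := D) (m := \col_j (bmin * (k%:R / p%:R))) br.
rewrite cD; apply.
- by move=> S /eqP.
- move=> S /eqP Sk; have := flat_signal_dist S (bmin * (k%:R / p%:R)) (bmin * (k%:R / p%:R)).
  rewrite (_ : \col_j (if j \in S then _ else _) = \col_j (bmin * (k%:R / p%:R))); last first.
    by apply/colP => j; rewrite !mxE; case: ifP.
  by move=> ->; rewrite Sk natrB ?(ltnW k_lt_p)// /r; field; rewrite gt_eqF.
- by rewrite bin_gt0 ltnW.
- apply: log_condition => //; [by lra|by rewrite ltr0n bin_gt0 ltnW].
Qed.

(** Corresponds to revealing [k - 1] indices, with [M = p - k + 1] candidates left for the last one.
    For fixed [B] the centre is the mean of the flat signals on the sets [i |: B], at squared
    distance [bmin^2 (1 - 1 / M)]; averaging over [B] restores the full sum. *)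
Lemma strong_signal_f2 : n%:R <= f2 p k bmin ->
  'C(p, k)%:R * (tail / 2) <= \sum_(S : {set 'I_p} | #|S| == k) worst S.
Proof.
move=> nf; apply: sum_supersets_ge => // B Bk.
have b2 : 0 < bmin ^+ 2 by exact: exprn_gt0.
have cB : #|~: B|%SET = (p - k.-1)%N by rewrite cardsCs finset.setCK card_ord Bk.
pose M : R := p%:R - k%:R + 1.
have ME : (p - k.-1)%:R = M.
  by rewrite /M natrB; [|lia]; rewrite -{2}(prednK k_gt0) -natr1; ring.
have M2 : 2 <= M by rewrite -ME (ler_nat _ 2); lia.
set r := bmin ^+ 2 * (1 - M^-1).
have br : bmin ^+ 2 / 2 <= r.
  apply: ler_wpM2l; first exact: ltW.
  have : M^-1 <= 2^-1 by rewrite lef_pV2 ?posrE//; lra.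
  lra.
pose D : {set {set 'I_p}} := [set (i |: B)%SET | i in ~: B]%SET.
have inj : {in ~: B &, injective (fun i => i |: B)%SET}.
  move=> i j; rewrite !inE => iB jB /setP/(_ i); rewrite !inE eqxx (negbTE iB) orbF.
  by rewrite orbF => /esym/eqP.
have cD : #|[in D]| = (p - k.-1)%N by rewrite (card_in_imset inj) cB.
have sD : \sum_(S in D) worst S = \sum_(i in ~: B) worst (i |: B)%SET by exact: big_imset.
have := strong (D := [in D]) (m := \col_j (if j \in B then bmin else bmin / M)) br.
rewrite cD ME sD; apply.
- by move=> S /imsetP[i]; rewrite inE => iB ->; exact: card_ext.
- move=> S /imsetP[i]; rewrite inE => iB ->.
  rewrite (bigID (fun j => j \in B))/= big1 ?add0r => [|j jB]; last first.
    by rewrite !mxE !inE jB orbT subrr expr0n.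
  rewrite (bigD1 i)//= !mxE !inE eqxx (negbTE iB)/=.
  rewrite (eq_bigr (fun=> (bmin / M) ^+ 2)) => [|j /andP[jB ji]]; last first.
    by rewrite !mxE !inE (negbTE ji) (negbTE jB) sub0r sqrrN.
  rewrite sumr_const.
  have -> : #|(fun j => (j \notin B) && (j != i))| = (p - k.-1).-1.
    rewrite -cB (cardsD1 i (~: B)%SET) inE iB add1n/=.
    by apply: eq_card => j; rewrite !inE andbC.
  rewrite -[_ *+ _]mulr_natl.
  have -> : (p - k.-1).-1%:R = M - 1.
    have h : (0 < p - k.-1)%N by lia.
    by rewrite -ME -[in RHS](prednK h) -natr1 addrK.
  rewrite /r; field; lra.
- by lia.
- by apply: log_condition => //; lra.
Qed.

End strong_signal.

Lemma few_measurements (rho : R) : 0 < rho -> rho < 1 -> (forall c, fine (mu [set c]) <= rho) ->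
  (n <= k.-1)%N ->
  'C(p, k)%:R * (nonsing_prob rho / 8) <= \sum_(S : {set 'I_p} | #|S| == k) worst S.
Proof.
move=> r0 r1 atoms nk; apply: sum_worst_single_swap => B i j Bk ij iB jB.
(* As [n <= k - 1], the size of [B], the default [i] is never reached below [n]. *)
pose c a := nth i (enum B) a.
have sB : size (enum B) = k.-1 by rewrite -cardE.
have lt a : (a < n)%N -> (a < size (enum B))%N.
  by move=> an; rewrite sB; exact: leq_trans nk.
have cB a : (a < n)%N -> c a \in B.
  by move=> an; rewrite -mem_enum; apply: mem_nth; exact: lt.
have cinj a b : (a < n)%N -> (b < n)%N -> c a = c b -> a = b.
  by move=> /lt an /lt bn /eqP; rewrite /c nth_uniq ?enum_uniq// => /eqP.
have dp := det_nonzero_prob model r0 r1 atoms cinj.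
have d0 : 0 < nonsing_prob rho by exact: expR_gt0.
have err l : l \notin B -> forall t : n.-tuple R, (forall a, 0 <= tnth t a) ->
    error X W g (l |: B)%SET (ext_signal bmin B c l t) <= worst (l |: B)%SET.
  move=> lB t t0; apply: error_le_worst.
  have [sE ge] := ext_signal_valid bmin_gt0 cB lB t0.
  by split => //; split; rewrite sE//; exact: card_ext.
have := confusable mg ij iB jB d0 dp (err i iB) (err j jB).
lra.
Qed.

(** One term per regime: [n bmin^2] bounded, [n] at most [f1] or [f2], and [n <= k - 1]. It depends
    on the entry law through [rho], but not on [n], [p], [k] or [bmin], as a limit argument
    requires. *)
Definition error_floor (rho : R) : R :=
  Num.min (expR (- (4 * (1 + 2 * (4 * tail_size)))) / 8)
    (Num.min (tail / 2) (nonsing_prob rho / 8)).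

Lemma sum_worst_ge (rho : R) : 0 < rho -> rho < 1 -> (forall c, fine (mu [set c]) <= rho) ->
  2 * tail_size <= n%:R ->
  n%:R <= Num.max (Num.max (f1 p k bmin) (f2 p k bmin)) (k%:R - 1) ->
  'C(p, k)%:R * error_floor rho <= \sum_(S : {set 'I_p} | #|S| == k) worst S.
Proof.
move=> r0 r1 atoms nL; have C0 : 0 <= 'C(p, k)%:R :> R by [].
(* Bounded [n bmin^2] is settled before the maximum is examined, so [f1] and [f2] come with the
   strength that the tail bound asks for. *)
have [weak _|strong] := leP (n%:R * bmin ^+ 2) (4 * tail_size).
  apply: le_trans (weak_signal weak); apply: ler_wpM2l => //.
  by rewrite /error_floor ge_min lexx.
rewrite !le_max => /orP[/orP[nf|nf]|nk].
- apply: le_trans (strong_signal_f1 nL (ltW strong) nf); apply: ler_wpM2l => //.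
  by rewrite /error_floor !ge_min lexx !orbT.
- apply: le_trans (strong_signal_f2 nL (ltW strong) nf); apply: ler_wpM2l => //.
  by rewrite /error_floor !ge_min lexx !orbT.
have nk' : (n <= k.-1)%N.
  rewrite -(ler_nat R); apply: (le_trans nk).
  by rewrite -{1}(prednK k_gt0) -natr1 addrK.
apply: le_trans (few_measurements r0 r1 atoms nk'); apply: ler_wpM2l => //.
by rewrite /error_floor !ge_min lexx !orbT.
Qed.

End worst_case.

Theorem theorem1 (R : realType) (mu : probability R R)
    (d : nat -> measure_display) (Omega : forall n, measurableType (d n))
    (P : forall n, probability (Omega n) R)
    (p k : nat -> nat) (bmin : nat -> R)
    (X : forall n, 'I_n -> 'I_(p n) -> {RV (P n) >-> R})
    (W : forall n, 'I_n -> {RV (P n) >-> R})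
    (mu_mean : ('E_mu[idfun] = 0)%E) (mu_variance : ('V_mu[idfun] = 1)%E)
    (k_gt0 : forall n, (1 <= k n)%N) (k_lt_p : forall n, (k n < p n)%N)
    (bmin_gt0 : forall n, 0 < bmin n)
    (model : forall n, measurement_model mu (X n) (W n)) :
  (exists g : forall n, decoder R n (p n),
     (forall n, measurable_decoder (g n)) /\
     asymptotically_reliable k bmin X W g) ->
  \forall n \near \oo,
    Num.max (Num.max (f1 (p n) (k n) (bmin n)) (f2 (p n) (k n) (bmin n)))
            ((k n)%:R - 1) < n%:R.
Proof.
case=> g [mg reliable].
have [rho [rho_gt0 rho_lt1 atoms]] := atoms_bounded mu_mean mu_variance.
have floor_gt0 : 0 < error_floor rho.
  by rewrite /error_floor !lt_min !divr_gt0 ?expR_gt0 ?tail_prob_gt0.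
(* For a set of the wrong size nothing is required and 0 is a placeholder, so that signals can be
   chosen for all [n] and [S] at once. *)
have worst_b n (S : {set 'I_(p n)}) : exists b, #|S| = k n ->
    valid_signals (k n) (bmin n) S b /\
    worst_error (k n) (X n) (W n) (g n) (bmin n) S / 2 <= error (X n) (W n) (g n) S b.
  have [Sk|Sk] := pselect (#|S| = k n); last by exists 0.
  have [b H] := worst_error_half (X n) (W n) (mg n) (bmin_gt0 n) Sk.
  by exists b.
pose b n S := sval (cid (worst_b n S)).
have bP n S := svalP (cid (worst_b n S)).
(* Reliability is applied to this one choice of nearly worst signals, which depends on the decoders
   [g]. *)
have /cvgrPdist_lt/(_ (error_floor rho / 2)) := reliable b (fun n S Sk => (bP n S Sk).1).
have f20 : 0 < error_floor rho / 2 by rewrite divr_gt0.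
move=> /(_ f20) small; near=> n.
have n_large : 2 * tail_size R <= n%:R by near: n; exact: nbhs_infty_ger.
have p_small : `|0 - p_err (X n) (W n) (k n) (g n) (b n)| < error_floor rho / 2 by near: n.
rewrite ltNge; apply/negP => n_le.
have := sum_worst_ge (model n) (mg n) (bmin_gt0 n) mu_mean mu_variance (k_gt0 n) (k_lt_p n)
  rho_gt0 rho_lt1 atoms n_large n_le.
have C0 : 0 < 'C(p n, k n)%:R :> R by rewrite ltr0n bin_gt0 ltnW.
have le2 : \sum_(S : {set 'I_(p n)} | #|S| == k n) worst_error (k n) (X n) (W n) (g n) (bmin n) S <=
    2 * \sum_(S : {set 'I_(p n)} | #|S| == k n) error (X n) (W n) (g n) S (b n S).
  rewrite mulr_sumr; apply: ler_sum => S /eqP Sk; have [_] := bP n S Sk.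
  by rewrite -/(b n S); lra.
have pE : \sum_(S : {set 'I_(p n)} | #|S| == k n) error (X n) (W n) (g n) S (b n S) =
    'C(p n, k n)%:R * p_err (X n) (W n) (k n) (g n) (b n).
  by rewrite /p_err mulrA divff ?mul1r// gt_eqF.
have p0 : 0 <= p_err (X n) (W n) (k n) (g n) (b n).
  apply: mulr_ge0; first by rewrite invr_ge0 ltW.
  by apply: sumr_ge0 => S _; exact: error_ge0.
move: p_small; rewrite sub0r normrN ger0_norm// => p_small.
(* The worst errors average at least the floor and at most [2 p_err], while [p_err] is below half of
   the floor. *)
move=> /le_trans/(_ le2); rewrite pE mulrCA ler_pM2l//.
lra.
Unshelve. all: by end_near.
Qed.
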